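(* The metric space $(HQ(\mathbb{D}), d_{\sup})$ is separable and non-compact. Moreover, as a subspace, $HQ(\mathbb{D})$ is closed in $(Q(\mathbb{D}), d_{\sup})$.
   Context: $\mathbb{D} = \{z \in \mathbb{C} : |z| < 1\}$ is the open unit disk. $Q(\mathbb{D})$ denotes the set of all quasiconformal mappings of $\mathbb{D}$ onto $\mathbb{D}$ (orientation-preserving homeomorphisms of $\mathbb{D}$ onto itself that are $K$-quasiconformal for some finite $K \geq 1$; $K$ may depend on the mapping). A complex-valued function $f = u + iv$ on a domain is called harmonic if its real part $u$ and imaginary part $v$ are both real-valued harmonic functions, i.e. $\Delta u = \Delta v = 0$. $HQ(\mathbb{D}) := \{ f \in Q(\mathbb{D}) : f \text{ is harmonic} \}$. Both sets carry the topology of uniform convergence, induced by the metric $d_{\sup}(f,g) := \sup_{z \in \mathbb{D}} |f(z) - g(z)|$. *)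

(* Defs.v *)
From HB Require Import structures.
From mathcomp Require Import all_boot all_order all_algebra.
From mathcomp Require Import all_classical all_reals all_analysis.
From mathcomp Require Import complex lra.

Set Implicit Arguments.
Unset Strict Implicit.
Unset Printing Implicit Defensive.

Import Order.TTheory GRing.Theory Num.Theory numFieldNormedType.Exports.
Import ComplexField.Normc.

Local Open Scope classical_set_scope.
Local Open Scope ring_scope.
Local Open Scope complex_scope.

(* The library puts the usual topology on [R[i]^o], not on the bare type [R[i]].
   The modulus [normc z] lives in [R], whereas [`|z|] lives in [R[i]]. *)
Definition unit_disk (R : realType) : set R[i]^o := [set z | normc z < 1].
Arguments unit_disk R _ : clear implicits.

(* The points of the disk, with the topology induced by that of [R[i]^o]. *)
Notation disk R := (set_type (unit_disk R)).

Section PlaneMaps.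
Context {R : realType}.
Local Notation C := (R[i]^o).
Local Notation D := (unit_disk R).
Local Notation mu := (@lebesgue_measure R).

(* A self-map of the disk, seen as a function on the whole plane by giving it
   the junk value 0 off the disk.  The disk being open, this value is irrelevant
   to local notions (partial derivatives, harmonicity...) at points of the disk. *)
Definition plane_map (f : disk R -> disk R) (z : C) : C :=
  if insub z is Some w then set_val (f w) else 0.

(* Partial derivatives with respect to x and y, where z = x + iy.  As usual
   with [derive1], these are total and only meaningful where they exist. *)
Definition partialx (u : C -> R) (z : C) : R :=
  derive1 (fun x : R => u (x +i* complex.Im z)) (complex.Re z).
Definition partialy (u : C -> R) (z : C) : R :=
  derive1 (fun y : R => u (complex.Re z +i* y)) (complex.Im z).

Definition C1_on (A : set C) (u : C -> R) : Prop := forall z, A z ->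
  [/\ derivable (fun x : R => u (x +i* complex.Im z)) (complex.Re z) 1,
      derivable (fun y : R => u (complex.Re z +i* y)) (complex.Im z) 1,
      {for z, continuous (partialx u)} & {for z, continuous (partialy u)}].

Definition C2_on (A : set C) (u : C -> R) : Prop :=
  [/\ C1_on A u, C1_on A (partialx u) & C1_on A (partialy u)].

Definition laplacian (u : C -> R) (z : C) : R :=
  partialx (partialx u) z + partialy (partialy u) z.

Definition harmonic_real (A : set C) (u : C -> R) : Prop :=
  C2_on A u /\ forall z, A z -> laplacian u z = 0.

Definition harmonic (A : set C) (f : C -> C) : Prop :=
  harmonic_real A (fun z => complex.Re (f z)) /\
  harmonic_real A (fun z => complex.Im (f z)).

Definition cpartialx (f : C -> C) (z : C) : C :=
  partialx (fun w => complex.Re (f w)) z +i*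
  partialx (fun w => complex.Im (f w)) z.
Definition cpartialy (f : C -> C) (z : C) : C :=
  partialy (fun w => complex.Re (f w)) z +i*
  partialy (fun w => complex.Im (f w)) z.

(* Wirtinger derivatives f_z and f_zbar. *)
Definition wirtinger (f : C -> C) (z : C) : C :=
  (cpartialx f z - (0 +i* 1) * cpartialy f z) / 2.
Definition wirtinger_bar (f : C -> C) (z : C) : C :=
  (cpartialx f z + (0 +i* 1) * cpartialy f z) / 2.

Definition absolutely_continuous (a b : R) (g : R -> C) : Prop :=
  forall e : R, 0 < e -> exists2 d : R, 0 < d &
    forall (n : nat) (s t : 'I_n -> R),
      (forall i, a <= s i /\ s i <= t i /\ t i <= b) ->
      (forall i j, i != j -> t i <= s j \/ t j <= s i) ->
      \sum_(i < n) (t i - s i) < d ->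
      \sum_(i < n) normc (g (t i) - g (s i)) < e.

(* Absolute continuity on lines: in every closed rectangle contained in A, the
   map is absolutely continuous on almost every horizontal segment and almost
   every vertical segment. *)
Definition ACL (A : set C) (f : C -> C) : Prop :=
  forall a b c d : R,
    (forall x y : R, a <= x <= b -> c <= y <= d -> A (x +i* y)) ->
    {ae mu, forall y, c <= y <= d ->
              absolutely_continuous a b (fun x => f (x +i* y))} /\
    {ae mu, forall x, a <= x <= b ->
              absolutely_continuous c d (fun y => f (x +i* y))}.

(* Lebesgue almost everywhere in A, the plane being identified with R * R. *)
Definition ae_on (A : set C) (P : C -> Prop) : Prop :=
  {ae (mu \x mu)%E, forall p : R * R, A (p.1 +i* p.2) -> P (p.1 +i* p.2)}.

Definition homeomorphism (X Y : topologicalType) (f : X -> Y) : Prop :=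
  continuous f /\ exists g : Y -> X, [/\ continuous g, cancel f g & cancel g f].

Definition circle_point (z0 : C) (r t : R) : C :=
  z0 + (r * cos t +i* (r * sin t)).

(* An injective continuous map preserves orientation when its local degree is
   +1: the image of any positively oriented circle bounding a closed disk in A
   winds once, counterclockwise, around the image of the centre.  Here [theta]
   is a continuous determination of arg (f (z0 + r e^{it}) - f z0). *)
Definition orientation_preserving (A : set C) (f : C -> C) : Prop :=
  forall (z0 : C) (r : R), 0 < r ->
    (forall z, normc (z - z0) <= r -> A z) ->
    exists theta : R -> R,
      [/\ {within `[0, 2 * pi], continuous theta},
          (forall t, 0 <= t <= 2 * pi ->
             let w := f (circle_point z0 r t) - f z0 in
             w = (normc w)%:C * (cos (theta t) +i* sin (theta t))) &
          theta (2 * pi) - theta 0 = 2 * pi].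

(* Analytic definition of K-quasiconformality: the dilatation bound is
   |f_zbar| <= k |f_z| almost everywhere, with k = (K - 1) / (K + 1). *)
Definition K_quasiconformal (K : R) (f : disk R -> disk R) : Prop :=
  [/\ homeomorphism f,
      orientation_preserving D (plane_map f),
      ACL D (plane_map f) &
      ae_on D (fun z => normc (wirtinger_bar (plane_map f) z) <=
                        (K - 1) / (K + 1) * normc (wirtinger (plane_map f) z))].

Definition quasiconformal (f : disk R -> disk R) : Prop :=
  exists2 K : R, 1 <= K & K_quasiconformal K f.

End PlaneMaps.

Record Q (R : realType) := MkQ {
  Qfun :> disk R -> disk R;
  Q_quasiconformal : quasiconformal Qfun }.

HB.instance Definition _ (R : realType) := gen_eqMixin (Q R).
HB.instance Definition _ (R : realType) := gen_choiceMixin (Q R).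

Section SupMetric.
Context {R : realType}.
Implicit Types f g h : Q R.

Definition d_sup f g : R :=
  sup (range (fun z : disk R => normc (set_val (f z) - set_val (g z)))).

Let nrm_triangle (x y z : R[i]) : normc (x - z) <= normc (x - y) + normc (y - z).
Proof. by rewrite -(subrKA y x (- z)); exact: le_normcD. Qed.

Let nrm_ge0 (x : R[i]) : 0 <= normc x.
Proof. by case: x => a b; exact: sqrtr_ge0. Qed.

Let in_disk (w : disk R) : normc (set_val w) < 1.
Proof. by have := set_mem (valP w). Qed.

Let D0 : unit_disk R 0.
Proof. by rewrite /unit_disk /= expr0n /= addr0 sqrtr0. Qed.

Let disk0 : disk R := exist _ 0 (mem_set D0).

Let dist_sup f g :
  has_sup (range (fun z : disk R => normc (set_val (f z) - set_val (g z)))).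
Proof.
split; first by exists (normc (set_val (f disk0) - set_val (g disk0))), disk0.
exists 2 => _ [z _ <-].
apply: (le_trans (nrm_triangle _ 0 _)); rewrite subr0 sub0r normcN.
by have := ltW (in_disk (f z)); have := ltW (in_disk (g z)); lra.
Qed.

Let le_d_sup f g z : normc (set_val (f z) - set_val (g z)) <= d_sup f g.
Proof. by apply: (ub_le_sup (dist_sup f g).2); exists z. Qed.

Let d_sup_le f g (c : R) :
  (forall z, normc (set_val (f z) - set_val (g z)) <= c) -> d_sup f g <= c.
Proof.
by move=> fg; apply: (ge_sup (dist_sup f g).1) => _ [z _ <-]; exact: fg.
Qed.

Lemma d_supxx f : d_sup f f = 0.
Proof.
apply/eqP; rewrite eq_le (le_trans _ (le_d_sup f f disk0)) ?nrm_ge0// andbT.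
by apply: d_sup_le => z; rewrite subrr normc0.
Qed.

Lemma d_sup_positivity f g : d_sup f g = 0 -> f = g.
Proof.
case: f g => [f qf] [g qg] fg0.
suff fg : f = g by subst g; rewrite (Prop_irrelevance qf qg).
apply/funext => z; apply/val_inj; apply/eqP; rewrite -subr_eq0; apply/eqP.
apply: (@eq0_normc R); apply/eqP; rewrite eq_le nrm_ge0 andbT -fg0.
exact: (le_d_sup (MkQ qf) (MkQ qg)).
Qed.

Lemma d_sup_sym f g : d_sup f g = d_sup g f.
Proof.
rewrite /d_sup; congr sup.
apply: (congr1 (fun u : disk R -> R => range u)); apply/funext => z.
by rewrite -normcN opprB.
Qed.

Lemma d_sup_triangle g f h : d_sup f h <= d_sup f g + d_sup g h.
Proof.
apply: d_sup_le => z; apply: (le_trans (nrm_triangle _ (set_val (g z)) _)).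
by apply: lerD; exact: le_d_sup.
Qed.

End SupMetric.

HB.instance Definition _ (R : realType) :=
  @isMetric.Build R (Q R) d_sup d_supxx d_sup_positivity d_sup_sym d_sup_triangle.

(* A subset of a metric space, as a metric space for the restricted distance. *)
Section SubMetric.
Context {R : realType} {X : metricType R} (A : set X).

Let sub_dist (x y : set_type A) : R := mdist (set_val x) (set_val y).

Let sub_dist_ge0 x y : 0 <= sub_dist x y.
Proof. exact: mdist_ge0. Qed.

Let sub_dist_positivity x y : sub_dist x y = 0 -> x = y.
Proof. by move=> xy0; apply: val_inj; exact: mdist_positivity xy0. Qed.

Let sub_ballE x d : ball x d = [set y | sub_dist x y < d].
Proof.
by rewrite -[LHS]/(set_val @^-1` ball (set_val x) d) ballEmdist.
Qed.

HB.instance Definition _ := @PseudoMetric_isMetric.Build R (set_type A)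
  sub_dist sub_dist_ge0 sub_dist_positivity sub_ballE.

End SubMetric.

Definition HQ (R : realType) : set (Q R) :=
  [set f | harmonic (unit_disk R) (plane_map f)].
Arguments HQ R _ : clear implicits.

Definition separable (T : topologicalType) : Prop :=
  exists2 A : set T, countable A & dense A.

(* Main.v *)
Require Import Defs.
From mathcomp Require Import all_boot all_order all_algebra.
From mathcomp Require Import all_classical all_reals all_analysis.
From mathcomp Require Import complex lra ring zify.

(** Closedness.  A uniform limit of harmonic functions is harmonic.  The maximum
    principle, applied to the difference of a function and of its mirror image in a
    square, bounds the first derivatives of a harmonic function at a point by its
    supremum on a disk around this point; applied to difference quotients, it bounds
    the second derivatives as well ([gradient_estimate],
    [second_derivative_estimate]).  Thus uniform convergence entails locally uniform
    convergence of the derivatives up to order two, and the Laplacian passes to the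
    limit ([harmonic_real_limit], [HQ_closed]).

    Non-compactness.  The Moebius maps [z |-> (z + a) / (1 + a z)] with [0 <= a < 1]
    are harmonic and 1-quasiconformal, and their values [a] at [0] come arbitrarily
    close to the circle.  On a compact space the continuous function [f |-> |f 0|],
    which is everywhere less than 1, would have a maximum less than 1
    ([HQ_not_compact]).

    Separability.  It suffices that every map of the space be uniformly continuous:
    it is then determined up to a small error by finitely many integers
    ([HQ_separable]).  A harmonic quasiconformal map [F] is smooth and satisfies the
    dilatation inequality at every point, so it maps a small disk onto a set that
    contains a disk of comparable size, unless its oscillation there is negligible
    ([image_covers]).  Images of disjoint disks are disjoint and lie in the unit
    disk, hence the sum of the squares of the oscillations of [F] along the edges of
    a fine grid is bounded ([discrete_energy]).  Around a boundary point, seen as the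
    origin of a half-plane, the grid splits into concentric shells, and the shell
    number [k] has about [4 k] edges; by the Cauchy-Schwarz inequality and the
    divergence of the harmonic series, some shell at a controlled distance has an
    image of small diameter ([pigeonhole_length], [short_shell]).  This image cuts a
    small cap off the disk, and the inside of the shell is mapped to this cap because
    the complement of a cap in a disk is convex ([boundary_oscillation],
    [qc_unif_continuous]). *)

Set Implicit Arguments.
Unset Strict Implicit.
Unset Printing Implicit Defensive.

Import Order.TTheory GRing.Theory Num.Theory numFieldNormedType.Exports.
Import ComplexField.Normc.

Local Open Scope classical_set_scope.
Local Open Scope ring_scope.
Local Open Scope complex_scope.

(** * Real modulus, compact disks, and derivatives on the line *)

Section ComplexPlane.
Context {R : realType}.
Local Notation C := (R[i]^o).
Implicit Types (z w : R[i]) (x y e d r : R).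

Lemma normc_ge0 z : 0 <= normc z.
Proof. by case: z => a b; exact: sqrtr_ge0. Qed.

Lemma normcE x y : normc (x +i* y) = Num.sqrt (x ^+ 2 + y ^+ 2).
Proof. by []. Qed.

Lemma normc_sqr z : normc z ^+ 2 = complex.Re z ^+ 2 + complex.Im z ^+ 2.
Proof. by case: z => a b; rewrite normcE sqr_sqrtr//= addr_ge0// sqr_ge0. Qed.

Lemma normc_lt z r : 0 <= r ->
  (normc z < r) = (complex.Re z ^+ 2 + complex.Im z ^+ 2 < r ^+ 2).
Proof. by move=> r0; rewrite -normc_sqr ltr_pXn2r// nnegrE normc_ge0. Qed.

Lemma normc_le z r : 0 <= r ->
  (normc z <= r) = (complex.Re z ^+ 2 + complex.Im z ^+ 2 <= r ^+ 2).
Proof. by move=> r0; rewrite -normc_sqr ler_pXn2r// nnegrE normc_ge0. Qed.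

Lemma normc_triangle w z v : normc (z - v) <= normc (z - w) + normc (w - v).
Proof. by rewrite -(subrKA w z (- v)); exact: le_normcD. Qed.

Lemma distcC z w : normc (z - w) = normc (w - z).
Proof. by rewrite -normcN opprB. Qed.

Lemma le_normcB z w : normc z <= normc w + normc (z - w).
Proof. by rewrite -{1}(subrK w z) addrC; exact: le_normcD. Qed.

Lemma normc_Re z : `|complex.Re z| <= normc z.
Proof.
rewrite -sqrtr_sqr; case: z => a b; rewrite normcE/= ler_sqrt ?addr_ge0 ?sqr_ge0//.
by rewrite lerDl sqr_ge0.
Qed.

Lemma normc_Im z : `|complex.Im z| <= normc z.
Proof.
rewrite -sqrtr_sqr; case: z => a b; rewrite normcE/= ler_sqrt ?addr_ge0 ?sqr_ge0//.
by rewrite lerDr sqr_ge0.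
Qed.

Lemma normc_real x : normc x%:C = `|x|.
Proof. by rewrite normcE expr0n/= addr0 sqrtr_sqr. Qed.

Lemma normc_imag x : normc (0 +i* x) = `|x|.
Proof. by rewrite normcE expr0n/= add0r sqrtr_sqr. Qed.

Lemma normc_ReIm z : normc z <= `|complex.Re z| + `|complex.Im z|.
Proof.
case: z => a b; rewrite normc_le ?addr_ge0//=.
rewrite -(real_normK (num_real a)) -(real_normK (num_real b)).
by have := normr_ge0 a; have := normr_ge0 b; nra.
Qed.

(** The norm of [R[i]] takes its values in [R[i]]; from here on the topology of the
    plane is handled through the real modulus [normc]. *)
Lemma nbhs_normc (z : C) (A : set C) :
  nbhs z A <-> exists2 e : R, 0 < e & forall w, normc (w - z) < e -> A w.
Proof.
split.
- move=> /nbhs_ballP [e /= e0 H]; exists (complex.Re e).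
    by move: e0; case: (e) => a b /=; rewrite ltcE /= => /andP[].
  move=> w wz; apply: H; rewrite -ball_normE /ball_ /=.
  rewrite -normrN opprB; move: e0 wz; case: e => a b.
  by rewrite /Num.norm/= !ltcE /= => /andP[/eqP -> _] ->; rewrite eqxx.
- move=> [e e0 H]; apply/nbhs_ballP; exists e%:C => /=.
    by rewrite ltcE /= eqxx.
  move=> w; rewrite -ball_normE /ball_ /= => wz; apply: H.
  by move: wz; rewrite -normrN opprB /Num.norm/= ltcE /= => /andP[].
Qed.

Lemma continuousC_epsP (u : C -> R) (z : C) : {for z, continuous u} <->
  forall e, 0 < e -> exists2 d, 0 < d &
    forall w, normc (w - z) < d -> `|u w - u z| < e.
Proof.
split=> [uz e e0|H].
- have /nbhs_normc[d d0 H] : nbhs z [set w | `|u w - u z| < e].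
    have /cvgrPdist_lt/(_ _ e0) := uz.
    by apply: (@filterS _ _ (nbhs_filter z)) => w /=; rewrite distrC.
  by exists d.
- apply/(@cvgrPdist_lt _ _ _ _ (nbhs_filter z)) => e e0; apply/nbhs_normc.
  have [d d0 Hd] := H _ e0; exists d => // w /Hd.
  by rewrite distrC.
Qed.

Lemma continuousR_epsP (u : R -> R) x : {for x, continuous u} <->
  forall e, 0 < e -> exists2 d, 0 < d &
    forall y, `|y - x| < d -> `|u y - u x| < e.
Proof.
split=> [uz e e0|H].
- have /nbhs_ballP[d d0 H] : nbhs x [set w | `|u w - u x| < e].
    have /cvgrPdist_lt/(_ _ e0) := uz.
    by apply: (@filterS _ _ (nbhs_filter x)) => w /=; rewrite distrC.
  by exists d => // y xy; apply: H; rewrite /ball/= distrC.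
- apply/cvgrPdist_lt => e e0; apply/nbhs_ballP.
  have [d d0 Hd] := H _ e0; exists d => // w.
  by rewrite /ball/= distrC => /Hd; rewrite distrC.
Qed.

Lemma continuous_mkC (p : R * R) :
  {for p, continuous (fun p : R * R => (p.1 +i* p.2 : C))}.
Proof.
move=> A /nbhs_normc[e e0 H]; apply/nbhs_ballP; exists (e / 2) => /=; first lra.
move=> q [h1 h2]; apply: H; apply: (le_lt_trans (normc_ReIm _)).
by move: h1 h2; rewrite /ball/= distrC (distrC p.2); lra.
Qed.

Lemma compact_rect x1 x2 y1 y2 :
  compact [set z : C | x1 <= complex.Re z <= x2 /\ y1 <= complex.Im z <= y2].
Proof.
have -> : [set z : C | x1 <= complex.Re z <= x2 /\ y1 <= complex.Im z <= y2] =
  (fun p : R * R => (p.1 +i* p.2 : C)) @` (`[x1, x2] `*` `[y1, y2]).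
  apply/seteqP; split=> [[a b] /= [h1 h2]|_ [[a b] [/= h1 h2] <-]].
    by exists (a, b) => //; split; rewrite /= in_itv.
  by move: h1 h2; rewrite /= !in_itv.
apply: continuous_compact.
  by apply: continuous_subspaceT => p; exact: continuous_mkC.
by apply: compact_setX; exact: segment_compact.
Qed.

Lemma continuous_normc (w z : C) : {for z, continuous (fun z : C => normc (z - w))}.
Proof.
apply/continuousC_epsP => e e0; exists e => // v vz.
apply: le_lt_trans vz; rewrite ler_norml.
have := normc_triangle v z w; have := normc_triangle z v w.
by rewrite (distcC z v) => ? ?; apply/andP; split; lra.
Qed.

Lemma compact_cdisk r : compact [set z : C | normc z <= r].
Proof.
apply: (@subclosed_compact C _ _ _ (@compact_rect (-r) r (-r) r)).
  have -> : [set z : C | normc z <= r] = (fun z : C => normc (z - 0)) @^-1` [set x | x <= r].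
    by apply/seteqP; split => z /=; rewrite subr0.
  apply: preimage_closed; last exact: closed_le.
  by move=> z _; exact: continuous_normc.
move=> z /= zr; have := le_trans (normc_Re z) zr; have := le_trans (normc_Im z) zr.
by rewrite !ler_norml.
Qed.

(** The usual Heine--Cantor argument, in the form that allows the second point
    to leave the compact set. *)
Lemma compact_unif_continuous (K : set C) (u : C -> R) e : compact K ->
  (forall z, K z -> {for z, continuous u}) -> 0 < e ->
  exists2 d, 0 < d & forall z, K z -> forall w, normc (w - z) < d -> `|u w - u z| < e.
Proof.
move=> /compact_near_coveringP cK uK e0.
pose P d z := forall w, normc (w - z) < d -> `|u w - u z| < e.
have near_P z : K z -> \forall z' \near (z : C) & d \near 0^'+, P d z'.
  move=> Kz; have [d d0 zd] := (continuousC_epsP _ _).1 (uK _ Kz) _ (divr_gt0 e0 (ltr0n _ 2)).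
  exists ([set w : C | normc (w - z) < d / 2], [set t | 0 < t < d / 2]) => /=.
    split; first by apply/nbhs_normc; exists (d / 2) => //; lra.
    near=> t; apply/andP; split; first by near: t; exact: nbhs_right_gt.
    by near: t; apply: nbhs_right_lt; lra.
  move=> [w t] /= [wz /andP[t0 td]] v vw.
  have /zd vz : normc (v - z) < d.
    by apply: (le_lt_trans (normc_triangle w _ _)); lra.
  have /zd {}wz : normc (w - z) < d by lra.
  rewrite -(subrKA (u z)) (le_lt_trans (ler_normD _ _))//.
  by rewrite (distrC (u z)); lra.
have : \forall d \near 0^'+, 0 < d /\ K `<=` P d.
  near=> d; split; first by near: d; exact: nbhs_right_gt.
  by near: d; exact: (cK _ _ P).
move=> /(@filter_ex _ _ _)[d [d0 KP]]; exists d => // z Kz w; exact: KP.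
Unshelve. all: end_near. Qed.

Lemma compact_max_C (K : set C) (u : C -> R) : K !=set0 -> compact K ->
  (forall z, K z -> {for z, continuous u}) ->
  exists2 c, K c & forall z, K z -> u z <= u c.
Proof.
move=> K0 cK uK.
have [|c /set_mem Kc cmax] := compact_EVT_max K0 cK (f := u).
  apply/subspace_continuousP => z Kz.
  by apply: cvg_within_filter; exact: uK.
by exists c => // z Kz; apply: cmax; exact: mem_set.
Qed.

Lemma IVT_at (u : R -> R) a b v : a <= b ->
  (forall t, a <= t <= b -> {for t, continuous u}) -> u a <= v -> v <= u b ->
  exists2 t, a <= t <= b & u t = v.
Proof.
move=> ab uc ua ub.
have [||t] := @IVT _ u a b v ab.
- apply/subspace_continuousP => z; rewrite /= in_itv => zab.
  by apply: cvg_within_filter; exact: uc.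
- by rewrite ge_min ua/= le_max ub orbT.
by rewrite in_itv => tab <-; exists t.
Qed.

Lemma is_derive_epsP (u : R -> R) x l : is_derive x 1 u l <->
  forall e, 0 < e -> exists2 d, 0 < d &
    forall t, `|t| < d -> `|u (x + t) - u x - l * t| <= e * `|t|.
Proof.
have E (h : R) : h != 0 -> h^-1 *: ((u \o shift x) (h *: 1) - u x) - l =
    h^-1 * (u (x + h) - u x - l * h).
  by move=> h0; rewrite /= /GRing.scale/= mulr1 addrC (addrC h x); field.
split=> [[du <-] e e0|H].
- have /cvgrPdist_lt/(_ _ e0)[d d0 Hd] := du.
  exists d => // t td; have [->|t0] := eqVneq t 0.
    by rewrite addr0 subrr mulr0 subrr !normr0 mulr0.
  have := Hd t; rewrite /ball_/= sub0r normrN => /(_ td t0).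
  rewrite -/('D_1 u x) distrC; set L := 'D_1 u x.
  have -> : t^-1 *: (u (t *: 1 + x) - u x) - L = t^-1 * (u (x + t) - u x - L * t).
    by rewrite /GRing.scale/= mulr1 (addrC t x); field.
  rewrite normrM normfV ltr_pdivrMl ?normr_gt0// => /ltW.
  by rewrite (mulrC _ e).
- have cv : (fun h => h^-1 *: ((u \o shift x) (h *: 1) - u x)) @ 0^' --> l.
    apply/cvgrPdist_le => e e0; have [d d0 Hd] := H _ e0.
    exists d => // t; rewrite /ball_/= sub0r normrN => td t0.
    rewrite distrC E// normrM normfV ler_pdivrMl ?normr_gt0// (mulrC _ e).
    exact: Hd.
  by apply: DeriveDef; [exact: cvgP cv | exact: cvg_lim cv].
Qed.

Lemma derive1_val (u : R -> R) x l : is_derive x 1 u l -> derive1 u x = l.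
Proof. by move=> du; rewrite derive1E derive_val. Qed.

Lemma is_derive1 (u : R -> R) x : derivable u x 1 -> is_derive x 1 u (derive1 u x).
Proof. by move=> du; rewrite derive1E; exact: derivableP. Qed.

Lemma is_derive_cvg_at (u : R -> R) x l : is_derive x 1 u l -> {for x, continuous u}.
Proof.
by move=> [du _]; apply: differentiable_continuous; exact/derivable1_diffP.
Qed.

(** The mean value theorem with the increment on either side of the base point. *)
Lemma MVT_increment (u du : R -> R) x t :
  (forall s, `|s| <= `|t| -> is_derive (x + s) 1 u (du (x + s))) ->
  exists2 s, `|s| <= `|t| & u (x + t) - u x = du (x + s) * t.
Proof.
move=> H.
have H' s : `|s - x| <= `|t| -> is_derive s 1 u (du s).
  by move=> /H; rewrite addrC subrK.
have [t0|t0|->] := ltrgtP t 0; last first.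
- by exists 0; rewrite ?normr0// addr0 subrr mulr0.
- have [|||c] := @MVT _ u du x (x + t).
  + lra.
  + move=> s; rewrite in_itv/= => /andP[s1 s2]; apply: H'.
    by rewrite !ger0_norm; lra.
  + apply/subspace_continuousP => z; rewrite /= in_itv/= => /andP[z1 z2].
    apply: cvg_within_filter; apply: is_derive_cvg_at; apply: H'.
    by rewrite !ger0_norm; lra.
  rewrite in_itv/= => /andP[c1 c2] E; exists (c - x).
    by rewrite !ger0_norm; lra.
  have -> : x + (c - x) = c by lra.
  by rewrite E addrAC subrr add0r.
- have [|||c] := @MVT _ u du (x + t) x.
  + lra.
  + move=> s; rewrite in_itv/= => /andP[s1 s2]; apply: H'.
    by rewrite !ler0_norm; lra.
  + apply/subspace_continuousP => z; rewrite /= in_itv/= => /andP[z1 z2].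
    apply: cvg_within_filter; apply: is_derive_cvg_at; apply: H'.
    by rewrite !ler0_norm; lra.
  rewrite in_itv/= => /andP[c1 c2] E; exists (c - x).
    by rewrite !ler0_norm; lra.
  have -> : x + (c - x) = c by lra.
  by rewrite -opprB E; lra.
Qed.

End ComplexPlane.

(** * Partial derivatives along the two axes *)

Section AxisDerivatives.
Context {R : realType}.
Local Notation C := (R[i]^o).
Implicit Types (z w : R[i]) (x y e d r t s l : R) (b : bool) (u v : C -> R) (A : set C).

(** Indexing the two axes by a boolean lets every argument about partial derivatives
    be given once. *)
Definition axis b : R[i] := if b then 0 +i* 1 else 1.

Definition axis_pd b u (z : C) : R := if b then partialy u z else partialx u z.

Definition is_axis_deriv b u z l : Prop :=
  is_derive (0 : R) 1 (fun t => u (z + t%:C * axis b)) l.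

Lemma add_axisE b t z : z + t%:C * axis b =
  if b then complex.Re z +i* (complex.Im z + t) else (complex.Re z + t) +i* complex.Im z.
Proof.
by case: b; case: z => x y; apply/eqP; rewrite eq_complex /=; apply/andP; split; apply/eqP; ring.
Qed.

Lemma normc_axis b t : normc (t%:C * axis b) = `|t|.
Proof. by case: b; rewrite normcM normc_real ?normc_imag ?normc1 ?normr1 mulr1. Qed.

Lemma is_axis_deriv_epsP b u z l : is_axis_deriv b u z l <->
  forall e, 0 < e -> exists2 d, 0 < d &
    forall t, `|t| < d -> `|u (z + t%:C * axis b) - u z - l * t| <= e * `|t|.
Proof.
rewrite /is_axis_deriv is_derive_epsP.
by split=> H e /H[d d0 Hd]; exists d => // t /Hd; rewrite add0r mul0r addr0.
Qed.

Lemma is_axis_derivE b u z l : is_axis_deriv b u z l <->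
  if b then is_derive (complex.Im z) 1 (fun y => u (complex.Re z +i* y)) l
  else is_derive (complex.Re z) 1 (fun x => u (x +i* complex.Im z)) l.
Proof.
rewrite is_axis_deriv_epsP; case: b; rewrite is_derive_epsP;
  split=> H e /H[d d0 Hd]; exists d => // t /Hd; rewrite add_axisE;
  by case: (z).
Qed.

Lemma is_axis_deriv_pd b u z l : is_axis_deriv b u z l -> axis_pd b u z = l.
Proof. by move=> /is_axis_derivE; case: b => /= /derive1_val. Qed.

Lemma C1_onP A u : C1_on A u <->
  forall z, A z -> forall b, is_axis_deriv b u z (axis_pd b u z) /\ {for (z : C), continuous (axis_pd b u)}.
Proof.
split=> H z /H.
- move=> [dx dy cx cy]; case.
    by split; [apply/is_axis_derivE; exact: is_derive1 | exact: cy].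
  by split; [apply/is_axis_derivE; exact: is_derive1 | exact: cx].
- move=> {}H; have [d1 c1] := H true; have [d0 c0] := H false; split.
  + by have /is_axis_derivE[] := d0.
  + by have /is_axis_derivE[] := d1.
  + exact: c0.
  + exact: c1.
Qed.

Lemma C2_onP A u : C2_on A u <-> C1_on A u /\ forall b, C1_on A (axis_pd b u).
Proof.
split=> [[H1 H2 H3]|[H1 H]]; last first.
  by split; [exact: H1|exact: (H false)|exact: (H true)].
by split; [exact: H1|case; [exact: H3|exact: H2]].
Qed.

Lemma is_axis_deriv_shift b u z s l : is_axis_deriv b u (z + s%:C * axis b) l ->
  is_derive s 1 (fun t => u (z + t%:C * axis b)) l.
Proof.
move=> /is_axis_deriv_epsP H; apply/is_derive_epsP => e /H[d d0 Hd]; exists d => // t /Hd.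
have -> : z + s%:C * axis b + t%:C * axis b = z + (s + t)%:C * axis b.
  by rewrite rmorphD/=; ring.
by [].
Qed.

Lemma MVT_axis A b u z t : C1_on A u ->
  (forall s, `|s| <= `|t| -> A (z + s%:C * axis b)) ->
  exists2 s, `|s| <= `|t| &
    u (z + t%:C * axis b) - u z = axis_pd b u (z + s%:C * axis b) * t.
Proof.
move=> /C1_onP uA At.
have [s|s st] := @MVT_increment _ (fun t => u (z + t%:C * axis b))
    (fun t => axis_pd b u (z + t%:C * axis b)) 0 t.
  rewrite add0r => st; apply: is_axis_deriv_shift.
  by have [] := uA _ (At _ st) b.
by rewrite !add0r mul0r addr0 => E; exists s.
Qed.

Lemma open_normc A z : open A -> A z ->
  exists2 r, 0 < r & forall w, normc (w - z) < r -> A w.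
Proof. by move=> oA Az; apply/nbhs_normc; exact: open_nbhs_nbhs. Qed.

Lemma ReIm_le_axes z : `|complex.Re z| + `|complex.Im z| <= 2 * normc z.
Proof. by have := normc_Re z; have := normc_Im z; lra. Qed.

Lemma C1_increment A u z z0 r e h : C1_on A u ->
  (forall w, normc (w - z) < r -> A w) ->
  (forall w, normc (w - z) < r -> forall b, `|axis_pd b u w - axis_pd b u z0| <= e) ->
  normc h < r ->
  `|u (z + h) - u z - (axis_pd false u z0 * complex.Re h + axis_pd true u z0 * complex.Im h)|
    <= 2 * e * normc h.
Proof.
move=> uA Ar ur; case: h => a b vr.
have aN := normc_Re (a +i* b); have bN := normc_Im (a +i* b).
have in_disk s t : `|s| <= `|a| -> `|t| <= `|b| -> normc (s +i* t) < r.
  move=> sa tb; apply: le_lt_trans vr; rewrite normc_le ?normc_ge0// normc_sqr/=.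
  by apply: lerD; rewrite -[leLHS]real_normK ?num_real// -[leRHS]real_normK ?num_real//
    ler_pXn2r// nnegrE.
have E1 : z + (a +i* b) = z + a%:C * axis false + b%:C * axis true.
  by case: (z) => x y; apply/eqP; rewrite !add_axisE/= eq_complex /= !eqxx.
have [|s sa Es] := @MVT_axis A false u z a uA.
  move=> s sa; apply: Ar; rewrite addrC addKr normc_axis.
  by apply: (le_lt_trans sa); apply: (le_lt_trans aN).
have [|t tb Et] := @MVT_axis A true u (z + a%:C * axis false) b uA.
  move=> t tb; apply: Ar.
  have -> : z + a%:C * axis false + t%:C * axis true - z = a +i* t.
    by case: (z) => x y; apply/eqP; rewrite !add_axisE/= eq_complex /=; apply/andP; split; apply/eqP; ring.
  exact: in_disk.
rewrite E1.
have -> : forall p q r0 s0 : R, p - q - (r0 * a + s0 * b) =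
   (p - u (z + a%:C * axis false) - s0 * b) + (u (z + a%:C * axis false) - q - r0 * a).
  by move=> *; ring.
rewrite Es Et -!mulrBl; apply: (le_trans (ler_normD _ _)); rewrite !normrM.
have H1 : `|axis_pd true u (z + a%:C * axis false + t%:C * axis true) - axis_pd true u z0| <= e.
  apply: ur.
  have -> : z + a%:C * axis false + t%:C * axis true - z = a +i* t.
    by case: (z) => x y; apply/eqP; rewrite !add_axisE/= eq_complex /=; apply/andP; split; apply/eqP; ring.
  exact: in_disk.
have H2 : `|axis_pd false u (z + s%:C * axis false) - axis_pd false u z0| <= e.
  apply: ur; rewrite addrC addKr normc_axis.
  by apply: (le_lt_trans sa); apply: (le_lt_trans aN).
have := ler_wpM2r (normr_ge0 b) H1; have := ler_wpM2r (normr_ge0 a) H2.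
have := le_trans (normr_ge0 _) H1 => e0.
have := ler_wpM2l e0 (ReIm_le_axes (a +i* b)); rewrite [complex.Re _]/= [complex.Im _]/=.
by lra.
Qed.

Lemma C1_locally A u z e : open A -> C1_on A u -> A z -> 0 < e ->
  exists r, [/\ 0 < r, forall w, normc (w - z) < r -> A w &
    forall w, normc (w - z) < r -> forall b, `|axis_pd b u w - axis_pd b u z| <= e].
Proof.
move=> oA /C1_onP uA Az e0; have [r r0 rA] := open_normc oA Az.
have [_ /continuousC_epsP/(_ _ e0)[r1 r10 H1]] := uA _ Az true.
have [_ /continuousC_epsP/(_ _ e0)[r2 r20 H2]] := uA _ Az false.
exists (Num.min r (Num.min r1 r2)); split; first by rewrite !lt_min r0 r10 r20.
  by move=> w; rewrite lt_min => /andP[/rA].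
by move=> w; rewrite !lt_min => /and3P[_ /H1 ? /H2 ?] []; exact: ltW.
Qed.

Lemma C1_continuous A u (z : C) : open A -> C1_on A u -> A z -> {for z, continuous u}.
Proof.
move=> oA uA Az; have [r [r0 rA ru]] := C1_locally oA uA Az ltr01.
apply/continuousC_epsP => e e0.
pose c := `|axis_pd false u z| + `|axis_pd true u z| + 2.
have c0 : 0 < c by rewrite /c; have := normr_ge0 (axis_pd false u z); have := normr_ge0 (axis_pd true u z); lra.
exists (Num.min r (e / c)); first by rewrite lt_min r0 divr_gt0.
move=> w; rewrite lt_min => /andP[wr]; rewrite ltr_pdivlMr// => we.
have := C1_increment uA rA ru wr.
rewrite [z + _]addrC subrK => H.
have hx := ler_wpM2l (normr_ge0 (axis_pd false u z)) (normc_Re (w - z)).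
have hy := ler_wpM2l (normr_ge0 (axis_pd true u z)) (normc_Im (w - z)).
move: hx hy; rewrite -!normrM.
set X := _ * complex.Re _ in H *; set Y := _ * complex.Im _ in H * => hx hy.
have := ler_normD (u w - u z - (X + Y)) (X + Y); rewrite subrK.
have := ler_normD X Y; rewrite /c in we; lra.
Qed.

(** Second order expansion along an axis, symmetrised so that only the first
    derivative has to be differentiable, and only at the centre. *)
Lemma second_difference A u z b e : open A -> C2_on A u -> A z -> 0 < e ->
  exists2 d, 0 < d & forall t, 0 < t -> t < d ->
  `|u (z + t%:C * axis b) + u (z - t%:C * axis b) - 2 * u z - axis_pd b (axis_pd b u) z * t ^+ 2|
    <= e * t ^+ 2.
Proof.
move=> oA /C2_onP[/C1_onP u1 /(_ b)/C1_onP u2] Az e0.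
have [r r0 rA] := open_normc oA Az.
have e2 : 0 < e / 2 by lra.
have [/is_axis_deriv_epsP/(_ _ e2)[d d0 Hd] _] := u2 _ Az b.
exists (Num.min r d); first by rewrite lt_min r0 d0.
move=> t t0; rewrite lt_min => /andP[tr td].
set l := axis_pd b (axis_pd b u) z in Hd *.
have dirA s : `|s| <= t -> A (z + s%:C * axis b).
  by move=> st; apply: rA; rewrite addrC addKr normc_axis (le_lt_trans st).
pose g s := u (z + s%:C * axis b).
have dg s : `|s| <= t -> is_derive s 1 g (axis_pd b u (z + s%:C * axis b)).
  by move=> /dirA/u1/(_ b)[+ _]; exact: is_axis_deriv_shift.
(* Subtracting the quadratic term before using the mean value theorem gives the right
   constant. *)
pose k s := g s + g (- s) - l * s ^+ 2.
have dk s : `|s| <= t -> is_derive s 1 k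
    (axis_pd b u (z + s%:C * axis b) - axis_pd b u (z + (- s)%:C * axis b) - 2 * l * s).
  move=> st; have d1 := dg _ st.
  have d2 : is_derive (- s) 1 g (axis_pd b u (z + (- s)%:C * axis b)).
    by apply: dg; rewrite normrN.
  have d3 : is_derive s 1 (g \o -%R) (- axis_pd b u (z + (- s)%:C * axis b)).
    apply/is_derive_epsP => e' e'0.
    have /is_derive_epsP/(_ _ e'0)[d' d'0 Hd'] := d2.
    exists d' => // h hd; have := Hd' (- h); rewrite normrN => /(_ hd).
    by rewrite /= opprD mulrN mulNr.
  have d4 : is_derive s 1 (fun s : R => l * s ^+ 2) (2 * l * s).
    by apply: is_derive_eq; rewrite /GRing.scale/= ; ring.
  have := is_deriveB (is_deriveD d1 d3) d4; exact.
have [s|s] := @MVT_increment _ k (fun s => axis_pd b u (z + s%:C * axis b) -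
   axis_pd b u (z + (- s)%:C * axis b) - 2 * l * s) 0 t.
  by rewrite add0r (ger0_norm (ltW t0)) => /dk.
rewrite !add0r (ger0_norm (ltW t0)) => st Ek.
have -> : u (z + t%:C * axis b) + u (z - t%:C * axis b) - 2 * u z - l * t ^+ 2 =
    k t - k 0.
  by rewrite /k /g rmorphN/= mulNr expr0n/= oppr0 mul0r addr0 mulr0 subr0; ring.
rewrite Ek normrM (ger0_norm (ltW t0)) expr2 mulrA ler_pM2r//.
have sd : `|s| < d by apply: le_lt_trans td.
have h1 := Hd _ sd; have := Hd (- s); rewrite normrN => /(_ sd) h2.
set p := axis_pd b u (z + _) in h1 *; set q := axis_pd b u (z + _) in h2 *.
have -> : p - q - 2 * l * s =
  (p - axis_pd b u z - l * s) - (q - axis_pd b u z - l * - s) by ring.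
apply: (le_trans (ler_normB _ _)).
have := ler_wpM2l (ltW e0) st; lra.
Qed.

End AxisDerivatives.

(** * The maximum principle *)

Section WeaklyHarmonic.
Context {R : realType}.
Local Notation C := (R[i]^o).
Implicit Types (z w : R[i]) (x y e d r t s l M : R) (b : bool) (u v : C -> R) (A K : set C).

(** A twice differentiable function satisfies [cross_sum u z t = L * t ^+ 2 + o(t ^+ 2)],
    where [L] is its Laplacian.  The condition that the left-hand side be [o(t ^+ 2)]
    is all that the maximum principle requires, and it is obviously preserved by
    translations, rotations, reflections and differences. *)
Definition cross_sum u z t : R :=
  u (z + t%:C) + u (z - t%:C) + u (z + (0 +i* t)) + u (z - (0 +i* t)) - 4 * u z.

Definition weak_laplacian0 u z : Prop := forall e, 0 < e -> exists2 d, 0 < d &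
  forall t, 0 < t -> t < d -> `|cross_sum u z t| <= e * t ^+ 2.

Definition weakly_harmonic A u : Prop := forall z, A z ->
  {for (z : C), continuous u} /\ weak_laplacian0 u z.

Lemma harmonic_weak A u : open A -> harmonic_real A u -> weakly_harmonic A u.
Proof.
move=> oA [u2 lap] z Az; split.
  by apply: (C1_continuous oA _ Az); have /C2_onP[] := u2.
move=> e e0; have e2 : 0 < e / 2 by lra.
have [d0 d00 H0] := second_difference false oA u2 Az e2.
have [d1 d10 H1] := second_difference true oA u2 Az e2.
exists (Num.min d0 d1); first by rewrite lt_min d00.
move=> t t0; rewrite lt_min => /andP[td0 td1].
have h0 := H0 _ t0 td0; have h1 := H1 _ t0 td1.
have lap0 : axis_pd false (axis_pd false u) z + axis_pd true (axis_pd true u) z = 0 := lap _ Az.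
have it : t%:C * axis true = 0 +i* t :> R[i].
  by apply/eqP; rewrite eq_complex /=; apply/andP; split; apply/eqP; ring.
rewrite it in h1; rewrite mulr1 in h0; rewrite /cross_sum.
move: (u (z + t%:C)) (u (z - t%:C)) (u (z + (0 +i* t))) (u (z - (0 +i* t))) (u z)
  (axis_pd false (axis_pd false u) z) (axis_pd true (axis_pd true u) z) h0 h1 lap0
  => a c a' c' uz l0 l1 h0 h1 lap0.
have -> : a + c + a' + c' - 4 * uz = (a + c - 2 * uz - l0 * t ^+ 2) + (a' + c' - 2 * uz - l1 * t ^+ 2).
  have -> : l1 = - l0 by lra.
  ring.
apply: (le_trans (ler_normD _ _)).
lra.
Qed.

(** The maximum principle: adding a small multiple of [x ^ 2] makes the
    Laplacian positive, which forbids an interior maximum. *)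
Lemma max_principle K u M : compact K -> (forall z, K z -> `|complex.Re z| <= M) ->
  (forall z, K z -> {for (z : C), continuous u}) ->
  (forall z, K z -> u z <= 0 \/ nbhs (z : C) K /\ weak_laplacian0 u z) ->
  forall z, K z -> u z <= 0.
Proof.
move=> cK KM uc bd z0 Kz0; rewrite leNgt; apply/negP => u0.
(* Small enough for [e * x ^+ 2] to stay below [u z0] on [K]. *)
pose e := u z0 / (2 * (M ^+ 2 + 1)).
have M2 : 0 < M ^+ 2 + 1 by rewrite ltr_wpDl ?sqr_ge0.
have e0 : 0 < e by rewrite divr_gt0 ?mulr_gt0.
have eM : e * M ^+ 2 < u z0.
  rewrite /e mulrAC ltr_pdivrMr ?mulr_gt0// ltr_pM2l//.
  by have := sqr_ge0 M; lra.
pose g (z : C) := u z + e * complex.Re z ^+ 2.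
have gc z : K z -> {for (z : C), continuous g}.
  move=> Kz; apply: continuousD; first exact: uc.
  have cre : {for (z : C), continuous (fun z : C => complex.Re z)}.
    apply/continuousC_epsP => e' e'0; exists e' => // w; apply: le_lt_trans.
    by have := normc_Re (w - z); case: (w) (z) => ? ? [].
  apply: (@continuousM _ _ (fun=> e) (fun z : C => complex.Re z ^+ 2)); first exact: cst_continuous.
  by apply: (@continuousM _ _ (fun z : C => complex.Re z) (fun z : C => complex.Re z)).
have [c Kc cmax] := compact_max_C (ex_intro _ _ Kz0) cK gc.
have gz0 : u z0 <= g c.
  by apply: (le_trans _ (cmax _ Kz0)); rewrite lerDl mulr_ge0 ?sqr_ge0 ?ltW.
have [uc0|[/nbhs_normc[r r0 rK] lapc]] := bd _ Kc.
- have : e * complex.Re c ^+ 2 <= e * M ^+ 2.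
    rewrite ler_pM2l// -real_normK ?num_real//.
    by rewrite ler_pXn2r ?nnegrE// ?KM// (le_trans _ (KM _ Kc)).
  by move: gz0; rewrite /g; lra.
- have [d d0 Hd] := lapc _ e0.
  pose t := Num.min r d / 2.
  have t0 : 0 < t by rewrite divr_gt0// lt_min r0 d0.
  have [tr td] : t < r /\ t < d.
    have : Num.min r d <= r by rewrite ge_min lexx.
    have : Num.min r d <= d by rewrite ge_min lexx orbT.
    by move: t0; rewrite /t; lra.
  have := Hd _ t0 td; rewrite ler_norml => /andP[+ _].
  have near_c w : normc w < r -> u (c + w) + e * complex.Re (c + w) ^+ 2 <=
      u c + e * complex.Re c ^+ 2.
    by move=> wr; apply: cmax; apply: rK; rewrite addrC addKr.
  have := near_c t%:C; rewrite normc_real gtr0_norm// => /(_ tr).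
  have := near_c (- t%:C); rewrite normcN normc_real gtr0_norm// => /(_ tr).
  have := near_c (0 +i* t); rewrite normc_imag gtr0_norm// => /(_ tr).
  have := near_c (- (0 +i* t)); rewrite normcN normc_imag gtr0_norm// => /(_ tr).
  rewrite /cross_sum !raddfD !raddfN/=.
  have := exprn_gt0 2 t0; have := mulr_gt0 e0 (exprn_gt0 2 t0).
  by move: (complex.Re c) => X; nra.
Qed.

Lemma weak_laplacian0D (c1 c2 : R) u v z : weak_laplacian0 u z ->
  weak_laplacian0 v z -> weak_laplacian0 (fun z => c1 * u z + c2 * v z) z.
Proof.
move=> H1 H2 e e0.
pose k := `|c1| + `|c2| + 1.
have k0 : 0 < k by rewrite /k; have := normr_ge0 c1; have := normr_ge0 c2; lra.
have ek : 0 < e / k by rewrite divr_gt0.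
have [d1 d10 Hd1] := H1 _ ek; have [d2 d20 Hd2] := H2 _ ek.
exists (Num.min d1 d2); first by rewrite lt_min d10.
move=> t t0; rewrite lt_min => /andP[td1 td2].
have -> : cross_sum (fun z => c1 * u z + c2 * v z) z t =
  c1 * cross_sum u z t + c2 * cross_sum v z t by rewrite /cross_sum; ring.
apply: (le_trans (ler_normD _ _)); rewrite !normrM.
have := ler_wpM2l (normr_ge0 c1) (Hd1 _ t0 td1).
have := ler_wpM2l (normr_ge0 c2) (Hd2 _ t0 td2).
have -> : e * t ^+ 2 = k * (e / k * t ^+ 2) by field; rewrite gt_eqF.
have := mulr_gt0 ek (exprn_gt0 2 t0).
by rewrite /k; nra.
Qed.

Lemma weakly_harmonicD A (c1 c2 : R) u v : weakly_harmonic A u ->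
  weakly_harmonic A v -> weakly_harmonic A (fun z => c1 * u z + c2 * v z).
Proof.
move=> H1 H2 z Az; have [uc ul] := H1 _ Az; have [vc vl] := H2 _ Az; split.
  apply: (@continuousD _ _ _ (fun z : C => c1 * u z) (fun z : C => c2 * v z)).
    by apply: (@continuousM _ _ (fun=> c1) u) => //; exact: cst_continuous.
  by apply: (@continuousM _ _ (fun=> c2) v) => //; exact: cst_continuous.
exact: weak_laplacian0D.
Qed.

Lemma weakly_harmonic_shift A u (a : R[i]) : weakly_harmonic A u ->
  weakly_harmonic [set z : C | A (z + a)] (fun z => u (z + a)).
Proof.
move=> H z /= /H[uc ul]; split.
  apply/continuousC_epsP => e e0; have [d d0 Hd] := (continuousC_epsP _ _).1 uc _ e0.
  exists d => // w wz; apply: Hd.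
  by have -> : w + a - (z + a) = w - z by ring.
move=> e e0; have [d d0 Hd] := ul _ e0; exists d => // t t0 td.
by have := Hd _ t0 td; rewrite /cross_sum !(addrAC z a).
Qed.

Lemma weakly_harmonic_rot A u : weakly_harmonic A u ->
  weakly_harmonic [set z : C | A ((0 +i* 1) * z)] (fun z => u ((0 +i* 1) * z)).
Proof.
move=> H z /= /H[uc ul]; split.
  apply/continuousC_epsP => e e0; have [d d0 Hd] := (continuousC_epsP _ _).1 uc _ e0.
  exists d => // w wz; apply: Hd.
  by rewrite -mulrBr normcM normc_imag normr1 mul1r.
move=> e e0; have [d d0 Hd] := ul _ e0; exists d => // t t0 td.
have := Hd _ t0 td; rewrite /cross_sum !mulrDr !mulrN.
have -> : (0 +i* 1) * t%:C = 0 +i* t :> R[i].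
  by apply/eqP; rewrite eq_complex /=; apply/andP; split; apply/eqP; ring.
have -> : (0 +i* 1) * (0 +i* t) = - t%:C :> R[i].
  by apply/eqP; rewrite eq_complex /=; apply/andP; split; apply/eqP; ring.
rewrite opprK; set a := u _; set b := u _; set c := u _; set dd := u _.
by have -> : c + dd + b + a - 4 * u ((0 +i* 1) * z) = a + b + c + dd - 4 * u ((0 +i* 1) * z) by ring.
Qed.
End WeaklyHarmonic.

(** * Interior estimates for the derivatives of a harmonic function *)

Section InteriorEstimates.
Context {R : realType}.
Local Notation C := (R[i]^o).
Implicit Types (z w : R[i]) (x y e d r t s l M : R) (b : bool) (u v : C -> R) (A K : set C).

Let conj_pt z : R[i] := complex.Re z +i* (- complex.Im z).

Lemma conj_ptD z w : conj_pt (z + w) = conj_pt z + conj_pt w.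
Proof. by case: z w => [a b] [c d]; rewrite /conj_pt /= opprD. Qed.

Lemma normc_conj_pt z : normc (conj_pt z) = normc z.
Proof. by case: z => a b; rewrite /conj_pt !normcE /= sqrrN. Qed.

Lemma weakly_harmonic_conj A u : weakly_harmonic A u ->
  weakly_harmonic [set z : C | A (conj_pt z)] (fun z => u (conj_pt z)).
Proof.
move=> H z /= /H[uc ul]; split.
  apply/continuousC_epsP => e e0; have [d d0 Hd] := (continuousC_epsP _ _).1 uc _ e0.
  exists d => // w wz; apply: Hd; rewrite -normc_conj_pt in wz.
  by rewrite conj_ptD in wz; move: wz; case: (z) => a b; rewrite /conj_pt/= opprK.
move=> e e0; have [d d0 Hd] := ul _ e0; exists d => // t t0 td.
have := Hd _ t0 td; rewrite /cross_sum !conj_ptD.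
have -> : conj_pt t%:C = t%:C by rewrite /conj_pt /= oppr0.
have -> : conj_pt (- t%:C) = - t%:C by rewrite /conj_pt /= oppr0.
have -> : conj_pt (0 +i* t) = - (0 +i* t) by rewrite /conj_pt; apply/eqP; rewrite eq_complex /= oppr0 !eqxx.
have -> : conj_pt (- (0 +i* t)) = 0 +i* t by rewrite /conj_pt; apply/eqP; rewrite eq_complex /= oppr0 opprK !eqxx.
set a := u _; set b := u _; set c := u (conj_pt z + _); set dd := u (conj_pt z - _).
by have -> : a + b + c + dd - 4 * u (conj_pt z) = a + b + dd + c - 4 * u (conj_pt z) by ring.
Qed.

(** For [0 <= k], this polynomial vanishes at the centre of the square where
    [|x| <= d] and [|y| <= d], is nonnegative on its upper half, and is at least
    [k * d ^+ 2] on the three sides of the upper half off the axis [y = 0]. *)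
Lemma weakly_harmonic_barrier A (k d : R) :
  weakly_harmonic A (fun z => k * (complex.Re z ^+ 2 + complex.Im z * (2 * d - complex.Im z))).
Proof.
move=> z _; split.
  have cre : {for (z : C), continuous (fun z : C => complex.Re z)}.
    apply/continuousC_epsP => e' e'0; exists e' => // w; apply: le_lt_trans.
    by have := normc_Re (w - z); case: (w) (z) => ? ? [].
  have cim : {for (z : C), continuous (fun z : C => complex.Im z)}.
    apply/continuousC_epsP => e' e'0; exists e' => // w; apply: le_lt_trans.
    by have := normc_Im (w - z); case: (w) (z) => ? ? [].
  apply: (@continuousM _ _ (fun=> k) (fun z : C => complex.Re z ^+ 2 + complex.Im z * (2 * d - complex.Im z))).
    exact: cst_continuous.
  apply: (@continuousD _ _ _ (fun z : C => complex.Re z ^+ 2) (fun z : C => complex.Im z * (2 * d - complex.Im z))).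
    by apply: (@continuousM _ _ (fun z : C => complex.Re z) (fun z : C => complex.Re z)).
  apply: (@continuousM _ _ (fun z : C => complex.Im z) (fun z : C => 2 * d - complex.Im z)) => //.
  apply: (@continuousB _ _ _ (fun z : C => 2 * d) (fun z : C => complex.Im z)) => //.
  exact: cst_continuous.
move=> e e0; exists 1 => // t t0 _; rewrite /cross_sum !raddfD !raddfN/=.
move: (complex.Re z) (complex.Im z) => x y.
set X := (X in `|X|); have -> : X = 0 by rewrite /X; ring.
by rewrite normr0 mulr_ge0 ?sqr_ge0 ?ltW.
Qed.

(** The difference of [u] and of its mirror image vanishes on the axis of symmetry
    of the square, so on the upper half of the square it is dominated by a harmonic
    quadratic polynomial that also vanishes at the centre. *)
Lemma reflection_estimate A u z0 d M : 0 < d -> weakly_harmonic A u ->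
  (forall z, `|complex.Re (z - z0)| <= d -> `|complex.Im (z - z0)| <= d -> A z /\ `|u z| <= M) ->
  forall t, 0 <= t <= d ->
  `|u (z0 + (0 +i* t)) - u (z0 - (0 +i* t))| <= 4 * M * t / d.
Proof.
move=> d0 uA sq t /andP[t0 td].
have M0 : 0 <= M.
  have [||_] := sq z0; rewrite ?subrr /= ?normr0 ?(ltW d0)//.
  exact: le_trans.
pose K := [set z : C | - d <= complex.Re z <= d /\ 0 <= complex.Im z <= d].
have cK : compact K := @compact_rect _ (- d) d 0 d.
pose u1 (z : C) := u (z + z0); pose u2 (z : C) := u (conj_pt z + z0).
have sqK z : K z -> [/\ A (z + z0), A (conj_pt z + z0), `|u1 z| <= M & `|u2 z| <= M].
  move=> [/andP[a1 a2] /andP[b1 b2]].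
  have [||? ?] := sq (z + z0).
  - by rewrite addrK ler_norml a1 a2.
  - by rewrite addrK ler_norml; apply/andP; split; lra.
  have [||? ?] := sq (conj_pt z + z0).
  - by rewrite addrK ler_norml a1 a2.
  - by rewrite addrK /= ler_norml; apply/andP; split; lra.
  by [].
have h1 : weakly_harmonic K u1.
  by move=> z /sqK[Az _ _ _]; exact: (weakly_harmonic_shift uA).
have h2 : weakly_harmonic K u2.
  move=> z /sqK[_ Az _ _].
  exact: (weakly_harmonic_conj (weakly_harmonic_shift (a := z0) uA)).
pose q (z : C) := complex.Re z ^+ 2 + complex.Im z * (2 * d - complex.Im z).
pose k := 2 * M / d ^+ 2.
have d2 : 0 < d ^+ 2 by rewrite exprn_gt0.
have k0 : 0 <= k by rewrite /k divr_ge0 ?mulr_ge0// ltW.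
have kd : k * d ^+ 2 = 2 * M by rewrite /k divfK// gt_eqF.
have main c : c ^+ 2 = 1 -> forall z, K z -> c * (u1 z - u2 z) - k * q z <= 0.
  move=> c2; pose w (z : C) := 1 * (c * u1 z + (- c) * u2 z) + (- 1) * (k * q z).
  have hw : weakly_harmonic K w.
    by apply: weakly_harmonicD; [exact: weakly_harmonicD|exact: weakly_harmonic_barrier].
  have wE z : w z = c * (u1 z - u2 z) - k * q z by rewrite /w; ring.
  move=> z Kz; rewrite -wE; apply: (max_principle cK (M := d)) Kz.
  - by move=> {}z [zd _]; rewrite ler_norml.
  - by move=> {}z /hw[].
  move=> {}z Kz; have [_ _ B1 B2] := sqK _ Kz.
  have c1 : c = 1 \/ c = - 1.
    by move/eqP: c2; rewrite sqrf_eq1 => /orP[] /eqP ->; [left|right].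
  have cB : c * (u1 z - u2 z) <= 2 * M.
    by move: B1 B2; rewrite !ler_norml => /andP[? ?] /andP[? ?]; case: c1 => ->; lra.
  have [/andP[a1 a2] /andP[b1 b2]] := Kz.
  have [int|bdry] := pselect (- d < complex.Re z < d /\ 0 < complex.Im z < d).
    right; split; last by have [] := hw _ Kz.
    case: int => /andP[x1 x2] /andP[y1 y2].
    apply/nbhs_normc.
    pose m := Num.min (Num.min (complex.Re z + d) (d - complex.Re z)) (Num.min (complex.Im z) (d - complex.Im z)).
    exists m; first by rewrite /m !lt_min; apply/andP; split; apply/andP; split; lra.
    move=> v vm; have xm := le_lt_trans (normc_Re _) vm; have ym := le_lt_trans (normc_Im _) vm.
    move: xm ym; rewrite !raddfB/= /m !lt_min !ltr_norml.
    move=> /andP[/andP[/andP[p1 p2] /andP[p3 p4]] _] /andP[_ /andP[/andP[p5 p6] /andP[p7 p8]]].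
    by split; apply/andP; split; lra.
  left; rewrite wE.
  have yy : 0 <= complex.Im z * (2 * d - complex.Im z) by apply: mulr_ge0; lra.
  have xx := sqr_ge0 (complex.Re z).
  have [z0'|zn0] := eqVneq (complex.Im z) 0.
    have -> : u1 z = u2 z.
      by rewrite /u1 /u2 /conj_pt z0' oppr0; case: (z) z0' => a b /= ->.
    by rewrite subrr mulr0 sub0r oppr_le0 mulr_ge0// addr_ge0.
  suff qd : d ^+ 2 <= q z.
    by have := ler_wpM2l k0 qd; lra.
  have [zd|zd] := eqVneq (complex.Im z) d.
    by rewrite /q zd in xx *; lra.
  have : `|complex.Re z| = d.
    apply/eqP; rewrite eq_le ler_norml a1 a2/= leNgt; apply/negP.
    rewrite ltr_norml => xd; apply: bdry; split => //.
    by rewrite lt_neqAle eq_sym zn0 b1 lt_neqAle zd b2.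
  by move=> xd; rewrite /q -(real_normK (num_real (complex.Re z))) xd; lra.
have Kt : K (0 +i* t) by split => /=; apply/andP; split; lra.
have e1 : z0 - (0 +i* t) = conj_pt (0 +i* t) + z0.
  by rewrite addrC; congr (_ + _); apply/eqP; rewrite eq_complex /= oppr0 !eqxx.
have := main 1 (expr1n _ _) _ Kt; have := main (- 1) (sqrr_sign _ 1) _ Kt.
rewrite e1 (addrC z0) /q /= /u1 /u2.
have : k * (0 ^+ 2 + t * (2 * d - t)) <= 4 * M * t / d.
  have -> : 4 * M * t / d = k * (2 * d * t) by rewrite /k; field; rewrite gt_eqF.
  by apply: ler_wpM2l => //; nra.
by rewrite ler_norml => *; apply/andP; split; lra.
Qed.

(** The estimate along the real axis is the one along the imaginary axis for the
    function rotated by a right angle. *)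
Lemma axis_estimate A u z0 r M b : 0 < r -> weakly_harmonic A u ->
  (forall z, normc (z - z0) <= r -> A z /\ `|u z| <= M) ->
  forall t, 0 <= t <= r / 2 ->
  `|u (z0 + t%:C * axis b) - u (z0 - t%:C * axis b)| <= 8 * M * t / r.
Proof.
move=> r0 uA ur t tr.
have sq w : `|complex.Re w| <= r / 2 -> `|complex.Im w| <= r / 2 -> normc w <= r.
  by have := normc_ReIm w; lra.
have -> : 8 * M * t / r = 4 * M * t / (r / 2) by field; rewrite gt_eqF.
case: b.
  have -> : t%:C * axis true = 0 +i* t :> R[i].
    by apply/eqP; rewrite eq_complex /=; apply/andP; split; apply/eqP; ring.
  apply: (reflection_estimate _ uA _ tr); first lra.
  by move=> z zx zy; apply: ur; exact: sq.
have ii z : (0 +i* 1) * (- (0 +i* 1) * z) = z.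
  by rewrite mulNr mulrN mulrA; case: z => a b; apply/eqP; rewrite eq_complex /=; apply/andP; split; apply/eqP; ring.
have := @reflection_estimate _ _ (- (0 +i* 1) * z0) (r / 2) M _ (weakly_harmonic_rot uA) _ _ tr.
rewrite !mulrDr !ii mulrN.
have -> : (0 +i* 1) * (0 +i* t) = - (t%:C * axis false) :> R[i].
  by apply/eqP; rewrite eq_complex /=; apply/andP; split; apply/eqP; ring.
rewrite opprK distrC; apply; first lra.
move=> z zx zy; apply: ur.
have <- : (0 +i* 1) * (z - (- (0 +i* 1) * z0)) = (0 +i* 1) * z - z0 by rewrite mulrBr ii.
by rewrite normcM normc_imag normr1 mul1r; exact: sq.
Qed.

Lemma sym_diff_le (g : R -> R) l c d : is_derive (0 : R) 1 g l -> 0 < d ->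
  (forall t, 0 < t -> t < d -> `|g t - g (- t)| <= c * t) -> `|l| <= c / 2.
Proof.
move=> /is_derive_epsP H d0 gc; rewrite leNgt; apply/negP => lc.
pose e := (`|l| - c / 2) / 2.
have e0 : 0 < e by rewrite /e; lra.
have [d' d'0 Hd] := H _ e0.
pose t := Num.min d d' / 2.
have t0 : 0 < t by rewrite divr_gt0// lt_min d0 d'0.
have [td td'] : t < d /\ t < d'.
  have : Num.min d d' <= d by rewrite ge_min lexx.
  have : Num.min d d' <= d' by rewrite ge_min lexx orbT.
  by move: t0; rewrite /t; lra.
have := Hd t; have := Hd (- t); rewrite normrN !add0r (gtr0_norm t0) => /(_ td') h1 /(_ td') h2.
have h3 := gc _ t0 td.
have : `|l * (2 * t)| <= (2 * e + c) * t.
  have -> : l * (2 * t) = (g t - g (- t)) - (g t - g 0 - l * t) + (g (- t) - g 0 - l * - t) by ring.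
  apply: (le_trans (ler_normD _ _)).
  have := ler_normB (g t - g (- t)) (g t - g 0 - l * t); lra.
rewrite normrM (gtr0_norm (mulr_gt0 _ t0))// mulrA ler_pM2r//.
by rewrite /e; lra.
Qed.

(** The bound on symmetric increments passes to the derivative at the centre. *)
Lemma gradient_estimate A u z0 r M b l : 0 < r -> weakly_harmonic A u ->
  (forall z, normc (z - z0) <= r -> A z /\ `|u z| <= M) ->
  is_axis_deriv b u z0 l -> `|l| <= 4 * M / r.
Proof.
move=> r0 uA ur ul.
have -> : 4 * M / r = 8 * M / r / 2 by field; rewrite gt_eqF.
apply: (@sym_diff_le _ _ _ (r / 2) ul); first lra.
move=> t t0 tr.
have -> : 8 * M / r * t = 8 * M * t / r by ring.
have := @axis_estimate A u z0 r M b r0 uA ur t; rewrite -mulNr -rmorphN; apply.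
by apply/andP; split; lra.
Qed.

(** The estimate for second derivatives follows by applying the previous one to
    difference quotients, which are again weakly harmonic. *)
Lemma second_derivative_estimate A u (p : C -> R) z0 r M b b' l : 0 < r -> weakly_harmonic A u ->
  (forall z, normc (z - z0) <= r -> A z /\ `|u z| <= M) ->
  (forall z, normc (z - z0) <= r -> is_axis_deriv b u z (p z)) ->
  is_axis_deriv b' p z0 l -> `|l| <= 64 * M / r ^+ 2.
Proof.
move=> r0 uA ur up pl.
have -> : 64 * M / r ^+ 2 = 128 * M / r ^+ 2 / 2 by field; rewrite gt_eqF.
apply: (@sym_diff_le _ _ _ (r / 4) pl); first lra.
move=> k k0 kr.
pose z1 := z0 + k%:C * axis b'; pose z2 := z0 + (- k)%:C * axis b'.
have n1 : normc (z1 - z0) = k by rewrite /z1 addrC addKr normc_axis gtr0_norm.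
have n2 : normc (z2 - z0) = k by rewrite /z2 addrC addKr normc_axis normrN gtr0_norm.
have d12 := is_deriveB (up z1 _) (up z2 _).
have -> : 128 * M / r ^+ 2 * k = 256 * M / r ^+ 2 * k / 2 by field; rewrite gt_eqF.
apply: (@sym_diff_le _ _ _ (r / 4) (d12 _ _)); [by lra|by lra|by lra|].
move=> h h0 hr.
pose v (z : C) := 1 * u (z + h%:C * axis b) + (- 1) * u (z + - (h%:C * axis b)).
pose A' := [set z : C | A (z + h%:C * axis b) /\ A (z + - (h%:C * axis b))].
have hv : weakly_harmonic A' v.
  apply: weakly_harmonicD.
    by move=> z [Az _]; exact: (weakly_harmonic_shift uA).
  by move=> z [_ Az]; exact: (weakly_harmonic_shift uA).
have r2 : 0 < r / 2 by lra.
have := @axis_estimate _ _ z0 (r / 2) (16 * M * h / r) b' r2 hv _ k.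
rewrite (_ : 8 * _ * k / _ = 256 * M / r ^+ 2 * k * h); last by field; rewrite gt_eqF.
have E : v (z0 + k%:C * axis b') - v (z0 - k%:C * axis b') =
  (u (z1 + h%:C * axis b) - u (z2 + h%:C * axis b)) -
  (u (z1 + (- h)%:C * axis b) - u (z2 + (- h)%:C * axis b)).
  by rewrite /v /z1 /z2 !rmorphN/= !mulNr; ring.
rewrite E; apply.
  move=> z zr.
  have zin s : `|s| <= r / 4 -> normc (z + s%:C * axis b - z0) <= r.
    move=> sr; rewrite addrAC; apply: (le_trans (le_normcD _ _)).
    by rewrite normc_axis; lra.
  have hin1 : A (z + h%:C * axis b).
    by apply: (ur _ (zin _ _)).1; rewrite gtr0_norm// ltW.
  have hin2 : A (z + - (h%:C * axis b)).
    rewrite -mulNr -rmorphN; apply: (ur _ (zin _ _)).1; rewrite normrN gtr0_norm// ltW//.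
  split; first by [].
  have := @axis_estimate A u z (r / 2) M b r2 uA _ h.
  rewrite (_ : 8 * M * h / _ = 16 * M * h / r); last by field; rewrite gt_eqF.
  rewrite /v mul1r mulN1r; apply; last by apply/andP; split; lra.
  move=> w wz; apply: ur; apply: (le_trans (normc_triangle z _ _)); lra.
by apply/andP; split; lra.
Qed.

End InteriorEstimates.

(** * Uniform limits of harmonic functions *)

Section HarmonicLimits.
Context {R : realType}.
Local Notation C := (R[i]^o).
Implicit Types (z w : R[i]) (x y e d r t s l M : R) (b : bool) (u v : C -> R) (A K : set C).

Lemma is_axis_deriv_near_eq A u v z b l : open A -> (forall w, A w -> u w = v w) -> A z ->
  is_axis_deriv b u z l -> is_axis_deriv b v z l.
Proof.
move=> oA uv Az /is_axis_deriv_epsP H; apply/is_axis_deriv_epsP => e /H[d d0 Hd].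
have [r r0 rA] := open_normc oA Az.
exists (Num.min d r); first by rewrite lt_min d0 r0.
move=> t; rewrite lt_min => /andP[td tr].
rewrite -!uv//; first exact: Hd.
by apply: rA; rewrite addrC addKr normc_axis.
Qed.

Lemma continuous_near_eq A u v (z : C) : open A -> (forall w, A w -> u w = v w) -> A z ->
  {for z, continuous u} -> {for z, continuous v}.
Proof.
move=> oA uv Az /continuousC_epsP H; apply/continuousC_epsP => e /H[d d0 Hd].
have [r r0 rA] := open_normc oA Az.
exists (Num.min d r); first by rewrite lt_min d0 r0.
move=> w; rewrite lt_min => /andP[wd wr].
by rewrite -!uv//; [exact: Hd|exact: rA].
Qed.

Lemma C1_on_eq A u v : open A -> (forall w, A w -> u w = v w) -> C1_on A u ->
  C1_on A v /\ forall b z, A z -> axis_pd b u z = axis_pd b v z.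
Proof.
move=> oA uv /C1_onP H.
have E b z : A z -> axis_pd b u z = axis_pd b v z.
  move=> Az; apply/esym/is_axis_deriv_pd; apply: (is_axis_deriv_near_eq oA uv Az).
  by have [] := H _ Az b.
split=> //; apply/C1_onP => z Az b; have [h1 h2] := H _ Az b; split.
  by rewrite -E//; exact: (is_axis_deriv_near_eq oA uv Az).
exact: (continuous_near_eq oA (E b) Az).
Qed.

Lemma laplacianE u z : laplacian u z = axis_pd false (axis_pd false u) z + axis_pd true (axis_pd true u) z.
Proof. by []. Qed.

Lemma harmonic_real_eq A u v : open A -> (forall w, A w -> u w = v w) ->
  harmonic_real A u -> harmonic_real A v.
Proof.
move=> oA uv [/C2_onP[u1 u2] lap].
have [v1 E] := C1_on_eq oA uv u1.
have v2 b := C1_on_eq oA (E b) (u2 b).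
split; first by apply/C2_onP; split; [exact: v1|move=> b; exact: (v2 b).1].
move=> z Az; rewrite laplacianE -((v2 false).2 false z Az) -((v2 true).2 true z Az).
by rewrite -laplacianE lap.
Qed.

Definition loc_unif_lim A (q : nat -> C -> R) (p : C -> R) : Prop :=
  forall z, A z -> exists2 r, 0 < r & forall e, 0 < e -> exists N : nat,
    forall n, (N <= n)%N -> forall w, normc (w - z) < r -> `|q n w - p w| <= e.

Definition loc_unif_cauchy A (q : nat -> C -> R) : Prop :=
  forall z, A z -> exists2 r, 0 < r & forall e, 0 < e -> exists N : nat,
    forall n m, (N <= n)%N -> (N <= m)%N ->
    forall w, normc (w - z) < r -> `|q n w - q m w| <= e.

Lemma cauchy_seq_lim (g : nat -> R) :
  (forall e, 0 < e -> exists N : nat, forall n m, (N <= n)%N -> (N <= m)%N ->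
     `|g n - g m| <= e) ->
  exists l, forall e, 0 < e -> exists N : nat, forall n, (N <= n)%N -> `|g n - l| <= e.
Proof.
move=> H.
have : cvgn g.
  apply/cauchy_cvgP/cauchy_exP => e e0.
  have e2 : 0 < e / 2 by lra.
  have [N HN] := H _ e2.
  exists (g N), N => // n /= nN; rewrite /ball/=.
  by apply: (le_lt_trans (HN _ _ (leqnn N) nN)); lra.
move=> /cvg_ex[l gl]; exists l => e e0.
have /cvgrPdist_le/(_ _ e0)[N _ HN] := gl.
by exists N => n nN; rewrite distrC; exact: HN.
Qed.

Lemma loc_unif_cauchy_lim A (q : nat -> C -> R) : loc_unif_cauchy A q ->
  exists p, loc_unif_lim A q p.
Proof.
move=> H.
have ex w : exists l, (forall e, 0 < e -> exists N : nat, forall n m, (N <= n)%N -> (N <= m)%N ->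
     `|q n w - q m w| <= e) ->
   forall e, 0 < e -> exists N : nat, forall n, (N <= n)%N -> `|q n w - l| <= e.
  have [cw|ncw] := pselect (forall e, 0 < e -> exists N : nat, forall n m, (N <= n)%N -> (N <= m)%N ->
     `|q n w - q m w| <= e); last by exists 0.
  by have [l Hl] := cauchy_seq_lim cw; exists l.
have [p Hp] := choice ex.
exists p => z /H[r r0 Hr]; exists r => // e e0.
have e2 : 0 < e / 2 by lra.
have [N HN] := Hr _ e2; exists N => n nN w wz.
have [|N' HN'] := Hp w _ _ e2.
  by move=> e' /Hr[N' HN']; exists N' => n' m' h1 h2; exact: HN'.
have := HN n (maxn N N') nN (leq_maxl _ _) w wz; have := HN' _ (leq_maxr N N').
have := ler_distD (q (maxn N N') w) (q n w) (p w); lra.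
Qed.

Lemma loc_unif_lim_continuous A (q : nat -> C -> R) p (z : C) : A z ->
  (forall n, {for z, continuous (q n)}) -> loc_unif_lim A q p -> {for z, continuous p}.
Proof.
move=> Az qc /(_ _ Az)[r r0 Hr]; apply/continuousC_epsP => e e0.
have e3 : 0 < e / 4 by lra.
have [N HN] := Hr _ e3.
have [d d0 Hd] := (continuousC_epsP _ _).1 (qc N) _ e3.
exists (Num.min r d); first by rewrite lt_min r0 d0.
move=> w; rewrite lt_min => /andP[wr wd].
have := HN _ (leqnn N) _ wr; have := Hd _ wd.
have := HN _ (leqnn N) z; rewrite subrr normc0 => /(_ r0).
have := ler_distD (q N w) (p w) (p z); have := ler_distD (q N z) (q N w) (p z).
rewrite (distrC (p w) (q N w)); lra.
Qed.

(** The increments of [q m - q n] are controlled by the mean value theorem, uniformly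
    in [m], so that the difference quotients of the limit are uniformly close to
    those of [q n]. *)
Lemma C1_limit A (q : nat -> C -> R) u (p : bool -> C -> R) : open A ->
  (forall n, C1_on A (q n)) -> loc_unif_lim A q u ->
  (forall b, loc_unif_lim A (fun n => axis_pd b (q n)) (p b)) ->
  C1_on A u /\ forall b z, A z -> axis_pd b u z = p b z.
Proof.
move=> oA q1 qu qp.
have main z b : A z -> is_axis_deriv b u z (p b z).
  move=> Az; apply/is_axis_deriv_epsP => e e0.
  have [r1 r10 Hr1] := qp b _ Az; have [r2 r20 Hr2] := qu _ Az.
  have [r3 r30 rA] := open_normc oA Az.
  have e4 : 0 < e / 8 by lra.
  have [N HN] := Hr1 _ e4.
  have /C1_onP/(_ _ Az b)[/is_axis_deriv_epsP/(_ _ e4)[d d0 Hd] _] := q1 N.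
  exists (Num.min (Num.min r1 r2) (Num.min r3 d)).
    by rewrite !lt_min r10 r20 r30 d0.
  move=> t; rewrite !lt_min => /andP[/andP[t1 t2] /andP[t3 t4]].
  have inr s : `|s| <= `|t| -> normc (z + s%:C * axis b - z) <= `|t|.
    by rewrite addrC addKr normc_axis.
  have [->|t0] := eqVneq t 0.
    by rewrite mul0r addr0 subrr mulr0 subrr normr0 mulr0.
  have tt : 0 < `|t| by rewrite normr_gt0.
  have et : 0 < e / 8 * `|t| by rewrite mulr_gt0//; lra.
  have [N' HN'] := Hr2 _ et.
  pose m := maxn N N'.
  have cmp : `|(q m (z + t%:C * axis b) - q m z) - (q N (z + t%:C * axis b) - q N z)| <= e / 4 * `|t|.
    pose g s := q m (z + s%:C * axis b) - q N (z + s%:C * axis b).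
    have [s|s] := @MVT_increment _ g (fun s => axis_pd b (q m) (z + s%:C * axis b) -
       axis_pd b (q N) (z + s%:C * axis b)) 0 t.
      rewrite add0r => st.
      have As : A (z + s%:C * axis b).
        by apply: rA; apply: le_lt_trans t3; exact: inr.
      have /C1_onP/(_ _ As b)[dm _] := q1 m; have /C1_onP/(_ _ As b)[dN _] := q1 N.
      by have := is_deriveB (is_axis_deriv_shift dm) (is_axis_deriv_shift dN); exact.
    rewrite !add0r => st Es.
    have -> : (q m (z + t%:C * axis b) - q m z) - (q N (z + t%:C * axis b) - q N z) =
      g t - g 0 by rewrite /g mul0r addr0; ring.
    rewrite Es normrM ler_wpM2r//.
    have sr : normc (z + s%:C * axis b - z) < r1 by apply: le_lt_trans t1; exact: inr.
    have := HN m (leq_maxl _ _) _ sr; have := HN N (leqnn _) _ sr.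
    have := ler_distD (p b (z + s%:C * axis b))
      (axis_pd b (q m) (z + s%:C * axis b)) (axis_pd b (q N) (z + s%:C * axis b)).
    by rewrite (distrC (p b _) (axis_pd b (q N) _)); lra.
  have h1 := Hd _ t4.
  have tz : normc (z + t%:C * axis b - z) < r2 by apply: le_lt_trans t2; exact: inr.
  have h2 := HN' m (leq_maxr _ _) _ tz.
  have h3 := HN' m (leq_maxr _ _) z; rewrite subrr normc0 in h3; have {}h3 := h3 r20.
  have h4 := HN N (leqnn _) z; rewrite subrr normc0 in h4; have {}h4 := h4 r10.
  have h5 := ler_wpM2r (normr_ge0 t) h4; rewrite -normrM in h5.
  move: (u (z + t%:C * axis b)) (u z) (q m (z + t%:C * axis b)) (q m z)
   (q N (z + t%:C * axis b)) (q N z) (axis_pd b (q N) z) (p b z) h1 h2 h3 h5 cmp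
   => a a' c c' f f' g' g h1 h2 h3 h5 cmp.
  have -> : a - a' - g * t = - (c - a) + (c' - a') + (c - c' - (f - f')) + (f - f' - g' * t) + (g' - g) * t.
    by ring.
  have tri5 x1 x2 x3 x4 x5 : `|x1 + x2 + x3 + x4 + x5| <= `|x1| + `|x2| + `|x3| + `|x4| + `|x5|.
    by do 4 (apply: (le_trans (ler_normD _ _)); apply: lerD => //).
  by apply: (le_trans (tri5 _ _ _ _ _)); rewrite normrN; lra.
have E b z : A z -> axis_pd b u z = p b z by move=> /(main z b)/is_axis_deriv_pd.
split=> //; apply/C1_onP => z Az b; split; first by rewrite E//; exact: main.
apply: (continuous_near_eq oA (u := p b)) => //; first by move=> w /E ->.
apply: (loc_unif_lim_continuous Az _ (qp b)) => n.
by have /C1_onP/(_ _ Az b)[] := q1 n.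
Qed.

(** The interior estimates turn uniform convergence of harmonic functions into
    locally uniform convergence of their derivatives up to order two. *)
Lemma harmonic_real_limit A (q : nat -> C -> R) u : open A ->
  (forall n, harmonic_real A (q n)) ->
  (forall e, 0 < e -> exists N : nat, forall n, (N <= n)%N ->
     forall z, A z -> `|q n z - u z| <= e) ->
  harmonic_real A u.
Proof.
move=> oA qh qu.
have q2 n : C2_on A (q n) by have [] := qh n.
have qw n := harmonic_weak oA (qh n).
pose diff n m := fun z : C => 1 * q n z + (- 1) * q m z.
have dw n m : weakly_harmonic A (diff n m) by apply: weakly_harmonicD.
have disk z : A z -> exists r, 0 < r /\ forall w, normc (w - z) < r ->
    forall w', normc (w' - w) <= r -> A w'.
  move=> Az; have [r r0 rA] := open_normc oA Az; exists (r / 2); split; first lra.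
  move=> w wz w' ww; apply: rA; have := normc_triangle w w' z; lra.
have small e : 0 < e -> exists N : nat, forall n m, (N <= n)%N -> (N <= m)%N ->
    forall z, A z -> `|diff n m z| <= e.
  move=> e0; have e2 : 0 < e / 2 by lra.
  have [N HN] := qu _ e2; exists N => n m nN mN z Az.
  have := HN _ nN _ Az; have := HN _ mN _ Az.
  have := ler_distD (u z) (q n z) (q m z); rewrite (distrC (u z)) /diff mul1r mulN1r; lra.
have dird n m b z : A z -> is_axis_deriv b (diff n m) z (1 * axis_pd b (q n) z + (-1) * axis_pd b (q m) z).
  move=> Az; have /C2_onP[/C1_onP/(_ _ Az b)[dn _] _] := q2 n.
  have /C2_onP[/C1_onP/(_ _ Az b)[dm _] _] := q2 m.
  have := is_deriveD (is_deriveZ 1 dn) (is_deriveZ (-1) dm); exact.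
have cauchy1 b : loc_unif_cauchy A (fun n => axis_pd b (q n)).
  move=> z /disk[r [r0 rA]]; exists r => // e e0.
  have e' : 0 < e * r / 4 by rewrite divr_gt0 ?mulr_gt0.
  have [N HN] := small _ e'; exists N => n m nN mN w wz.
  have Aw : A w by apply: (rA _ wz); rewrite subrr normc0 ltW.
  have := gradient_estimate r0 (dw n m) _ (dird n m b _ Aw).
  move=> /(_ (e * r / 4)); rewrite mul1r mulN1r.
  have -> : 4 * (e * r / 4) / r = e by field; rewrite gt_eqF.
  by apply=> w' /(rA _ wz) Aw'; split => //; exact: HN.
have cauchy2 b b' : loc_unif_cauchy A (fun n => axis_pd b' (axis_pd b (q n))).
  move=> z /disk[r [r0 rA]]; exists r => // e e0.
  have e' : 0 < e * r ^+ 2 / 64 by rewrite divr_gt0 ?mulr_gt0 ?exprn_gt0.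
  have [N HN] := small _ e'; exists N => n m nN mN w wz.
  have Aw : A w by apply: (rA _ wz); rewrite subrr normc0 ltW.
  have /C2_onP[_ /(_ b)/C1_onP/(_ _ Aw b')[dn _]] := q2 n.
  have /C2_onP[_ /(_ b)/C1_onP/(_ _ Aw b')[dm _]] := q2 m.
  have dd := is_deriveD (is_deriveZ 1 dn) (is_deriveZ (-1) dm).
  have := @second_derivative_estimate _ A (diff n m) (fun z => 1 * axis_pd b (q n) z + (-1) * axis_pd b (q m) z)
    w r (e * r ^+ 2 / 64) b b' _ r0 (dw n m) _ _ dd.
  have -> : 64 * (e * r ^+ 2 / 64) / r ^+ 2 = e by field; rewrite gt_eqF.
  have -> : 1 *: axis_pd b' (axis_pd b (q n)) w + -1 *: axis_pd b' (axis_pd b (q m)) w =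
    axis_pd b' (axis_pd b (q n)) w - axis_pd b' (axis_pd b (q m)) w by rewrite /GRing.scale/= mul1r mulN1r.
  apply=> w' /(rA _ wz) Aw'; first by split => //; exact: HN.
  exact: dird.
have qu' : loc_unif_lim A q u.
  move=> z /disk[r [r0 rA]]; exists r => // e /qu[N HN]; exists N => n nN w wz.
  by apply: HN => //; apply: (rA _ wz); rewrite subrr normc0 ltW.
have [p Hp] := choice (fun b => loc_unif_cauchy_lim (cauchy1 b)).
have [s Hs] := choice (fun bb : bool * bool => loc_unif_cauchy_lim (cauchy2 bb.1 bb.2)).
have q1 n : C1_on A (q n) := ((C2_onP _ _).1 (q2 n)).1.
have [u1 up] := C1_limit oA q1 qu' Hp.
have q12 b n : C1_on A (axis_pd b (q n)) := ((C2_onP _ _).1 (q2 n)).2 b.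
have H2 b := C1_limit oA (q12 b) (Hp b) (fun b' => Hs (b, b')).
have up' b z : A z -> p b z = axis_pd b u z by move=> /(up b) ->.
have u2 b := C1_on_eq oA (up' b) (H2 b).1.
split; first by apply/C2_onP; split; [exact: u1|move=> b; exact: (u2 b).1].
move=> z Az.
have E b : axis_pd b (axis_pd b u) z = s (b, b) z.
  by rewrite -(u2 b).2// (H2 b).2.
rewrite (_ : laplacian u z = s (false, false) z + s (true, true) z); last first.
  by rewrite laplacianE !E.
apply/eqP; rewrite -normr_eq0; apply/eqP/le_anti/andP; split; last exact: normr_ge0.
apply/ler_addgt0Pr => e e0; rewrite add0r.
have e2 : 0 < e / 2 by lra.
have [r0 r00 /(_ _ e2)[N0 HN0]] := Hs (false, false) _ Az.
have [r1 r10 /(_ _ e2)[N1 HN1]] := Hs (true, true) _ Az.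
have := HN0 _ (leq_maxl N0 N1) z; have := HN1 _ (leq_maxr N0 N1) z.
rewrite subrr normc0 => /(_ r10) h1 /(_ r00) h0.
have lap : axis_pd false (axis_pd false (q (maxn N0 N1))) z + axis_pd true (axis_pd true (q (maxn N0 N1))) z = 0.
  by rewrite -laplacianE (qh (maxn N0 N1)).2.
move: (axis_pd false _ z) (axis_pd true _ z) (s (false, false) z) (s (true, true) z) h0 h1 lap
  => a b d c h0 h1 lap.
have -> : d + c = - ((a - d) + (b - c)) by lra.
rewrite normrN; apply: (le_trans (ler_normD _ _)); lra.
Qed.

End HarmonicLimits.

(** * Self-maps of the disk; closedness *)

Section DiskMaps.
Context {R : realType}.
Local Notation C := (R[i]^o).
Local Notation D := (unit_disk R).
Implicit Types (z w : R[i]) (f g : Q R).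

Lemma unit_disk_open : open D.
Proof.
rewrite openE => z /= z1; apply/nbhs_normc; exists (1 - normc z); first by rewrite subr_gt0.
by move=> w wz; have := le_normcB w z; rewrite /unit_disk /=; lra.
Qed.

Definition disk_pt z (Dz : D z) : disk R := exist _ (z : C) (mem_set Dz).

Lemma plane_mapE (f : disk R -> disk R) z (Dz : D z) :
  plane_map f z = set_val (f (disk_pt Dz)).
Proof.
rewrite /plane_map; case: insubP => [w _ wz|]; last by rewrite mem_set.
by congr (set_val (f _)); apply: val_inj; rewrite wz.
Qed.

Lemma disk_ptP (w : disk R) : D (set_val w).
Proof. exact: (set_mem (valP w)). Qed.

Lemma plane_map_val (f : disk R -> disk R) (w : disk R) :
  plane_map f (set_val w) = set_val (f w).
Proof. by rewrite (plane_mapE _ (disk_ptP w)); congr (set_val (f _)); apply: val_inj. Qed.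

Lemma plane_map_disk (f : disk R -> disk R) z : D z -> D (plane_map f z).
Proof. by move=> Dz; rewrite (plane_mapE _ Dz); exact: disk_ptP. Qed.

Lemma disk0 : D (0 : R[i]).
Proof. by change (normc (0 : R[i]) < 1); rewrite normc0. Qed.

Lemma d_sup_has_sup f g :
  has_sup (range (fun z : disk R => normc (set_val (f z) - set_val (g z)))).
Proof.
split; first by exists (normc (set_val (f (disk_pt disk0)) - set_val (g (disk_pt disk0)))), (disk_pt disk0).
exists 2 => _ [z _ <-]; apply: (le_trans (normc_triangle 0 _ _)).
rewrite subr0 sub0r normcN.
by have := disk_ptP (f z); have := disk_ptP (g z); rewrite /unit_disk /=; lra.
Qed.

Lemma le_d_sup f g z : D z -> normc (plane_map f z - plane_map g z) <= d_sup f g.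
Proof.
move=> Dz; apply: (ub_le_sup (d_sup_has_sup f g).2).
by exists (disk_pt Dz); rewrite ?(plane_mapE _ Dz).
Qed.

Lemma d_sup_le f g c : (forall z, D z -> normc (plane_map f z - plane_map g z) <= c) ->
  d_sup f g <= c.
Proof.
move=> H; apply: (ge_sup (d_sup_has_sup f g).1) => _ [z _ <-].
by rewrite -!plane_map_val; apply: H; exact: disk_ptP.
Qed.

Lemma Q_ballE f e g : ball f e g <-> d_sup f g < e.
Proof. by rewrite ballEmdist. Qed.

Lemma HQ_closed : closed (HQ R).
Proof.
move=> f clf.
have ex n : exists g : Q R, HQ R g /\ d_sup f g < n.+1%:R^-1.
  have [|g [Hg fg]] := clf (ball f n.+1%:R^-1).
    by apply: nbhsx_ballx; rewrite invr_gt0.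
  by exists g; split => //; exact/Q_ballE.
have [g Hg] := choice ex.
have conv e : 0 < e -> exists N : nat, forall n, (N <= n)%N -> forall z, D z ->
    normc (plane_map (g n) z - plane_map f z) <= e.
  move=> e0; exists (Num.truncn e^-1) => n nN z Dz.
  rewrite distcC; apply: (le_trans (le_d_sup _ _ Dz)).
  apply: (le_trans (ltW (Hg n).2)).
  rewrite invf_ple ?posrE//; apply: (le_trans (ltW (truncnS_gt _))).
  by rewrite ler_nat.
split.
- apply: (harmonic_real_limit (q := fun n z => complex.Re (plane_map (g n) z)) unit_disk_open).
    by move=> n; exact: (Hg n).1.1.
  move=> e /conv[N HN]; exists N => n nN z Dz; apply: le_trans (HN _ nN _ Dz).
  by rewrite -raddfB; exact: normc_Re.
- apply: (harmonic_real_limit (q := fun n z => complex.Im (plane_map (g n) z)) unit_disk_open).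
    by move=> n; exact: (Hg n).1.2.
  move=> e /conv[N HN]; exists N => n nN z Dz; apply: le_trans (HN _ nN _ Dz).
  by rewrite -raddfB; exact: normc_Im.
Qed.

Lemma plane_map_continuous (f : disk R -> disk R) : continuous f ->
  forall z, D z -> forall e : R, 0 < e -> exists2 d, 0 < d &
  forall w, D w -> normc (w - z) < d -> normc (plane_map f w - plane_map f z) < e.
Proof.
move=> cf z Dz e e0.
pose v0 := set_val (f (disk_pt Dz)).
pose V := [set v : C | normc (v - v0) < e].
have oV : open V.
  rewrite openE => v /= ve; apply/nbhs_normc; exists (e - normc (v - v0)).
    by rewrite subr_gt0.
  by move=> u uv; have := normc_triangle v u v0; rewrite /V /=; lra.
have Vv0 : V v0 by change (normc (v0 - v0) < e); rewrite subrr normc0.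
have : nbhs (disk_pt Dz) (f @^-1` (set_val @^-1` V)).
  apply: cf; exists (set_val @^-1` V); split; [by exists V|exact: Vv0|by []].
move=> [_ [[U oU <-] /= Uz] UV].
have [d d0 dU] := open_normc oU Uz; exists d => // w Dw /dU Uw.
by rewrite (plane_mapE _ Dw) (plane_mapE _ Dz); exact: (UV (disk_pt Dw)).
Qed.

Lemma disk_map_continuous (f : disk R -> disk R) :
  (forall z, D z -> forall e : R, 0 < e -> exists2 d, 0 < d &
    forall w, D w -> normc (w - z) < d -> normc (plane_map f w - plane_map f z) < e) ->
  continuous f.
Proof.
move=> H z A [_ [[U oU <-] /= Uz] UA].
have [e e0 eU] := open_normc oU Uz.
have [d d0 Hd] := H _ (disk_ptP z) _ e0.
exists (set_val @^-1` [set v : C | normc (v - set_val z) < d]); split.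
- exists [set v : C | normc (v - set_val z) < d] => //.
  rewrite openE => v /= ve; apply/nbhs_normc; exists (d - normc (v - set_val z)).
    by rewrite subr_gt0.
  by move=> u uv; have := normc_triangle v u (set_val z); rewrite /=; lra.
- by change (normc (set_val z - set_val z) < d); rewrite subrr normc0.
- move=> w /= wd; apply: UA; apply: eU.
  by have := Hd _ (disk_ptP w) wd; rewrite !plane_map_val.
Qed.

End DiskMaps.

(** * Holomorphic functions are harmonic *)

Section Holomorphic.
Context {R : realType}.
Local Notation C := (R[i]^o).
Implicit Types (z w h c : R[i]) (e d r t : R) (b : bool) (g : C -> C) (A : set C).

Definition has_cderiv g z c : Prop := forall e, 0 < e -> exists2 d, 0 < d &
  forall h, normc h < d -> normc (g (z + h) - g z - c * h) <= e * normc h.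

Lemma cderiv_quadratic g z c (k r : R) : 0 < r -> 0 <= k ->
  (forall h, normc h < r -> normc (g (z + h) - g z - c * h) <= k * normc h ^+ 2) ->
  has_cderiv g z c.
Proof.
move=> r0 k0 H e e0; exists (Num.min r (e / (k + 1))).
  by rewrite lt_min r0 divr_gt0//; lra.
move=> h; rewrite lt_min => /andP[hr]; rewrite ltr_pdivlMr; last lra.
move=> he; apply: (le_trans (H _ hr)); rewrite expr2 mulrA ler_wpM2r ?normc_ge0//.
by have := normc_ge0 h; nra.
Qed.

(** The factor [c0] serves for both coordinates: it is [1] for the real part and [- i]
    for the imaginary part. *)
Lemma cderiv_axis_deriv_Re g c0 z c b : has_cderiv g z c ->
  is_axis_deriv b (fun z => complex.Re (c0 * g z)) z (complex.Re (c0 * c * axis b)).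
Proof.
move=> H; apply/is_axis_deriv_epsP => e e0.
have k0 : 0 < normc c0 + 1 by have := normc_ge0 c0; lra.
have ek : 0 < e / (normc c0 + 1) by rewrite divr_gt0.
have [d d0 Hd] := H _ ek; exists d => // t td.
have := Hd (t%:C * axis b); rewrite normc_axis => /(_ td) hd.
have -> : complex.Re (c0 * g (z + t%:C * axis b)) - complex.Re (c0 * g z) -
    complex.Re (c0 * c * axis b) * t =
  complex.Re (c0 * (g (z + t%:C * axis b) - g z - c * (t%:C * axis b))).
  have -> : complex.Re (c0 * c * axis b) * t = complex.Re (c0 * (c * (t%:C * axis b))).
    have -> : c0 * (c * (t%:C * axis b)) = t%:C * (c0 * c * axis b) by ring.
    by case: (c0 * c * axis b) => x y /=; ring.
  by rewrite -!raddfB -!mulrBr.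
apply: (le_trans (normc_Re _)); rewrite normcM.
apply: (@le_trans _ _ (normc c0 * (e / (normc c0 + 1) * `|t|))).
  by rewrite ler_wpM2l ?normc_ge0.
have -> : e * `|t| = (normc c0 + 1) * (e / (normc c0 + 1) * `|t|).
  by field; rewrite gt_eqF.
by apply: ler_wpM2r; [rewrite mulr_ge0 ?(ltW ek)|lra].
Qed.

Definition normc_continuous g z : Prop := forall e, 0 < e -> exists2 d, 0 < d &
  forall h, normc h < d -> normc (g (z + h) - g z) <= e.

Lemma cderiv_continuous g z c : has_cderiv g z c -> normc_continuous g z.
Proof.
move=> H e e0; have [d d0 Hd] := H _ ltr01.
have k0 : 0 < normc c + 1 by have := normc_ge0 c; lra.
exists (Num.min d (e / (normc c + 1))); first by rewrite lt_min d0 divr_gt0.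
move=> h; rewrite lt_min => /andP[hd]; rewrite ltr_pdivlMr// => he.
have := Hd _ hd; have := le_normcB (g (z + h) - g z) (c * h).
by rewrite normcM; lra.
Qed.

Lemma continuous_Re g c0 (z : C) : normc_continuous g z ->
  {for z, continuous (fun z : C => complex.Re (c0 * g z))}.
Proof.
move=> H; apply/continuousC_epsP => e e0.
have k0 : 0 < normc c0 + 1 by have := normc_ge0 c0; lra.
have ek : 0 < e / (normc c0 + 1) by rewrite divr_gt0.
have [d d0 Hd] := H _ ek; exists d => // w wd.
have := Hd _ wd; rewrite (addrC z) subrK => hd.
rewrite -raddfB -mulrBr; apply: (le_lt_trans (normc_Re _)); rewrite normcM.
have -> : e = (normc c0 + 1) * (e / (normc c0 + 1)) by field; rewrite gt_eqF.
by have := normc_ge0 c0; nra.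
Qed.

Lemma C1_on_Re A g g1 c0 : open A -> (forall z, A z -> has_cderiv g z (g1 z)) ->
  (forall z, A z -> normc_continuous g1 z) ->
  C1_on A (fun z => complex.Re (c0 * g z)) /\
  forall b z, A z -> complex.Re (c0 * axis b * g1 z) = axis_pd b (fun z => complex.Re (c0 * g z)) z.
Proof.
move=> oA gd g1c.
have E b z : A z -> complex.Re (c0 * axis b * g1 z) = axis_pd b (fun z => complex.Re (c0 * g z)) z.
  by move=> /gd/(cderiv_axis_deriv_Re c0 b)/is_axis_deriv_pd ->; congr complex.Re; ring.
split=> //; apply/C1_onP => z Az b; split.
  rewrite -E// mulrAC; apply: cderiv_axis_deriv_Re; exact: gd.
apply: (continuous_near_eq oA (E b) Az); apply: continuous_Re; exact: g1c.
Qed.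

(** Differentiating along an axis multiplies the complex derivative by the unit vector
    of this axis, and the squares of the two unit vectors add up to [0]. *)
Lemma harmonic_real_Re A g g1 g2 c0 : open A ->
  (forall z, A z -> has_cderiv g z (g1 z)) ->
  (forall z, A z -> has_cderiv g1 z (g2 z)) ->
  (forall z, A z -> normc_continuous g2 z) ->
  harmonic_real A (fun z => complex.Re (c0 * g z)).
Proof.
move=> oA gd g1d g2c.
have g1c z : A z -> normc_continuous g1 z by move=> /g1d/cderiv_continuous.
have [u1 E1] := C1_on_Re c0 oA gd g1c.
have u2 b := C1_on_Re (c0 * axis b) oA g1d g2c.
have v2 b := C1_on_eq oA (E1 b) (u2 b).1.
split; first by apply/C2_onP; split; [exact: u1|move=> b; exact: (v2 b).1].
move=> z Az; rewrite laplacianE -!(v2 _).2// -!(u2 _).2//.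
rewrite -raddfD /= (_ : _ + _ = 0)//.
rewrite -mulrDl -!mulrA -mulrDr (_ : axis false * axis false + axis true * axis true = 0) ?mulr0 ?mul0r//.
by apply/eqP; rewrite eq_complex /=; apply/andP; split; apply/eqP; ring.
Qed.

Lemma Im_Re z : complex.Im z = complex.Re (- (0 +i* 1) * z).
Proof. by case: z => x y /=; ring. Qed.

Lemma holomorphic_harmonic A (f g g1 g2 : C -> C) : open A ->
  (forall z, A z -> g z = f z) ->
  (forall z, A z -> has_cderiv g z (g1 z)) ->
  (forall z, A z -> has_cderiv g1 z (g2 z)) ->
  (forall z, A z -> normc_continuous g2 z) ->
  Defs.harmonic A f.
Proof.
move=> oA gf h1 h2 h3; split.
  apply: (harmonic_real_eq oA _ (harmonic_real_Re 1 oA h1 h2 h3)).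
  by move=> w Aw; rewrite mul1r gf.
apply: (harmonic_real_eq oA _ (harmonic_real_Re (- (0 +i* 1)) oA h1 h2 h3)).
by move=> w Aw; rewrite [RHS]Im_Re gf.
Qed.

Lemma holomorphic_wirtinger_bar A (f g : C -> C) c z : open A -> A z ->
  (forall w, A w -> g w = f w) -> has_cderiv g z c -> wirtinger_bar f z = 0.
Proof.
move=> oA Az gf gd.
have re b : axis_pd b (fun w => complex.Re (f w)) z = complex.Re (c * axis b).
  apply: is_axis_deriv_pd; rewrite -[c]mul1r.
  apply: (is_axis_deriv_near_eq oA _ Az (cderiv_axis_deriv_Re 1 b gd)) => w Aw.
  by rewrite mul1r gf.
have im b : axis_pd b (fun w => complex.Im (f w)) z = complex.Im (c * axis b).
  apply: is_axis_deriv_pd; rewrite Im_Re mulrA.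
  apply: (is_axis_deriv_near_eq oA _ Az (cderiv_axis_deriv_Re (- (0 +i* 1)) b gd)) => w Aw.
  by rewrite [RHS]Im_Re gf.
have ex : cpartialx f z = c * axis false.
  rewrite /cpartialx -[partialx _ z]/(axis_pd false _ z) -[partialx (fun w => complex.Im (f w)) z]/(axis_pd false _ z).
  by rewrite re im; case: (c * axis false).
have ey : cpartialy f z = c * axis true.
  rewrite /cpartialy -[partialy _ z]/(axis_pd true _ z) -[partialy (fun w => complex.Im (f w)) z]/(axis_pd true _ z).
  by rewrite re im; case: (c * axis true).
rewrite /wirtinger_bar ex ey.
have -> : c * axis false + (0 +i* 1) * (c * axis true) = c * (1 + (0 +i* 1) * (0 +i* 1)).
  by rewrite /axis; ring.
rewrite (_ : 1 + _ = 0) ?mulr0 ?mul0r//.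
by apply/eqP; rewrite eq_complex /=; apply/andP; split; apply/eqP; ring.
Qed.

End Holomorphic.

(** * Moebius maps; non-compactness *)

Section Mobius.
Context {R : realType}.
Local Notation C := (R[i]^o).
Local Notation D := (unit_disk R).
Implicit Types (z w h c : R[i]) (a e d r t : R).

Lemma unit_diskE z : D z <-> normc z < 1.
Proof. by []. Qed.

Definition mobius a z : R[i] := (z + a%:C) / (1 + a%:C * z).

Lemma mobius_den_ge a z : `|a| < 1 -> D z -> 1 - `|a| <= normc (1 + a%:C * z).
Proof.
move=> a1 /unit_diskE z1; have := le_normcB 1 (1 + a%:C * z).
rewrite normc1 opprD addrA subrr sub0r normcN normcM normc_real.
by have := normr_ge0 a; nra.
Qed.

Lemma mobius_den_neq0 a z : `|a| < 1 -> D z -> 1 + a%:C * z != 0.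
Proof.
move=> a1 Dz; apply/eqP => E; have := mobius_den_ge a1 Dz.
by rewrite E normc0; lra.
Qed.

Lemma mobius_disk a z : `|a| < 1 -> D z -> D (mobius a z).
Proof.
move=> a1 Dz; have z1 := (unit_diskE _).1 Dz; have d0 := mobius_den_neq0 a1 Dz.
apply/unit_diskE; rewrite /mobius normcM normcV.
have dp : 0 < normc (1 + a%:C * z).
  by rewrite lt_neqAle normc_ge0 andbT eq_sym; apply: contra d0 => /eqP/eq0_normc ->.
rewrite ltr_pdivrMr// mul1r normc_lt ?normc_ge0// normc_sqr.
move: z1; rewrite normc_lt// expr1n; case: (z) => x y /= z1.
have a2 : a ^+ 2 < 1 by rewrite -real_normK ?num_real// expr_lt1.
rewrite !(mul0r, subr0, addr0, add0r, mulr0).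
by nra.
Qed.

Lemma mobiusK a z : `|a| < 1 -> D z -> mobius (- a) (mobius a z) = z.
Proof.
move=> a1 Dz; have d0 := mobius_den_neq0 a1 Dz.
have aC : 1 - a%:C * a%:C != 0.
  rewrite -rmorphM -(rmorph1 (@real_complex R)) -rmorphB/=.
  have : a ^+ 2 < 1 by rewrite -real_normK ?num_real// expr_lt1.
  by move=> h; apply/eqP => /(congr1 (@complex.Re R)) /=; rewrite -expr2; lra.
rewrite /mobius rmorphN/=.
have d1 : 1 + - a%:C * ((z + a%:C) / (1 + a%:C * z)) = (1 - a%:C * a%:C) / (1 + a%:C * z).
  by field.
by rewrite d1; field; rewrite d0 aC.
Qed.

Lemma mobiusB a z w : `|a| < 1 -> D z -> D w ->
  mobius a w - mobius a z = (1 - a%:C ^+ 2) * (w - z) / ((1 + a%:C * z) * (1 + a%:C * w)).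
Proof.
move=> a1 Dz Dw; have d0 := mobius_den_neq0 a1 Dz; have d1 := mobius_den_neq0 a1 Dw.
by rewrite /mobius; field; rewrite d0 d1.
Qed.

Lemma mobius_inv_le a z : `|a| < 1 -> D z -> normc (1 + a%:C * z)^-1 <= (1 - `|a|)^-1.
Proof.
move=> a1 Dz; have h := mobius_den_ge a1 Dz.
by rewrite normcV lef_pV2 ?posrE//; lra.
Qed.

Lemma mobius_lipschitz a : `|a| < 1 -> exists2 L : R, 0 < L &
  forall z w, D z -> D w -> normc (mobius a w - mobius a z) <= L * normc (w - z).
Proof.
move=> a1; have m0 : 0 < 1 - `|a| by rewrite subr_gt0.
exists ((normc (1 - a%:C ^+ 2) + 1) * ((1 - `|a|)^-1 * (1 - `|a|)^-1)).
  rewrite !mulr_gt0 ?invr_gt0//; have := normc_ge0 (1 - a%:C ^+ 2); lra.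
move=> z w Dz Dw; rewrite mobiusB// invfM !normcM.
rewrite [leRHS]mulrAC; apply: ler_pM; rewrite ?mulr_ge0 ?normc_ge0//.
  by rewrite ler_wpM2r ?normc_ge0//; lra.
by apply: ler_pM; rewrite ?normc_ge0//; exact: mobius_inv_le.
Qed.

Let inv_den a z := (1 + a%:C * z)^-1 : R[i].

Lemma disk_nbhd z : D z -> exists2 r, 0 < r & forall h, normc h < r -> D (z + h).
Proof.
move=> /(open_normc unit_disk_open)[r r0 Hr]; exists r => // h hr.
by apply: Hr; rewrite addrC addKr.
Qed.

Lemma mobius_cderiv a z : `|a| < 1 -> D z ->
  has_cderiv (mobius a) z ((1 - a%:C ^+ 2) * inv_den a z ^+ 2).
Proof.
move=> a1 Dz; have [r r0 Hr] := disk_nbhd Dz.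
have m0 : 0 < 1 - `|a| by rewrite subr_gt0.
set M := (1 - `|a|)^-1; have M0 : 0 <= M by rewrite invr_ge0 ltW.
apply: (cderiv_quadratic (k := normc ((1 - a%:C ^+ 2) * a%:C) * (M * M * M)) r0).
  by rewrite !mulr_ge0 ?normc_ge0.
move=> h hr; have Dh := Hr _ hr.
have d0 := mobius_den_neq0 a1 Dz; have d1 := mobius_den_neq0 a1 Dh.
have -> : mobius a (z + h) - mobius a z - (1 - a%:C ^+ 2) * inv_den a z ^+ 2 * h =
  - ((1 - a%:C ^+ 2) * a%:C) * (inv_den a z * inv_den a z * inv_den a (z + h)) * (h * h).
  by rewrite mobiusB// /inv_den; field; rewrite d0 d1.
rewrite expr2 (normcM _ (h * h)) (normcM h); apply: ler_pM; rewrite ?mulr_ge0 ?normc_ge0//.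
rewrite (normcM _ (_ * _ * inv_den a (z + h))) normcN; apply: ler_pM; rewrite ?mulr_ge0 ?normc_ge0//.
by rewrite !normcM !ler_pM ?mulr_ge0 ?normc_ge0 ?mobius_inv_le.
Qed.

Lemma mobius_cderiv2 a z : `|a| < 1 -> D z ->
  has_cderiv (fun z => (1 - a%:C ^+ 2) * inv_den a z ^+ 2) z
    (- 2 * a%:C * (1 - a%:C ^+ 2) * inv_den a z ^+ 3).
Proof.
move=> a1 Dz; have [r r0 Hr] := disk_nbhd Dz.
have m0 : 0 < 1 - `|a| by rewrite subr_gt0.
set M := (1 - `|a|)^-1; have M0 : 0 <= M by rewrite invr_ge0 ltW.
apply: (cderiv_quadratic (k := normc ((1 - a%:C ^+ 2) * a%:C ^+ 2) * (M * M * M * (M + M + M))) r0).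
  by rewrite !mulr_ge0 ?normc_ge0// !addr_ge0.
move=> h hr; have Dh := Hr _ hr.
have d0 := mobius_den_neq0 a1 Dz; have d1 := mobius_den_neq0 a1 Dh.
rewrite (_ : _ - _ - _ =
  (1 - a%:C ^+ 2) * a%:C ^+ 2 * (inv_den a z * inv_den a z * inv_den a (z + h) *
    (inv_den a (z + h) + inv_den a z + inv_den a z)) * (h * h)); last first.
  by rewrite /inv_den; field; rewrite d0 d1.
have Mz := mobius_inv_le a1 Dz; have Mh := mobius_inv_le a1 Dh.
rewrite expr2 (normcM _ (h * h)) (normcM h); apply: ler_pM; rewrite ?mulr_ge0 ?normc_ge0//.
rewrite (normcM _ (_ * (_ + _ + _))); apply: ler_pM; rewrite ?mulr_ge0 ?normc_ge0//.
rewrite !normcM !ler_pM ?mulr_ge0 ?normc_ge0//.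
by apply: (le_trans (le_normcD _ _)); apply: lerD => //; apply: (le_trans (le_normcD _ _)); apply: lerD.
Qed.

Lemma mobius_deriv2_cont a z : `|a| < 1 -> D z ->
  normc_continuous (fun z => - 2 * a%:C * (1 - a%:C ^+ 2) * inv_den a z ^+ 3) z.
Proof.
move=> a1 Dz; have [r r0 Hr] := disk_nbhd Dz.
have m0 : 0 < 1 - `|a| by rewrite subr_gt0.
set M := (1 - `|a|)^-1; have M0 : 0 <= M by rewrite invr_ge0 ltW.
set c := - 2 * a%:C * (1 - a%:C ^+ 2).
pose k := normc (c * - a%:C) * (M * M * (M * M + M * M + M * M)).
have k0 : 0 <= k by rewrite !mulr_ge0 ?normc_ge0// !addr_ge0// mulr_ge0.
move=> e e0; exists (Num.min r (e / (k + 1))).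
  by rewrite lt_min r0 divr_gt0//; lra.
move=> h; rewrite lt_min => /andP[hr]; rewrite ltr_pdivlMr; last lra.
move=> he; have Dh := Hr _ hr.
have d0 := mobius_den_neq0 a1 Dz; have d1 := mobius_den_neq0 a1 Dh.
rewrite (_ : _ - _ = c * - a%:C * (inv_den a z * inv_den a (z + h) *
    (inv_den a (z + h) * inv_den a (z + h) + inv_den a (z + h) * inv_den a z +
     inv_den a z * inv_den a z)) * h); last first.
  by rewrite /inv_den; field; rewrite d0 d1.
have Mz := mobius_inv_le a1 Dz; have Mh := mobius_inv_le a1 Dh.
rewrite (normcM _ h).
apply: (@le_trans _ _ (k * normc h)); last by have := normc_ge0 h; lra.
apply: ler_wpM2r; first exact: normc_ge0.
rewrite (normcM _ (_ * (_ + _ + _))); apply: ler_pM; rewrite ?mulr_ge0 ?normc_ge0//.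
rewrite !normcM !ler_pM ?mulr_ge0 ?normc_ge0//.
apply: (le_trans (le_normcD _ _)); apply: lerD; last by rewrite normcM ler_pM ?normc_ge0.
by apply: (le_trans (le_normcD _ _)); apply: lerD; rewrite normcM ler_pM ?normc_ge0.
Qed.

End Mobius.

Section MobiusMaps.
Context {R : realType}.
Local Notation C := (R[i]^o).
Local Notation D := (unit_disk R).
Implicit Types (z w h c : R[i]) (a e d r t : R).

Definition cis t : R[i] := cos t +i* sin t.

Lemma cisD s t : cis (s + t) = cis s * cis t.
Proof.
by rewrite /cis cosD sinD; apply/eqP; rewrite eq_complex /=; apply/andP; split; apply/eqP; ring.
Qed.

Lemma normc_cis t : normc (cis t) = 1.
Proof. by rewrite /cis normcE cos2Dsin2 sqrtr1. Qed.

Definition princ_arg w : R := atan (complex.Im w / complex.Re w).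

Lemma princ_argE w : 0 < complex.Re w -> w = (normc w)%:C * cis (princ_arg w).
Proof.
case: w => x y /= x0; rewrite /princ_arg /cis /=.
have sE : sin (atan (y / x)) = (y / x) * cos (atan (y / x)).
  by rewrite -{2}[y / x]atanK /tan divfK// gt_eqF// cos_gt0_pihalf// atan_gtNpi2 atan_ltpi2.
have cE : Num.sqrt (x ^+ 2 + y ^+ 2) * cos (atan (y / x)) = x.
  rewrite cos_atan.
  have -> : x ^+ 2 + y ^+ 2 = x ^+ 2 * (1 + (y / x) ^+ 2) by field; rewrite gt_eqF.
  rewrite sqrtrM ?sqr_ge0// sqrtr_sqr gtr0_norm// mulfK// gt_eqF// sqrtr_gt0.
  by rewrite ltr_pwDl// sqr_ge0.
apply/eqP; rewrite eq_complex /= !mul0r subr0 addr0 sE mulrCA cE; apply/andP; split => //.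
by apply/eqP; field; rewrite gt_eqF.
Qed.

Definition mobius_map a (a1 : `|a| < 1) (w : disk R) : disk R :=
  disk_pt (mobius_disk a1 (disk_ptP w)).

Lemma plane_mobius a (a1 : `|a| < 1) z : D z -> plane_map (mobius_map a1) z = mobius a z.
Proof. by move=> Dz; rewrite (plane_mapE _ Dz). Qed.

Lemma mobius_map_continuous a (a1 : `|a| < 1) : continuous (mobius_map a1).
Proof.
apply: disk_map_continuous => z Dz e e0; have [L L0 HL] := mobius_lipschitz a1.
exists (e / L); first by rewrite divr_gt0.
move=> w Dw; rewrite ltr_pdivlMr// mulrC => wz.
by rewrite !plane_mobius//; apply: le_lt_trans wz; exact: HL.
Qed.

Lemma mobius_mapK a (a1 : `|a| < 1) (b1 : `|- a| < 1) : cancel (mobius_map a1) (mobius_map b1).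
Proof. by move=> w; apply: val_inj => /=; exact: mobiusK (disk_ptP w). Qed.

Lemma mobius_map_homeo a (a1 : `|a| < 1) : homeomorphism (mobius_map a1).
Proof.
split; first exact: mobius_map_continuous.
have b1 : `|- a| < 1 by rewrite normrN.
exists (mobius_map b1); split; [exact: mobius_map_continuous|exact: mobius_mapK|].
move=> w; apply: val_inj => /=.
by have := mobiusK b1 (disk_ptP w); rewrite opprK.
Qed.

Lemma circle_pointE z r t : circle_point z r t = z + r%:C * cis t.
Proof. by congr (z + _); apply/eqP; rewrite eq_complex /=; apply/andP; split; apply/eqP; ring. Qed.

Lemma mobius_den_Re a z : `|a| < 1 -> D z -> 0 < complex.Re (1 + a%:C * z).
Proof.
move=> a1 /unit_diskE z1; have := normc_Re z; rewrite ler_norml => /andP[h1 h2].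
move: a1; rewrite ltr_norml => /andP[a1 a2].
have -> : complex.Re (1 + a%:C * z) = 1 + a * complex.Re z.
  by case: (z) => x y /=; rewrite mul0r subr0.
have p1 : 0 < (1 + a) * (1 + complex.Re z) by apply: mulr_gt0; lra.
have p2 : 0 < (1 - a) * (1 - complex.Re z) by apply: mulr_gt0; lra.
by lra.
Qed.

(** The increment of a Moebius map along a circle is [r e^(it)] divided by two
    numbers of the right half-plane, where the principal argument is continuous. *)
Lemma mobius_orientation a (a1 : `|a| < 1) : orientation_preserving D (plane_map (mobius_map a1)).
Proof.
move=> z0 r r0 Hr.
have Dc t : D (circle_point z0 r t).
  apply: Hr; rewrite circle_pointE addrC addKr normcM normc_real normc_cis mulr1.
  by rewrite gtr0_norm.
have D0 : D z0 by apply: Hr; rewrite subrr normc0 ltW.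
pose w t := 1 + a%:C * circle_point z0 r t; pose w0 := 1 + a%:C * z0.
have a2 : 0 < 1 - a ^+ 2.
  by rewrite subr_gt0 -real_normK ?num_real// expr_lt1.
have wRe t : 0 < complex.Re (w t) by exact: mobius_den_Re.
have w0Re : 0 < complex.Re w0 by exact: mobius_den_Re.
have wE t : complex.Re (w t) = 1 + a * (complex.Re z0 + r * cos t).
  by rewrite /w /circle_point; case: (z0) => x y /=; rewrite mul0r subr0.
have wIm t : complex.Im (w t) = a * (complex.Im z0 + r * sin t).
  by rewrite /w /circle_point; case: (z0) => x y /=; rewrite mul0r addr0 add0r.
pose theta t := t - princ_arg w0 - princ_arg (w t).
have theta_c : continuous theta.
  move=> t; apply: (@continuousB _ _ _ (fun t => t - princ_arg w0) (fun t => princ_arg (w t))).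
    by apply: (@continuousB _ _ _ id (fun=> princ_arg w0)); [exact: cvg_id|exact: cst_continuous].
  apply: (@continuous_comp _ _ _ (fun t => complex.Im (w t) / complex.Re (w t)) atan); last exact: continuous_atan.
  have -> : (fun t => complex.Im (w t) / complex.Re (w t)) =
    (fun t => a * (complex.Im z0 + r * sin t) * (1 + a * (complex.Re z0 + r * cos t))^-1).
    by apply/funext => s; rewrite wE wIm.
  apply: (@continuousM _ _ (fun t => a * (complex.Im z0 + r * sin t))
    (fun t => (1 + a * (complex.Re z0 + r * cos t))^-1)).
    apply: (@continuousM _ _ (fun=> a) (fun t => complex.Im z0 + r * sin t)); first exact: cst_continuous.
    apply: (@continuousD R R R (fun=> complex.Im z0) (fun t => r * sin t)); first exact: cst_continuous.
    by apply: (@continuousM _ _ (fun=> r)); [exact: cst_continuous|exact: continuous_sin].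
  apply: continuousV; first by rewrite -wE gt_eqF.
  apply: (@continuousD R R R (fun=> 1) (fun t => a * (complex.Re z0 + r * cos t))); first exact: cst_continuous.
  apply: (@continuousM _ _ (fun=> a) (fun t => complex.Re z0 + r * cos t)); first exact: cst_continuous.
  apply: (@continuousD R R R (fun=> complex.Re z0) (fun t => r * cos t)); first exact: cst_continuous.
  by apply: (@continuousM _ _ (fun=> r)); [exact: cst_continuous|exact: continuous_cos].
exists theta; split.
- exact: continuous_subspaceT.
- move=> t _ /=; rewrite !plane_mobius// mobiusB//.
  pose rho := (1 - a ^+ 2) * r / (normc w0 * normc (w t)).
  have n0 (x : R[i]) : 0 < complex.Re x -> 0 < normc x.
    by move=> x0; apply: lt_le_trans (normc_Re x); rewrite normr_gt0 gt_eqF.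
  have nw0 := n0 _ w0Re; have nw := n0 _ (wRe t).
  have rho0 : 0 < rho by rewrite /rho divr_gt0 ?mulr_gt0.
  have cisN0 s : cis s != 0.
    by apply/eqP => E; have := normc_cis s; rewrite E normc0 => /eqP; rewrite eq_sym oner_eq0.
  have -> : (1 - a%:C ^+ 2) * (circle_point z0 r t - z0) /
      ((1 + a%:C * z0) * (1 + a%:C * circle_point z0 r t)) = rho%:C * cis (theta t).
    rewrite -/(w t) -/w0 {1}(princ_argE w0Re) {1}(princ_argE (wRe t)).
    rewrite circle_pointE (addrC z0) addrK.
    have -> : cis t = cis (theta t) * cis (princ_arg w0) * cis (princ_arg (w t)).
      by rewrite -!cisD /theta; congr cis; ring.
    have -> : rho%:C = (1 - a%:C ^+ 2) * r%:C / ((normc w0)%:C * (normc (w t))%:C).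
      by rewrite /rho fmorph_div !rmorphM rmorphB rmorphXn rmorph1.
    field; rewrite !cisN0 !fmorph_eq0.
    by rewrite !gt_eqF.
  by rewrite normcM normc_cis mulr1 normc_real gtr0_norm.
- have -> : 2 * pi = pi *+ 2 :> R by rewrite mulr_natl.
  rewrite /theta.
  have -> : w (pi *+ 2) = w 0 by rewrite /w /circle_point cos2pi sin2pi cos0 sin0.
  by ring.
Qed.

Lemma lipschitz_abs_continuous (g : R -> C) (a b L : R) : 0 < L ->
  (forall s t, a <= s <= b -> a <= t <= b -> normc (g t - g s) <= L * `|t - s|) ->
  absolutely_continuous a b g.
Proof.
move=> L0 gL e e0; exists (e / L); first by rewrite divr_gt0.
move=> n s t st _; rewrite ltr_pdivlMr// mulrC => H; apply: le_lt_trans H.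
rewrite mulr_sumr; apply: ler_sum => i _; have [h1 [h2 h3]] := st i.
rewrite -[t i - s i]ger0_norm ?subr_ge0//; apply: gL.
  by rewrite h1 (le_trans h2).
by rewrite h3 (le_trans h1).
Qed.

Lemma lipschitz_ACL (f : C -> C) (L : R) : 0 < L ->
  (forall z w, D z -> D w -> normc (f w - f z) <= L * normc (w - z)) -> ACL D f.
Proof.
move=> L0 fL a b c d rect; split; apply: aeW => y yd; apply: (lipschitz_abs_continuous L0) => s t hs ht.
  apply: (le_trans (fL _ _ _ _)); [exact: rect|exact: rect|].
  by rewrite ler_pM2l// (_ : _ - _ = (t - s)%:C) ?normc_real//; apply/eqP; rewrite eq_complex /= subrr !eqxx.
apply: (le_trans (fL _ _ _ _)); [exact: rect|exact: rect|].
by rewrite ler_pM2l// (_ : _ - _ = 0 +i* (t - s)) ?normc_imag//; apply/eqP; rewrite eq_complex /= subrr !eqxx.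
Qed.

Lemma mobius_quasiconformal a (a1 : `|a| < 1) : quasiconformal (mobius_map a1).
Proof.
exists 1 => //; split.
- exact: mobius_map_homeo.
- exact: mobius_orientation.
- have [L L0 HL] := mobius_lipschitz a1; apply: (lipschitz_ACL L0) => z w Dz Dw.
  by rewrite !plane_mobius//; exact: HL.
- apply: aeW => p Dp; rewrite subrr !mul0r.
  have -> : wirtinger_bar (plane_map (mobius_map a1)) (p.1 +i* p.2) = 0.
    apply: (holomorphic_wirtinger_bar unit_disk_open Dp _ (mobius_cderiv a1 Dp)).
    by move=> w Dw; rewrite plane_mobius.
  by rewrite normc0.
Qed.

Definition mobius_Q a (a1 : `|a| < 1) : Q R := MkQ (mobius_quasiconformal a1).

Lemma mobius_HQ a (a1 : `|a| < 1) : HQ R (mobius_Q a1).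
Proof.
apply: (holomorphic_harmonic unit_disk_open _ (fun z => @mobius_cderiv R a z a1)
  (fun z => @mobius_cderiv2 R a z a1) (fun z => @mobius_deriv2_cont R a z a1)).
by move=> z Dz; rewrite plane_mobius.
Qed.

(** The continuous function [|f 0|] takes values arbitrarily close to [1] on the
    Moebius maps, but never the value [1]. *)
Lemma HQ_not_compact : ~ compact [set: set_type (HQ R)].
Proof.
move=> cpt.
pose N0 (f : set_type (HQ R)) : R := normc (plane_map (set_val f : Q R) 0).
have N0c : continuous N0.
  have cQ : continuous (fun f : Q R => normc (plane_map f 0) : R).
    move=> f; apply/(@cvgrPdist_lt _ _ _ _ (nbhs_filter f)) => e e0.
    have : nbhs f (ball f e) by exact: nbhsx_ballx.
    apply: (@filterS _ _ (nbhs_filter f)) => g /Q_ballE fg; apply: le_lt_trans fg.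
    apply: le_trans (le_d_sup f g disk0).
    rewrite ler_norml; have := le_normcB (plane_map f 0) (plane_map g 0).
    by have := le_normcB (plane_map g 0) (plane_map f 0); rewrite (distcC (plane_map g 0)) => *; apply/andP; split; lra.
  move=> f; apply: (@continuous_comp _ _ _ set_val (fun f : Q R => normc (plane_map f 0) : R)).
    exact: initial_continuous.
  exact: cQ.
have norm0 : `|0 : R| < 1 by rewrite normr0.
have [||c _ cmax] := @compact_EVT_max _ R N0 setT _ cpt.
- by exists (exist _ (mobius_Q norm0) (mem_set (mobius_HQ norm0))).
- exact: continuous_subspaceT.
have c1 : N0 c < 1 by have := plane_map_disk (set_val c : Q R) disk0.
pose a := (N0 c + 1) / 2.
have a0 : 0 < a by rewrite /a; have : 0 <= N0 c by [exact: normc_ge0]; lra.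
have a1 : `|a| < 1 by rewrite gtr0_norm// /a; lra.
have E : plane_map (mobius_Q a1) 0 = a%:C.
  rewrite (plane_mobius a1); last exact: disk0.
  by rewrite /mobius mulr0 addr0 add0r divr1.
have := cmax (exist _ (mobius_Q a1) (mem_set (mobius_HQ a1))) (mem_set I).
rewrite {1}/N0 [normc _](_ : _ = normc (plane_map (mobius_Q a1) 0))// E normc_real gtr0_norm//.
by rewrite /a; lra.
Qed.

End MobiusMaps.

(** * Area of disjoint squares *)

Section SquarePacking.
Context {R : realType}.
Local Notation mu := (@lebesgue_measure R).
Implicit Types (x y s t : R).

Lemma itv_oo_measure x s : 0 <= s ->
  mu [set` `]x - s, x + s[] = (2 * s)%:E.
Proof.
move=> s0; rewrite lebesgue_measure_itv /= lte_fin.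
case: ifPn => [_|]; first by rewrite -EFinB; congr EFin; ring.
by rewrite -leNgt => h; congr EFin; lra.
Qed.

Definition square (p : R * R) s : set (R * R) :=
  [set` `]p.1 - s, p.1 + s[] `*` [set` `]p.2 - s, p.2 + s[].

Lemma square_measurable p s : measurable (square p s).
Proof. by apply: measurableX; exact: measurable_itv. Qed.

Lemma square_measure p s : 0 <= s -> (mu \x mu)%E (square p s) = ((2 * s) ^+ 2)%:E.
Proof.
move=> s0; rewrite /square product_measure1E; [|exact: measurable_itv|exact: measurable_itv].
by rewrite [X in (X * _)%E](itv_oo_measure p.1 s0) [X in (_ * X)%E](itv_oo_measure p.2 s0) -EFinM.
Qed.

Lemma square_packing (I : finType) (P : pred I) (p : I -> R * R) (s : I -> R) :
  (forall i, P i -> 0 <= s i) ->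
  (forall i j, P i -> P j -> square (p i) (s i) `&` square (p j) (s j) !=set0 -> i = j) ->
  (forall i, P i -> square (p i) (s i) `<=` square (0, 0) 1) ->
  \sum_(i | P i) (2 * s i) ^+ 2 <= 4.
Proof.
move=> s0 disj sub.
pose r := [seq i <- index_enum I | P i].
have rP i : i \in r = P i by rewrite mem_filter mem_index_enum andbT.
have ur : uniq r by rewrite filter_uniq// index_enum_uniq.
have fin : finite_set [set` r] by exact: finite_seq.
have : ((mu \x mu) (\bigcup_(i in [set` r]) square (p i) (s i)) <= (mu \x mu) (square (0%R, 0%R) 1))%E.
  apply: le_measure; rewrite ?inE.
  - by apply: fin_bigcup_measurable => // i _; exact: square_measurable.
  - exact: square_measurable.
  - by move=> q [i /=]; rewrite rP => Pi; exact: sub.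
rewrite (@measure_fin_bigcup _ _ _ (mu \x mu)%E I [set` r] (fun i => square (p i) (s i)) fin).
- rewrite square_measure// -fsbig_seq// big_filter mulr1.
  rewrite (eq_bigr (fun i => ((2 * s i) ^+ 2)%:E)); last by move=> i /s0; exact: square_measure.
  by rewrite sumEFin lee_fin; lra.
- by move=> i j /=; rewrite !rP => Pi Pj; exact: disj.
- by move=> i _; exact: square_measurable.
Qed.

End SquarePacking.

(** * Images of small disks under a smooth quasiconformal map *)

Section SmoothQuasiconformal.
Context {R : realType}.
Local Notation C := (R[i]^o).
Local Notation D := (unit_disk R).
Implicit Types (z w h : R[i]) (e d r t k rho : R) (F G : C -> C).

(** What uniform continuity requires of a harmonic quasiconformal map [F] of inverse
    [G]: by smoothness, the dilatation inequality holds at every point. *)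
Record smooth_qc F G k : Prop := SmoothQC {
  qc_ran : forall z, D z -> D (F z);
  qc_inv_ran : forall z, D z -> D (G z);
  qc_can : forall z, D z -> G (F z) = z;
  qc_inv_can : forall w, D w -> F (G w) = w;
  qc_cont : forall z, D z -> normc_continuous F z;
  qc_inv_cont : forall z, D z -> normc_continuous G z;
  qc_C1_Re : C1_on D (fun z => complex.Re (F z));
  qc_C1_Im : C1_on D (fun z => complex.Im (F z));
  qc_lt1 : 0 <= k < 1;
  qc_dil : forall z, D z -> normc (wirtinger_bar F z) <= k * normc (wirtinger F z) }.

Lemma normc_conj z : normc (conjc z) = normc z.
Proof. by case: z => x y; rewrite !normcE /= sqrrN. Qed.

Lemma wirtinger_linear F z h :
  wirtinger F z * h + wirtinger_bar F z * conjc h =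
  (axis_pd false (fun z => complex.Re (F z)) z * complex.Re h +
   axis_pd true (fun z => complex.Re (F z)) z * complex.Im h) +i*
  (axis_pd false (fun z => complex.Im (F z)) z * complex.Re h +
   axis_pd true (fun z => complex.Im (F z)) z * complex.Im h).
Proof.
rewrite /wirtinger /wirtinger_bar.
have -> : cpartialx F z = axis_pd false (fun z => complex.Re (F z)) z +i*
  axis_pd false (fun z => complex.Im (F z)) z by [].
have -> : cpartialy F z = axis_pd true (fun z => complex.Re (F z)) z +i*
  axis_pd true (fun z => complex.Im (F z)) z by [].
move: (axis_pd false _ z) (axis_pd false _ z) (axis_pd true _ z) (axis_pd true _ z) => b a d c.
case: h => x y.
have two : (2 : R[i]) != 0 by rewrite pnatr_eq0.
have regroup (P S u v : R[i]) : P / 2 * u + S / 2 * v = (P * u + S * v) / 2 by ring.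
rewrite regroup; apply: (canLR (mulfK two)).
by apply/eqP; rewrite eq_complex /=; apply/andP; split; apply/eqP; ring.
Qed.

(** The partial derivatives are uniformly continuous on a compact subdisk, which
    makes the first order expansion uniform in the centre.  A relative error of [1]
    is enough: errors proportional to the mesh of a grid contribute a bounded
    amount to the discrete energy. *)
Lemma first_order F G k r : smooth_qc F G k -> r < 1 ->
  exists2 tau, 0 < tau & forall z, normc z <= r -> forall h, normc h < tau ->
    D (z + h) /\
    normc (F (z + h) - F z - (wirtinger F z * h + wirtinger_bar F z * conjc h)) <= normc h.
Proof.
move=> qc r1.
have rD z : normc z <= r -> D z by move=> zr; apply: le_lt_trans zr r1.
have unif u : C1_on D u -> exists2 d, 0 < d & forall z, normc z <= r -> forall w, normc (w - z) < d ->
    forall b, `|axis_pd b u w - axis_pd b u z| <= 1 / 4.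
  move=> /C1_onP u1.
  have e0 : 0 < 1 / 4 :> R by lra.
  have H b := @compact_unif_continuous _ _ (axis_pd b u) _ (@compact_cdisk R r) (fun z zr => (u1 z (rD z zr) b).2) e0.
  have [d0 d00 H0] := H false; have [d1 d10 H1] := H true.
  exists (Num.min d0 d1); first by rewrite lt_min d00.
  move=> z zr w; rewrite lt_min => /andP[w0 w1] []; apply: ltW; [exact: H1|exact: H0].
have [d0 d00 H0] := unif _ (qc_C1_Re qc); have [d1 d10 H1] := unif _ (qc_C1_Im qc).
have r10 : 0 < 1 - r by lra.
exists (Num.min (1 - r) (Num.min d0 d1)); first by rewrite !lt_min r10 d00 d10.
move=> z zr h; rewrite !lt_min => /and3P[hr h0 h1].
have zD : forall w, normc (w - z) < 1 - r -> D w.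
  by move=> w wz; have := le_normcB w z; rewrite /unit_disk /=; lra.
split; first by apply: zD; rewrite addrC addKr.
have big u d : 0 < d -> C1_on D u -> (forall z, normc z <= r -> forall w, normc (w - z) < d ->
    forall b, `|axis_pd b u w - axis_pd b u z| <= 1 / 4) -> normc h < d ->
    `|u (z + h) - u z - (axis_pd false u z * complex.Re h + axis_pd true u z * complex.Im h)| <= 1 / 2 * normc h.
  move=> dd0 u1 Hu hd.
  have -> : 1 / 2 = 2 * (1 / 4) :> R by lra.
  apply: (@C1_increment _ D _ _ _ (Num.min (1 - r) d)) => //.
  - by move=> w; rewrite lt_min => /andP[/zD].
  - by move=> w; rewrite lt_min => /andP[_ wd] b; exact: Hu.
  - by rewrite lt_min hr hd.
have B0 := big _ _ d00 (qc_C1_Re qc) H0 h0; have B1 := big _ _ d10 (qc_C1_Im qc) H1 h1.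
apply: (le_trans (normc_ReIm _)); rewrite wirtinger_linear.
move: B0 B1; set X := `|_ - _|; set Y := `|_ - _| => BX BY.
set X' := `|_|; set Y' := `|_|.
have -> : X' = X by rewrite /X' /X !raddfB.
have -> : Y' = Y by rewrite /Y' /Y !raddfB.
by lra.
Qed.

(** The differential is [h |-> a h + b (conjc h)] with [|b| <= k |a|], so its greatest
    and least stretchings are comparable. *)
Lemma qc_linear_bounds F G k z h : smooth_qc F G k -> D z ->
  (1 - k) * normc (wirtinger F z) * normc h <=
    normc (wirtinger F z * h + wirtinger_bar F z * conjc h) <=
  2 * normc (wirtinger F z) * normc h.
Proof.
move=> qc Dz; have := qc_dil qc Dz; have /andP[k0 k1] := qc_lt1 qc.
move: (wirtinger F z) (wirtinger_bar F z) => a b ba.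
have := le_normcD (a * h) (b * conjc h).
have := le_normcB (a * h) (a * h + b * conjc h).
rewrite opprD addrA subrr sub0r normcN !normcM normc_conj.
have := ler_wpM2r (normc_ge0 h) ba.
have : k * normc a * normc h <= normc a * normc h.
  by rewrite -mulrA ler_piMl ?mulr_ge0 ?normc_ge0// ltW.
by move=> *; apply/andP; split; lra.
Qed.

Lemma continuous_normc_comp F (z : C) : normc_continuous F z ->
  {for z, continuous (fun z : C => normc (F z) : R)}.
Proof.
move=> H; apply/continuousC_epsP => e e0; have e2 : 0 < e / 2 by lra.
have [d d0 Hd] := H _ e2; exists d => // w wd.
have := Hd _ wd; rewrite (addrC z) subrK => hw.
rewrite ltr_norml; have := le_normcB (F w) (F z); have := le_normcB (F z) (F w).
by rewrite (distcC (F z)) => *; apply/andP; split; lra.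
Qed.

Lemma qc_max F r : (forall z, D z -> normc_continuous F z) -> (forall z, D z -> D (F z)) -> 0 <= r -> r < 1 ->
  exists2 r', 0 <= r' < 1 & forall z, normc z <= r -> normc (F z) <= r'.
Proof.
move=> Fc FD r0 r1.
have rD z : normc z <= r -> D z by move=> zr; apply: le_lt_trans zr r1.
have [||c cr Hc] := @compact_max_C _ _ (fun z : C => normc (F z) : R) _ (@compact_cdisk R r).
- by exists 0; change (normc (0 : R[i]) <= r); rewrite normc0.
- by move=> z /rD Dz; apply: continuous_normc_comp; exact: Fc.
exists (normc (F c)) => //; rewrite normc_ge0 /=.
exact: (FD _ (rD _ cr)).
Qed.

Definition segment_pt (p q : R[i]) t : R[i] := p + t%:C * (q - p).

Lemma segment_pt0 p q : segment_pt p q 0 = p. Proof. by rewrite /segment_pt mul0r addr0. Qed.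
Lemma segment_pt1 p q : segment_pt p q 1 = q. Proof. by rewrite /segment_pt mul1r addrC subrK. Qed.

Lemma segment_ptB p q t : segment_pt p q t - p = t%:C * (q - p).
Proof. by rewrite /segment_pt addrC addKr. Qed.

Lemma normc_segment_pt p q t : 0 <= t <= 1 -> normc (segment_pt p q t) <= (1 - t) * normc p + t * normc q.
Proof.
move=> /andP[t0 t1].
have -> : segment_pt p q t = (1 - t)%:C * p + t%:C * q by rewrite /segment_pt rmorphB rmorph1; ring.
apply: (le_trans (le_normcD _ _)); rewrite !normcM !normc_real !ger0_norm//; lra.
Qed.

Lemma segment_pt_disk p q t : 0 <= t <= 1 -> D p -> D q -> D (segment_pt p q t).
Proof.
move=> t01; rewrite /unit_disk /= => p1 q1; apply: (le_lt_trans (normc_segment_pt _ _ t01)).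
move/andP: t01 => [t0 t1]; have [pq|/ltW qp] := leP (normc p) (normc q).
  have : 0 <= (1 - t) * (normc q - normc p) by apply: mulr_ge0; lra.
  lra.
have : 0 <= t * (normc p - normc q) by apply: mulr_ge0; lra.
lra.
Qed.

Lemma continuous_segment_pt (N : R[i] -> R) p q t :
  (forall e, 0 < e -> exists2 d, 0 < d & forall v, normc (v - segment_pt p q t) < d ->
     `|N v - N (segment_pt p q t)| < e) ->
  {for t, continuous (fun t => N (segment_pt p q t))}.
Proof.
move=> H; apply/continuousR_epsP => e /H[d d0 Hd].
have c0 : 0 < normc (q - p) + 1 by have := normc_ge0 (q - p); lra.
exists (d / (normc (q - p) + 1)); first by rewrite divr_gt0.
move=> s; rewrite ltr_pdivlMr// => st; apply: Hd.
have -> : segment_pt p q s - segment_pt p q t = (s - t)%:C * (q - p) by rewrite /segment_pt rmorphB; ring.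
rewrite normcM normc_real; have := normr_ge0 (s - t); nra.
Qed.

(** If [F] moves every point of the circle of radius [r] around [z] by at least [rho],
    the disk of radius [rho] around [F z] is covered by the image of the disk bounded
    by this circle: a segment from [F z] that leaves the image would cross the image
    of the circle; it cannot leave the unit disk first, for [F] maps compact sets to
    compact sets. *)
Lemma image_covers F G k z r r1 rho : smooth_qc F G k -> 0 < r -> r1 < 1 ->
  (forall h, normc h <= r -> normc (z + h) <= r1) ->
  (forall h, normc h = r -> rho <= normc (F (z + h) - F z)) ->
  forall w, normc (w - F z) < rho -> D w /\ normc (G w - z) < r.
Proof.
move=> qc r0 r11 zr Fr.
have zr1 : normc z <= r1 by rewrite -[z]addr0; apply: zr; rewrite normc0 ltW.
have r10 : 0 <= r1 by apply: le_trans (normc_ge0 _) zr1.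
have Dz : D z by apply: le_lt_trans zr1 r11.
have inD w : D w -> normc (w - F z) < rho -> normc (G w - z) < r.
  move=> Dw wrho; rewrite ltNge; apply/negP => Gw.
  have [||||t t01 Et] := @IVT_at _ (fun t => normc (G (segment_pt (F z) w t) - z)) 0 1 r.
  - exact: ler01.
  - move=> t t01; apply: (continuous_segment_pt (N := fun v => normc (G v - z))) => e e0.
    have Dt : D (segment_pt (F z) w t) by apply: segment_pt_disk => //; exact: (qc_ran qc).
    have e2 : 0 < e / 2 by lra.
    have [d d0 Hd] := qc_inv_cont qc Dt e2; exists d => // v vd.
    have := Hd _ vd; rewrite (addrC (segment_pt _ _ _)) subrK => hv.
    rewrite ltr_norml; have := normc_triangle (G v) (G (segment_pt (F z) w t)) z.
    have := normc_triangle (G (segment_pt (F z) w t)) (G v) z.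
    by rewrite (distcC (G (segment_pt _ _ _)) (G v)) => *; apply/andP; split; lra.
  - by rewrite segment_pt0 (qc_can qc)// subrr normc0 ltW.
  - by rewrite segment_pt1.
  have Dt : D (segment_pt (F z) w t) by apply: segment_pt_disk => //; exact: (qc_ran qc).
  have := Fr _ Et; rewrite (addrC z) subrK (qc_inv_can qc)// segment_ptB normcM normc_real.
  move/andP: t01 => [t0 t1]; rewrite ger0_norm//.
  by have := normc_ge0 (w - F z); nra.
have [r2 /andP[r20 r21] Fr2] := qc_max (qc_cont qc) (qc_ran qc) r10 r11.
move=> w wrho; suff Dw : D w by split => //; exact: inD.
rewrite /unit_disk /= ltNge; apply/negP => w1.
have [||||t t01 Et] := @IVT_at _ (fun t => normc (segment_pt (F z) w t)) 0 1 ((r2 + 1) / 2).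
- exact: ler01.
- move=> t t01; apply: (continuous_segment_pt (N := fun v => normc v)) => e e0; exists e => // v vd.
  apply: le_lt_trans vd; rewrite ler_norml.
  have := le_normcB v (segment_pt (F z) w t); have := le_normcB (segment_pt (F z) w t) v.
  by rewrite (distcC (segment_pt _ _ _)) => *; apply/andP; split; lra.
- by rewrite segment_pt0; have := Fr2 _ zr1; lra.
- by rewrite segment_pt1; lra.
have Dt : D (segment_pt (F z) w t) by rewrite /unit_disk /= Et; lra.
have trho : normc (segment_pt (F z) w t - F z) < rho.
  rewrite segment_ptB normcM normc_real; move/andP: t01 => [t0 t1]; rewrite ger0_norm//.
  by have := normc_ge0 (w - F z); nra.
have := inD _ Dt trho; set v := segment_pt _ _ _ in Dt Et * => Gv.
have := Fr2 (G v); rewrite (qc_inv_can qc)// Et.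
have : normc (G v) <= r1.
  by have := zr (G v - z) (ltW Gv); rewrite (addrC z) subrK.
by move=> h /(_ h); lra.
Qed.

End SmoothQuasiconformal.

(** * Bounded energy on a grid *)

Section DiscreteEnergy.
Context {R : realType}.
Local Notation C := (R[i]^o).
Local Notation D := (unit_disk R).
Implicit Types (z w v : R[i]) (e d r t k h : R) (F G : C -> C).

(** The images of small disjoint disks contain disjoint squares whose sides are
    comparable to the oscillation of the map, up to an additive error
    proportional to the radius. *)
Lemma discrete_energy F G k (I : finType) (P : pred I) (z : I -> R[i]) h rc tau :
  smooth_qc F G k -> rc + h < 1 -> 0 < h -> 2 * h < tau ->
  (forall w, normc w <= rc -> forall v, normc v < tau ->
    D (w + v) /\
    normc (F (w + v) - F w - (wirtinger F w * v + wirtinger_bar F w * conjc v)) <= normc v) ->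
  (forall i, P i -> normc (z i) <= rc) ->
  (forall i j, P i -> P j -> normc (z i - z j) < h / 2 -> i = j) ->
  #|P|%:R * h ^+ 2 <= 1 ->
  exists2 e : I -> R, forall i, P i -> forall v, normc v <= 2 * h ->
       normc (F (z i + v) - F (z i)) ^+ 2 <= e i &
    \sum_(i | P i) e i <= 2120 / (1 - k) ^+ 2.
Proof.
move=> qc rch h0 htau exp zrc sep card.
have /andP[k0 k1] := qc_lt1 qc.
have c0 : 0 < 1 - k by lra.
pose a i := normc (wirtinger F (z i)).
(* By the first order expansion, [F] moves the circle of radius [h / 4] around [z i] by
   at least the second argument of this maximum. *)
pose rho i := Num.max 0 ((1 - k) * a i * (h / 4) - h / 4).
have rho0 i : 0 <= rho i by rewrite /rho le_max lexx.
have Dz i : P i -> D (z i) by move=> /zrc zi; rewrite /unit_disk /=; lra.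
(* Conversely [(1 - k) * |F (z i + v) - F (z i)| <= 16 * rho i + 6 * h] when [|v| <= 2 * h]. *)
pose e i := 2 * (256 * rho i ^+ 2 + 36 * h ^+ 2) / (1 - k) ^+ 2.
exists e.
  move=> i Pi v vh.
  have [_ Hv] := exp _ (zrc _ Pi) v (le_lt_trans vh htau).
  have /andP[_ Lv] := qc_linear_bounds v qc (Dz _ Pi).
  have := le_normcB (F (z i + v) - F (z i)) (wirtinger F (z i) * v + wirtinger_bar F (z i) * conjc v).
  rewrite -/(a i) in Lv => h1.
  have a0 : 0 <= a i by exact: normc_ge0.
  have v0 := normc_ge0 v.
  have h2 : normc (F (z i + v) - F (z i)) <= 4 * a i * h + 2 * h by nra.
  have h3 : (1 - k) * a i * (h / 4) - h / 4 <= rho i by rewrite /rho le_max lexx orbT.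
  have h4 : (1 - k) * normc (F (z i + v) - F (z i)) <= 16 * rho i + 6 * h.
    apply: (@le_trans _ _ ((1 - k) * (4 * a i * h + 2 * h))); first by rewrite ler_pM2l.
    by nra.
  rewrite /e ler_pdivlMr ?exprn_gt0// mulrC -exprMn.
  have := normc_ge0 (F (z i + v) - F (z i)) => n0.
  have n1 : 0 <= (1 - k) * normc (F (z i + v) - F (z i)) by rewrite mulr_ge0// ltW.
  apply: (@le_trans _ _ ((16 * rho i + 6 * h) ^+ 2)).
    by rewrite ler_pXn2r// nnegrE// (le_trans n1).
  have := sqr_ge0 (16 * rho i - 6 * h); lra.
have cover i w : P i -> normc (w - F (z i)) < rho i -> D w /\ normc (G w - z i) < h / 4.
  move=> Pi wrho; have h40 : 0 < h / 4 by lra.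
  apply: (image_covers qc h40 rch _ _ wrho).
    by move=> v vh; apply: (le_trans (le_normcD _ _)); have := zrc _ Pi; lra.
  move=> v vh.
  have [|_ Hv] := exp _ (zrc _ Pi) v; first by rewrite vh; lra.
  have /andP[Lv _] := qc_linear_bounds v qc (Dz _ Pi).
  have := le_normcB (wirtinger F (z i) * v + wirtinger_bar F (z i) * conjc v) (F (z i + v) - F (z i)).
  rewrite distcC => h1; rewrite vh in Hv Lv.
  have p0 : 0 < rho i by apply: le_lt_trans wrho; exact: normc_ge0.
  by rewrite /rho ge_max normc_ge0 /= /a; lra.
(* The square of half-side [rho i / 2] is contained in the disk of radius [rho i]. *)
have pack := @square_packing R I P (fun i => (complex.Re (F (z i)), complex.Im (F (z i)))) (fun i => rho i / 2).
have sqr i q : square (complex.Re (F (z i)), complex.Im (F (z i))) (rho i / 2) q ->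
    normc ((q.1 +i* q.2) - F (z i)) < rho i.
  rewrite /square /= !in_itv /= => -[/andP[x1 x2] /andP[y1 y2]].
  apply: (le_lt_trans (normc_ReIm _)); rewrite !raddfB /=.
  have : `|q.1 - complex.Re (F (z i))| < rho i / 2 by rewrite ltr_norml; apply/andP; split; lra.
  have : `|q.2 - complex.Im (F (z i))| < rho i / 2 by rewrite ltr_norml; apply/andP; split; lra.
  by lra.
have {}pack : \sum_(i | P i) rho i ^+ 2 <= 4.
  under eq_bigr do rewrite -[rho _](@divfK _ 2)// mulrC.
  apply: pack.
  - by move=> i _; rewrite divr_ge0.
  - move=> i j Pi Pj [q [/sqr qi /sqr qj]].
    have [_ Gi] := cover _ _ Pi qi; have [_ Gj] := cover _ _ Pj qj.
    apply: (sep _ _ Pi Pj); have := normc_triangle (G (q.1 +i* q.2)) (z i) (z j).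
    by rewrite (distcC (z i) (G _)); lra.
  - move=> i Pi q /sqr qi; have [Dq _] := cover _ _ Pi qi.
    have := le_lt_trans (normc_Re _) Dq; have := le_lt_trans (normc_Im _) Dq.
    rewrite /square /= !in_itv /= !ltr_norml => /andP[y1 y2] /andP[x1 x2].
    by split; apply/andP; split; lra.
rewrite /e -mulr_suml ler_pM2r ?invr_gt0 ?exprn_gt0// -mulr_sumr big_split /= -mulr_sumr.
rewrite sumr_const -(mulr_natl (36 * h ^+ 2)).
have -> : #|P|%:R * (36 * h ^+ 2) = 36 * (#|P|%:R * h ^+ 2) by ring.
lra.
Qed.

End DiscreteEnergy.

(** * Concentric shells in the half-plane grid *)

Section Shells.
Local Open Scope int_scope.

(** The vertex number [m] of the shell number [k], the part above height [n] of the
    square where [max(|x|, y) = k]: the path goes up the right side, along the top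
    and down the left side; it turns at [n + m = k] and at [n + m = 3 k]. *)
Definition shell_x (n k m : nat) : int :=
  if (n + m <= k)%N then k%:Z else
  if (n + m <= 3 * k)%N then (2 * k%:Z - (n + m)%:Z)%R else (- k%:Z)%R.

Definition shell_y (n k m : nat) : int :=
  if (n + m <= k)%N then (n + m)%:Z else
  if (n + m <= 3 * k)%N then k%:Z else (4 * k%:Z - (n + m)%:Z)%R.

Lemma shell_vertex_inj (n k k' m m' : nat) : (n <= k)%N -> (n <= k')%N ->
  (m <= 4 * k - 2 * n)%N -> (m' <= 4 * k' - 2 * n)%N ->
  shell_x n k m = shell_x n k' m' -> shell_y n k m = shell_y n k' m' -> k = k' /\ m = m'.
Proof.
rewrite /shell_x /shell_y; repeat (case: ifP => ?); lia.
Qed.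

Lemma shell_vertex_step (n k m : nat) : (n <= k)%N -> (m < 4 * k - 2 * n)%N ->
  (`|shell_x n k m.+1 - shell_x n k m| + `|shell_y n k m.+1 - shell_y n k m| <= 1)%R.
Proof.
rewrite /shell_x /shell_y; repeat (case: ifP => ?); lia.
Qed.

Lemma shell_vertex_bounds (n k m : nat) : (n <= k)%N -> (m <= 4 * k - 2 * n)%N ->
  [/\ (- k%:Z <= shell_x n k m)%R, (shell_x n k m <= k%:Z)%R, (n%:Z <= shell_y n k m)%R & (shell_y n k m <= k%:Z)%R].
Proof.
rewrite /shell_x /shell_y; repeat (case: ifP => ?); move=> *; split; lia.
Qed.

End Shells.

(** * The Cayley transform *)

Section HalfPlaneChart.
Context {R : realType}.
Local Notation C := (R[i]^o).
Local Notation D := (unit_disk R).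
Local Notation i := (0 +i* 1 : R[i]).
Implicit Types (z w v W zeta : R[i]) (e d r t k h x y : R).

(** The Cayley transform, mapping the upper half-plane to the disk and [0] to [zeta]. *)
Definition chart zeta W : R[i] := zeta * (i - W) / (i + W).

Lemma normc_iD W : normc (i + W) ^+ 2 = complex.Re W ^+ 2 + (1 + complex.Im W) ^+ 2.
Proof. by rewrite normc_sqr; case: W => x y /=; rewrite add0r. Qed.

Lemma chart_den_ge1 W : 0 <= complex.Im W -> 1 <= normc (i + W).
Proof.
move=> y0; rewrite -(@ler_pXn2r _ 2)// ?nnegrE ?normc_ge0// normc_iD expr1n.
by have := sqr_ge0 (complex.Re W); nra.
Qed.

Lemma chart_den_neq0 W : 0 <= complex.Im W -> i + W != 0.
Proof.
by move=> /chart_den_ge1 h; apply/eqP => E; move: h; rewrite E normc0; lra.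
Qed.

(** On this box the chart changes distances by a factor of at most [2]. *)
Definition box W : Prop := `|complex.Re W| <= 1 / 2 /\ 0 <= complex.Im W <= 1 / 2.

Lemma chart_den_le2 W : box W -> normc (i + W) <= 2.
Proof.
move=> [x1 /andP[y0 y1]]; apply: (le_trans (normc_ReIm _)); case: W x1 y0 y1 => x y /= x1 y0 y1.
by rewrite add0r (@ger0_norm _ (1 + y)); lra.
Qed.

Lemma chartB zeta W W' : normc zeta = 1 -> 0 <= complex.Im W -> 0 <= complex.Im W' ->
  normc (chart zeta W - chart zeta W') * (normc (i + W) * normc (i + W')) = 2 * normc (W - W').
Proof.
move=> z1 y0 y0'; rewrite -!normcM.
have d0 := chart_den_neq0 y0; have d0' := chart_den_neq0 y0'.
have -> : (chart zeta W - chart zeta W') * ((i + W) * (i + W')) = zeta * (2%:R%:C * (i * (W' - W))).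
  by rewrite /chart !rmorph_nat; field; rewrite d0 d0'.
rewrite !normcM z1 mul1r normc_real normc_imag normr1 mul1r distcC ger0_norm//.
Qed.

Lemma chart_lipschitz zeta W W' : normc zeta = 1 -> 0 <= complex.Im W -> 0 <= complex.Im W' ->
  normc (chart zeta W - chart zeta W') <= 2 * normc (W - W').
Proof.
move=> z1 y0 y0'; rewrite -(chartB z1 y0 y0') ler_peMr ?normc_ge0//.
by have := chart_den_ge1 y0; have := chart_den_ge1 y0'; nra.
Qed.

Lemma chart_expand zeta W W' : normc zeta = 1 -> box W -> box W' ->
  normc (W - W') <= 2 * normc (chart zeta W - chart zeta W').
Proof.
move=> z1 bW bW'; have [_ /andP[y0 _]] := bW; have [_ /andP[y0' _]] := bW'.
have := chartB z1 y0 y0'; have h := chart_den_le2 bW; have h' := chart_den_le2 bW'.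
have := ler_pM (normc_ge0 _) (normc_ge0 _) h h'.
by have := normc_ge0 (chart zeta W - chart zeta W'); nra.
Qed.

Lemma chart_sqr zeta W : normc zeta = 1 -> 0 <= complex.Im W ->
  normc (chart zeta W) ^+ 2 * normc (i + W) ^+ 2 = normc (i + W) ^+ 2 - 4 * complex.Im W.
Proof.
move=> z1 y0; rewrite -exprMn -normcM /chart divfK ?chart_den_neq0//.
by rewrite normcM z1 mul1r normc_iD normc_sqr; case: (W) => x y /=; ring.
Qed.

Lemma chart_norm zeta W : normc zeta = 1 -> box W ->
  normc (chart zeta W) <= 1 - complex.Im W / 2.
Proof.
move=> z1 bW; have [_ /andP[y0 y1]] := bW.
have := chart_sqr z1 y0; have := chart_den_ge1 y0; have := chart_den_le2 bW.
set d := normc (i + W) => d2 d1 E.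
have d4 : d ^+ 2 <= 4 by nra.
have d0 : 0 < d ^+ 2 by nra.
rewrite -(@ler_pXn2r _ 2)// ?nnegrE ?normc_ge0//; last lra.
have : normc (chart zeta W) ^+ 2 <= 1 - complex.Im W.
  by rewrite -(ler_pM2r d0) E; nra.
by have := sqr_ge0 (complex.Im W); nra.
Qed.

Definition chart_inv zeta z : R[i] := i * (1 - z / zeta) / (1 + z / zeta).

Lemma chart_inv_den zeta z : normc zeta = 1 -> D z -> 1 + z / zeta != 0.
Proof.
move=> z1 Dz; apply/eqP => E.
have : normc (z / zeta) < 1 by rewrite normcM normcV z1 invr1 mulr1.
have -> : z / zeta = - 1 by apply/eqP; rewrite -addr_eq0 addrC E.
by rewrite normcN normc1 ltxx.
Qed.

Lemma zeta_neq0 zeta : normc zeta = 1 -> zeta != 0.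
Proof. by move=> z1; apply/eqP => E; move: z1; rewrite E normc0 => /eqP; rewrite eq_sym oner_eq0. Qed.

Lemma i_neq0 : i != 0. Proof. by apply: zeta_neq0; rewrite normc_imag normr1. Qed.

Lemma chart_invK zeta z : normc zeta = 1 -> D z -> chart zeta (chart_inv zeta z) = z.
Proof.
move=> z1 Dz; have d0 := chart_inv_den z1 Dz; have n0 := zeta_neq0 z1; have i0 := i_neq0.
have i2 : i * i = - 1 by apply/eqP; rewrite eq_complex /=; apply/andP; split; apply/eqP; ring.
rewrite /chart /chart_inv; set s := z / zeta in d0 *.
have -> : z = zeta * s by rewrite /s mulrCA mulfV// mulr1.
have e1 : i - i * (1 - s) / (1 + s) = i * (2 * s) / (1 + s) by field.
have e2 : i + i * (1 - s) / (1 + s) = i * 2 / (1 + s) by field.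
by rewrite e1 e2; field; rewrite i0 d0.
Qed.

Lemma chart_inv_Im zeta z : normc zeta = 1 -> D z -> 0 < complex.Im (chart_inv zeta z).
Proof.
move=> z1 Dz; have d0 := chart_inv_den z1 Dz.
have s1 : normc (z / zeta) < 1 by rewrite normcM normcV z1 invr1 mulr1.
rewrite /chart_inv; move: (z / zeta) s1 d0 => s s1 d0.
have dp : 0 < normc (1 + s).
  by rewrite lt_neqAle normc_ge0 andbT eq_sym; apply: contra d0 => /eqP/eq0_normc ->.
have -> : i * (1 - s) / (1 + s) = (normc (1 + s) ^- 2)%:C * (i * (1 - s) * conjc (1 + s)).
  apply: (canLR (mulfK d0)).
  have -> : (normc (1 + s) ^- 2)%:C * (i * (1 - s) * conjc (1 + s)) * (1 + s) =
     i * (1 - s) * ((normc (1 + s) ^- 2)%:C * ((1 + s) * conjc (1 + s))) by ring.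
  have -> : (1 + s) * conjc (1 + s) = (normc (1 + s) ^+ 2)%:C.
    by rewrite normc_sqr; case: (1 + s) => x y; apply/eqP; rewrite eq_complex /=; apply/andP; split; apply/eqP; ring.
  by rewrite -rmorphM mulVf ?mulr1// expf_neq0// gt_eqF.
move: s1; rewrite normc_lt// expr1n; move: dp; move: (normc (1 + s)) => N N0.
case: s {d0} => x y /= s1.
set X := (X in 0 < X); have -> : X = N ^- 2 * (1 - (x ^+ 2 + y ^+ 2)) by rewrite /X; ring.
by rewrite mulr_gt0 ?subr_gt0// invr_gt0 exprn_gt0.
Qed.

Lemma chart_inv_small zeta z : normc zeta = 1 -> normc (z - zeta) <= 1 ->
  normc (chart_inv zeta z) <= normc (z - zeta).
Proof.
move=> z1 zz; have n0 := zeta_neq0 z1.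
have E : normc (1 - z / zeta) = normc (z - zeta).
  have -> : 1 - z / zeta = (zeta - z) / zeta by field.
  by rewrite normcM normcV z1 invr1 mulr1 distcC.
have h : 1 <= normc (1 + z / zeta).
  have := le_normcB 2 (1 + z / zeta).
  have -> : 2 - (1 + z / zeta) = 1 - z / zeta by ring.
  rewrite E (_ : normc 2 = 2); first lra.
  by rewrite -[2]/(2%:R) -(rmorph_nat (@real_complex R)) normc_real ger0_norm.
rewrite /chart_inv normcM normcV normcM normc_imag normr1 mul1r E.
by rewrite ler_pdivrMr ?ler_peMr ?normc_ge0//; lra.
Qed.

End HalfPlaneChart.

(** * The length-area argument *)

Section ShortShell.
Context {R : realType}.
Local Notation C := (R[i]^o).
Local Notation D := (unit_disk R).
Implicit Types (k m n : nat).

Lemma cauchy_schwarz_sum (I : finType) (P : pred I) (x : I -> R) :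
  (\sum_(i | P i) x i) ^+ 2 <= #|P|%:R * \sum_(i | P i) x i ^+ 2.
Proof.
rewrite expr2 big_distrlr /=.
apply: (@le_trans _ _ (\sum_(i | P i) \sum_(j | P j) (x i ^+ 2 / 2 + x j ^+ 2 / 2))).
  apply: ler_sum => i _; apply: ler_sum => j _.
  by have := sqr_ge0 (x i - x j); lra.
rewrite (eq_bigr (fun i => #|P|%:R * (x i ^+ 2 / 2) + \sum_(j | P j) (x j ^+ 2 / 2))); last first.
  by move=> i _; rewrite big_split /= sumr_const mulr_natl.
rewrite big_split /= sumr_const -mulr_sumr -!mulr_suml -(mulr_natl (_ / 2)).
by rewrite -mulrDr ler_wpM2l//; lra.
Qed.

Lemma sum_inv_block (a : nat) : (0 < a)%N ->
  1 / 2 <= \sum_(a <= k < 2 * a) (k%:R : R)^-1.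
Proof.
move=> a0; have a0' : 0 < a%:R :> R by rewrite ltr0n.
apply: (@le_trans _ _ (\sum_(a <= k < 2 * a) (2 * a%:R)^-1)).
  rewrite sumr_const_nat (_ : (2 * a - a = a)%N); last by lia.
  rewrite -[leRHS]mulr_natl (_ : _ * _ = 1 / 2)//; field; exact: lt0r_neq0.
rewrite !big_nat; apply: ler_sum => k /andP[k1 k2].
rewrite lef_pV2 ?posrE ?mulr_gt0// ?ltr0n; last by apply: leq_trans k1.
by rewrite -natrM ler_nat ltnW.
Qed.

Lemma sum_inv_dyadic (a M : nat) : (0 < a)%N ->
  M%:R / 2 <= \sum_(a <= k < 2 ^ M * a) (k%:R : R)^-1.
Proof.
move=> a0; elim: M => [|M IH]; first by rewrite mul0r expn0 mul1n big_geq.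
have p0 : (0 < 2 ^ M)%N by rewrite expn_gt0.
rewrite (@big_cat_nat _ _ _ (2 ^ M * a)%N) /=; [|by nia|by rewrite expnS; nia].
rewrite -natr1 mulrDl; apply: lerD => //.
by rewrite expnS -mulnA; apply: sum_inv_block; nia.
Qed.

(** Length-area: the shells are disjoint, and the shell number [k] has at most
    [4 k] edges, so that the divergence of the harmonic series makes one of the
    shells numbered from [N] to [2 ^ M * N] short when the total energy is bounded. *)
Lemma pigeonhole_length (n N M : nat) (d : nat -> nat -> R) (E l : R) :
  (0 < n)%N -> (n <= N)%N -> 0 < l -> 8 * E < l ^+ 2 * M%:R ->
  (forall k m, 0 <= d k m) ->
  \sum_(i : 'I_(2 ^ M * N) * 'I_(4 * (2 ^ M * N)) | (N <= i.1)%N && (i.2 < 4 * i.1 - 2 * n)%N)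
    d i.1 i.2 ^+ 2 <= E ->
  exists k, [/\ (N <= k)%N, (k < 2 ^ M * N)%N &
    forall m, (m <= 4 * k - 2 * n)%N -> \sum_(0 <= j < m) d k j <= l].
Proof.
move=> n0 nN l0 El d0 sumE; apply: contrapT => H.
set T := (2 ^ M * N)%N in sumE H.
have long k : (N <= k)%N -> (k < T)%N -> l < \sum_(m < 4 * T | (m < 4 * k - 2 * n)%N) d k m.
  move=> Nk kT; rewrite ltNge; apply/negP => sl; apply: H; exists k; split => // m mk.
  apply: le_trans sl; rewrite -(big_ord_widen _ (d k)); last by lia.
  rewrite -(big_mkord xpredT (d k)) (@big_cat_nat _ _ _ m 0 (4 * k - 2 * n)%N)//=.
  by rewrite lerDl sumr_ge0.
have Nk0 : (0 < N)%N by lia.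
have shell k : (N <= k)%N -> (k < T)%N ->
    l ^+ 2 / 4 * k%:R^-1 <= \sum_(m < 4 * T | (m < 4 * k - 2 * n)%N) d k m ^+ 2.
  move=> Nk kT; move: (long _ Nk kT).
  set S := \sum_(m < _ | _) _; set S2 := \sum_(m < _ | _) _ => lS.
  have CS : S ^+ 2 <= #|[pred m : 'I_(4 * T) | (m < 4 * k - 2 * n)%N]|%:R * S2.
    exact: cauchy_schwarz_sum.
  have k0 : 0 < k%:R :> R by rewrite ltr0n; lia.
  have S20 : 0 <= S2 by apply: sumr_ge0 => i _; exact: sqr_ge0.
  have card : #|[pred m : 'I_(4 * T) | (m < 4 * k - 2 * n)%N]|%:R <= 4 * k%:R :> R.
    rewrite -natrM ler_nat.
    have -> : #|[pred m : 'I_(4 * T) | (m < 4 * k - 2 * n)%N]| = (4 * k - 2 * n)%N.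
      rewrite -sum1_card (eq_bigl (fun m : 'I_(4 * T) => (m < 4 * k - 2 * n)%N))//.
      by rewrite -(big_ord_widen _ (fun _ => 1%N)) ?sum_nat_const ?card_ord ?muln1//; lia.
    by lia.
  have l2 : l ^+ 2 <= 4 * k%:R * S2.
    have := ler_wpM2r S20 card; have : l ^+ 2 <= S ^+ 2 by rewrite ler_pXn2r// ?nnegrE; lra.
    by lra.
  by rewrite ler_pdivrMr//; lra.
have : l ^+ 2 / 4 * (M%:R / 2) <= E.
  apply: le_trans sumE.
  apply: (@le_trans _ _ (\sum_(N <= k < T) l ^+ 2 / 4 * k%:R^-1)).
    by rewrite -mulr_sumr ler_wpM2l ?sum_inv_dyadic// divr_ge0 ?sqr_ge0.
  rewrite -(pair_big_dep (fun k : 'I_T => (N <= k)%N) (fun (k : 'I_T) (m : 'I_(4 * T)) => (m < 4 * k - 2 * n)%N)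
    (fun (k : 'I_T) (m : 'I_(4 * T)) => d k m ^+ 2)) /=.
  rewrite (@big_nat_widenl _ _ _ N 0)//.
  rewrite big_mkord; apply: ler_sum => k Nk; apply: shell.
  - by move: Nk => /andP[].
  - exact: ltn_ord.
by lra.
Qed.

End ShortShell.

(** * A shell with a small image *)

Section ShortShellImage.
Context {R : realType}.
Local Notation C := (R[i]^o).
Local Notation D := (unit_disk R).
Implicit Types (z w v W zeta : R[i]) (F G : C -> C) (n k m : nat).

Lemma shell_right (n k : nat) (q : int) : (n%:Z <= q)%R -> (q <= k%:Z)%R ->
  exists m : nat, [/\ (m <= 4 * k - 2 * n)%N, shell_x n k m = k%:Z & shell_y n k m = q].
Proof.
move=> nq qk; exists (absz q - n)%N; rewrite /shell_x /shell_y; split; first by lia.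
  by repeat (case: ifP => ?); lia.
by repeat (case: ifP => ?); lia.
Qed.

Lemma shell_top (n k : nat) (q : int) : (n <= k)%N -> (- k%:Z <= q)%R -> (q <= k%:Z)%R ->
  exists m : nat, [/\ (m <= 4 * k - 2 * n)%N, shell_x n k m = q & shell_y n k m = k%:Z].
Proof.
move=> nk nq qk; exists (absz (2 * k%:Z - n%:Z - q)%R)%N; rewrite /shell_x /shell_y; split; first by lia.
  by repeat (case: ifP => ?); lia.
by repeat (case: ifP => ?); lia.
Qed.

Lemma shell_left (n k : nat) (q : int) : (n%:Z <= q)%R -> (q <= k%:Z)%R ->
  exists m : nat, [/\ (m <= 4 * k - 2 * n)%N, shell_x n k m = (- k%:Z)%R & shell_y n k m = q].
Proof.
move=> nq qk; exists (absz (4 * k%:Z - n%:Z - q)%R)%N; rewrite /shell_x /shell_y; split; first by lia.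
  by repeat (case: ifP => ?); lia.
by repeat (case: ifP => ?); lia.
Qed.

Definition shell_vertex (h : R) n k m : R[i] := (h * (shell_x n k m)%:~R) +i* (h * (shell_y n k m)%:~R).

Lemma int_dist_lt1 (p q : int) : `|p - q| < 1 -> p = q.
Proof. lia. Qed.

Lemma box_bounds (X Y K e : R) : K <= 1 / 2 -> 0 < e -> - K <= X -> X <= K ->
  e <= Y -> Y <= K -> (`|X| <= 1 / 2 /\ 0 <= Y <= 1 / 2) /\ e <= Y.
Proof.
by move=> *; rewrite ler_norml; split; [split; apply/andP; split; lra|].
Qed.

Lemma floor_near (a b : int) (x : R) : a%:~R <= x -> x <= b%:~R ->
  exists q : int, [/\ (a <= q)%R, (q <= b)%R & `|x - q%:~R| <= 1].
Proof.
move=> ax xb; exists (Num.floor x); split.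
- by rewrite floor_ge_int.
- by rewrite -(@ler_int R); apply: le_trans xb; exact: floor_le_tmp.
- have := floor_le_tmp x; have := floorD1_gt x; rewrite intrD1 => *.
  by rewrite ger0_norm; lra.
Qed.

Definition on_shell (r : R) W : Prop :=
  [/\ `|complex.Re W| <= r, complex.Im W <= r & `|complex.Re W| = r \/ complex.Im W = r].

(** Rounding down the coordinate that varies along the side of the shell. *)
Lemma near_shell_vertex (h : R) n k W : 0 < h -> (n <= k)%N -> h * n%:R <= complex.Im W ->
  on_shell (h * k%:R) W ->
  exists2 m, (m <= 4 * k - 2 * n)%N & normc (W - shell_vertex h n k m) <= h.
Proof.
move=> h0 nk; case: W => X Y /= nY [Xk Yk bd].
pose x := X / h; pose y := Y / h.
have Xx : X = h * x by rewrite /x mulrC divfK// gt_eqF.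
have Yy : Y = h * y by rewrite /y mulrC divfK// gt_eqF.
move: nY Xk Yk bd; rewrite Xx Yy normrM (gtr0_norm h0) !ler_pM2l// => ny xk yk bd.
have {}bd : `|x| = k%:R \/ y = k%:R.
  by case: bd => /(mulfI (lt0r_neq0 h0)); [left|right].
have near (p q : int) m : shell_x n k m = p -> shell_y n k m = q ->
    `|x - p%:~R| + `|y - q%:~R| <= 1 -> normc ((h * x +i* (h * y)) - shell_vertex h n k m) <= h.
  move=> Ep Eq H; apply: (le_trans (normc_ReIm _)).
  rewrite /shell_vertex Ep Eq /= -!mulrBr !normrM (gtr0_norm h0) -mulrDr.
  by rewrite -[leRHS]mulr1 ler_pM2l.
move: xk; rewrite ler_norml => /andP[xk1 xk2].
have top : y = k%:R -> exists2 m, (m <= 4 * k - 2 * n)%N & normc ((h * x +i* (h * y)) - shell_vertex h n k m) <= h.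
  move=> yE; have [||q [q1 q2 q3]] := @floor_near (- k%:Z) k%:Z x.
  - by rewrite intrN.
  - by [].
  have [m [mk mx my]] := shell_top nk q1 q2; exists m => //.
  by apply: (near _ _ _ mx my); rewrite yE subrr normr0 addr0.
have [xE|yE] := bd; last exact: top.
have [||q [q1 q2 q3]] := @floor_near n%:Z k%:Z y => //.
have [x0|x0] := leP 0 x.
  move: xE; rewrite ger0_norm// => xE.
  have [m [mk mx my]] := shell_right q1 q2; exists m => //.
  by apply: (near _ _ _ mx my); rewrite xE subrr normr0 add0r.
move: xE; rewrite ltr0_norm// => xE.
have [m [mk mx my]] := shell_left q1 q2; exists m => //.
have xE' : x = (- k%:Z)%:~R by rewrite intrN -[LHS]opprK xE.
by apply: (near _ _ _ mx my); rewrite {1}xE' subrr normr0 add0r.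
Qed.

Lemma telescope_norm (s : nat -> R[i]) m :
  normc (s m - s 0%N) <= \sum_(0 <= j < m) normc (s j.+1 - s j).
Proof.
elim: m => [|m IH]; first by rewrite subrr normc0 big_geq.
rewrite big_nat_recr//=; apply: (le_trans (normc_triangle (s m) _ _)).
by rewrite addrC; apply: lerD.
Qed.

Lemma qc_inner_unif_continuous F G (c r l : R) : smooth_qc F G c -> r < 1 -> 0 < l ->
  exists2 d, 0 < d & forall z, normc z <= r -> forall w, normc (w - z) < d ->
    normc (F w - F z) <= l.
Proof.
move=> qc r1 l0; have l2 : 0 < l / 2 by lra.
have Fc z : normc z <= r -> normc_continuous F z by move=> zr; apply: (qc_cont qc); exact: le_lt_trans zr r1.
have cRe z : normc z <= r -> {for (z : C), continuous (fun z : C => complex.Re (F z))}.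
  move=> /Fc h; have -> : (fun z : C => complex.Re (F z)) = (fun z : C => complex.Re (1 * F z)).
    by apply/funext => w; rewrite mul1r.
  exact: continuous_Re.
have cIm z : normc z <= r -> {for (z : C), continuous (fun z : C => complex.Im (F z))}.
  move=> /Fc h; have -> : (fun z : C => complex.Im (F z)) = (fun z : C => complex.Re (- (0 +i* 1) * F z)).
    by apply/funext => w; rewrite -Im_Re.
  exact: continuous_Re.
have [d1 d10 H1] := compact_unif_continuous (@compact_cdisk R r) cRe l2.
have [d2 d20 H2] := compact_unif_continuous (@compact_cdisk R r) cIm l2.
exists (Num.min d1 d2); first by rewrite lt_min d10.
move=> z zr w; rewrite lt_min => /andP[w1 w2].
apply: (le_trans (normc_ReIm _)); rewrite !raddfB/=.
by have := H1 _ zr _ w1; have := H2 _ zr _ w2; lra.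
Qed.

(** The discrete energy of [F] at the vertices of a fine grid is bounded independently
    of the grid, so the length-area argument yields a shell along which the total
    variation of [F] at the vertices is at most [l]; the points between two vertices
    are dealt with by uniform continuity, the shell being cut at a positive height. *)
Lemma short_shell F G (c : R) zeta (M j : nat) (l : R) : smooth_qc F G c ->
  normc zeta = 1 -> (M <= j)%N -> 0 < l -> 8 * (2120 / (1 - c) ^+ 2) < l ^+ 2 * M%:R ->
  exists r W0, [/\ (2 ^+ M.+1)^-1 <= r <= 1 / 2, box W0 /\ complex.Im W0 = (2 ^+ j.+1)^-1 &
    forall W, (2 ^+ j.+1)^-1 <= complex.Im W -> on_shell r W ->
      normc (F (chart zeta W) - F (chart zeta W0)) <= 2 * l].
Proof.
move=> qc z1 Mj l0 El.
set eta : R := (2 ^+ j.+1)^-1.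
have eta0 : 0 < eta by rewrite invr_gt0 exprn_gt0.
have eta2 : eta <= 1 / 2.
  rewrite /eta exprS invfM div1r ler_piMr// invf_le1 ?exprn_gt0//.
  by rewrite -natrX ler1n expn_gt0.
pose rc := 1 - eta / 2.
have rc1 : rc < 1 by rewrite /rc; lra.
have [tau1 tau10 exp] := first_order qc rc1.
have [tau2 tau20 unif] := qc_inner_unif_continuous qc rc1 l0.
pose tau := Num.min tau1 tau2.
have tau0 : 0 < tau by rewrite lt_min tau10.
have [n n3 ntau] : exists2 n, (2 < n)%N & 2 * eta / tau < n%:R.
  exists (Num.truncn (2 * eta / tau)).+3 => //.
  by apply: (lt_trans (truncnS_gt (2 * eta / tau))); rewrite ltr_nat; exact: leqnSn.
have n0 : (0 < n)%N by apply: leq_trans n3.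
have nR : 0 < n%:R :> R by rewrite ltr0n.
pose h := eta / n%:R.
have h0 : 0 < h by rewrite divr_gt0.
have hn : h * n%:R = eta by rewrite /h divfK// gt_eqF.
have htau : 2 * h < tau.
  rewrite /h mulrA ltr_pdivrMr// -ltr_pdivrMl// (mulrC tau^-1).
  exact: ntau.
have [htau1 htau2] : 2 * h < tau1 /\ 2 * h < tau2.
  by move: htau; rewrite lt_min => /andP[].
have h2 : h < eta / 2.
  by rewrite /h ltr_pM2l// ltf_pV2 ?posrE// ltr_nat.
(* [N] and [T] count the steps of length [h] in the innermost and the outermost radii. *)
have [N NE] : exists N, N = (n * 2 ^ (j - M))%N by eexists.
have [T T2] : exists T, T = (2 ^ M * N)%N by eexists.
have TE : T = (n * 2 ^ j)%N.
  by rewrite T2 NE mulnCA -expnD subnKC.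
have nN : (n <= N)%N by rewrite NE leq_pmulr// expn_gt0.
have hT : h * T%:R = 1 / 2.
  rewrite TE natrM mulrA hn natrX /eta exprS; field.
  by rewrite expf_neq0// pnatr_eq0.
have hN : h * N%:R = (2 ^+ M.+1)^-1.
  have : h * T%:R = 1 / 2 by [].
  rewrite T2 natrM natrX exprS invfM => E.
  have p0 : 2 ^+ M != 0 :> R by rewrite expf_neq0// pnatr_eq0.
  by apply: (mulIf p0); rewrite divfK// -mulrA (mulrC N%:R) E div1r.
have vbox k m : (N <= k)%N -> (k < T)%N -> (m <= 4 * k - 2 * n)%N ->
    box (shell_vertex h n k m) /\ eta <= complex.Im (shell_vertex h n k m).
  move=> Nk kT mk; have nk : (n <= k)%N := leq_trans nN Nk.
  have [x1 x2 y1 y2] := shell_vertex_bounds nk mk.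
  have kh : h * k%:R <= 1 / 2 by rewrite -hT ler_pM2l// ler_nat ltnW.
  rewrite -!(@ler_int R) intrN in x1 x2 y1 y2.
  apply: (box_bounds kh eta0); rewrite -?mulrN -?hn; by rewrite ler_pM2l.
pose z k m := chart zeta (shell_vertex h n k m).
have zrc k m : (N <= k)%N -> (k < T)%N -> (m <= 4 * k - 2 * n)%N -> normc (z k m) <= rc.
  move=> Nk kT mk; have [b y] := vbox _ _ Nk kT mk.
  by apply: (le_trans (chart_norm z1 b)); rewrite /rc; lra.
pose P (i : 'I_T * 'I_(4 * T)) := (N <= i.1)%N && (i.2 < 4 * i.1 - 2 * n)%N.
have rch : rc + h < 1 by rewrite /rc; lra.
have [|||e He sume] := @discrete_energy _ F G c ('I_T * 'I_(4 * T))%type P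
    (fun i => z i.1 i.2) h rc tau1 qc rch h0 htau1 exp.
- by move=> i /andP[i1 i2]; apply: zrc => //; exact: ltnW.
- move=> [k m] [k' m'] /andP[/= Nk mk] /andP[/= Nk' mk'] zz.
  have [b _] := vbox _ _ Nk (ltn_ord k) (ltnW mk).
  have [b' _] := vbox _ _ Nk' (ltn_ord k') (ltnW mk').
  have := chart_expand z1 b b' => VV.
  have {VV} VV : normc (shell_vertex h n k m - shell_vertex h n k' m') < h by apply: (le_lt_trans VV); lra.
  have coord (p q : int) : `|h * p%:~R - h * q%:~R| < h -> p = q.
    rewrite -mulrBr normrM gtr0_norm// -[ltRHS]mulr1 ltr_pM2l// -intrB -intr_norm ltrz1.
    exact: int_dist_lt1.
  have Ex := coord _ _ (le_lt_trans (normc_Re _) VV).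
  have Ey := coord _ _ (le_lt_trans (normc_Im _) VV).
  have [] := @shell_vertex_inj n k k' m m' (leq_trans nN Nk) (leq_trans nN Nk') (ltnW mk) (ltnW mk') Ex Ey.
  by move=> E1 E2; congr (_, _); exact: val_inj.
- have : (#|P| <= T * (4 * T))%N.
    by apply: (leq_trans (max_card _)); rewrite card_prod !card_ord.
  rewrite -(ler_nat R) !natrM => cP.
  have := ler_wpM2r (sqr_ge0 h) cP.
  have -> : T%:R * (4%:R * T%:R) * h ^+ 2 = 4 * (h * T%:R) ^+ 2 by ring.
  rewrite hT => cP'; apply: (le_trans cP'); lra.
pose d k m := normc (F (z k m.+1) - F (z k m)).
have d0 k m : 0 <= d k m by exact: normc_ge0.
have sumd : \sum_(i : 'I_(2 ^ M * N) * 'I_(4 * (2 ^ M * N)) | (N <= i.1)%N && (i.2 < 4 * i.1 - 2 * n)%N)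
    d i.1 i.2 ^+ 2 <= 2120 / (1 - c) ^+ 2.
  rewrite -T2; apply: le_trans sume; apply: ler_sum => -[k m] Pi.
  have := He _ Pi (z k m.+1 - z k m); rewrite /= (addrC (z k m)) subrK; apply.
  move: Pi => /andP[/= Nk mk].
  have [b _] := vbox _ _ Nk (ltn_ord k) mk; have [b' _] := vbox _ _ Nk (ltn_ord k) (ltnW mk).
  have [_ /andP[y0 _]] := b; have [_ /andP[y0' _]] := b'.
  apply: (le_trans (chart_lipschitz z1 y0 y0')); rewrite ler_pM2l//.
  apply: (le_trans (normc_ReIm _)); rewrite /shell_vertex !raddfB /=.
  have nk : (n <= k)%N := leq_trans nN Nk.
  have := shell_vertex_step nk mk; rewrite -(@ler_int R) rmorphD /= !intr_norm !rmorphB /= => st.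
  have hh x : `|h * x| = h * `|x| by rewrite normrM gtr0_norm.
  by rewrite -!mulrBr !hh -mulrDr -[leRHS]mulr1 ler_pM2l.
have [k [Nk + short]] := pigeonhole_length n0 nN l0 El d0 sumd.
rewrite -T2 => kT.
have nk : (n <= k)%N := leq_trans nN Nk.
have [b0 _] := vbox _ _ Nk kT (leq0n _).
exists (h * k%:R), (shell_vertex h n k 0); split.
- rewrite -hN ler_pM2l// ler_nat Nk /=.
  by rewrite -hT ler_pM2l// ler_nat ltnW.
- split => //; rewrite /shell_vertex /= /shell_y addn0 nk.
  exact: hn.
- move=> W; rewrite -hn => nW sW; have [m mk near] := near_shell_vertex h0 nk nW sW.
  have [bm ym] := vbox _ _ Nk kT mk.
  have W0 : 0 <= complex.Im W by apply: le_trans nW; rewrite hn ltW.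
  have [_ /andP[y0 _]] := bm.
  have step : normc (F (chart zeta W) - F (z k m)) <= l.
    apply: unif; first exact: zrc.
    by apply: (le_lt_trans (chart_lipschitz z1 W0 y0)); lra.
  have := telescope_norm (fun m => F (z k m)) m; have := short _ mk; rewrite /d => s1 s2.
  have := normc_triangle (F (z k m)) (F (chart zeta W)) (F (z k 0%N)).
  by rewrite -/(z k 0%N); lra.
Qed.

End ShortShellImage.

(** * Uniform continuity up to the boundary *)

Section UniformContinuity.
Context {R : realType}.
Local Notation C := (R[i]^o).
Local Notation D := (unit_disk R).
Implicit Types (z w v W zeta p q b : R[i]) (F G : C -> C).

Definition dotp w b : R := complex.Re w * complex.Re b + complex.Im w * complex.Im b.

Lemma dotp_le w b : dotp w b <= normc w * normc b.
Proof.
rewrite -normcM; have -> : dotp w b = complex.Re (w * conjc b).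
  by rewrite /dotp; case: (w) (b) => x y [u v] /=; ring.
have -> : normc (w * b) = normc (w * conjc b) by rewrite !normcM normc_conj.
by apply: le_trans (normc_Re _); exact: ler_norm.
Qed.

Lemma dotpp b : dotp b b = normc b ^+ 2.
Proof. by rewrite normc_sqr /dotp; ring. Qed.

Lemma dotp_segment_pt w w' b t : dotp (segment_pt w w' t) b = (1 - t) * dotp w b + t * dotp w' b.
Proof. by rewrite /dotp /segment_pt; case: w w' b => [? ?] [? ?] [? ?] /=; ring. Qed.

Lemma dotpBl w w' b : dotp (w - w') b = dotp w b - dotp w' b.
Proof. by rewrite /dotp; case: w w' b => [? ?] [? ?] [? ?] /=; ring. Qed.

(** A point of the disk whose component along the direction of [b] exceeds [1 - 3 * l]
    is at distance at most [sqrt (6 * l)] from the unit vector of this direction. *)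
Lemma cap_diameter w w' b (l e : R) : D w -> D w' -> 0 < normc b -> 0 < e -> 24 * l <= e ^+ 2 ->
  (1 - 3 * l) * normc b < dotp w b -> (1 - 3 * l) * normc b < dotp w' b ->
  normc (w - w') <= e.
Proof.
move=> Dw Dw' b0 e0 le hw hw'.
pose beta : R[i] := (normc b)^-1%:C * b.
have nb : normc beta = 1 by rewrite /beta normcM normc_real gtr0_norm ?invr_gt0// mulVf// gt_eqF.
have db x : dotp x beta = dotp x b / normc b.
  by rewrite /dotp /beta; case: x (b) => [? ?] [? ?] /=; ring.
have near x : D x -> (1 - 3 * l) * normc b < dotp x b -> normc (x - beta) <= e / 2.
  move=> x1 hx; rewrite /unit_disk /= in x1.
  rewrite -(@ler_pXn2r _ 2)// ?nnegrE ?normc_ge0//; last lra.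
  have -> : normc (x - beta) ^+ 2 = normc x ^+ 2 + normc beta ^+ 2 - 2 * dotp x beta.
    rewrite -!dotpp /dotp; case: (x) (beta) => [? ?] [? ?] /=; ring.
  have hd : 1 - 3 * l < dotp x beta by rewrite db ltr_pdivlMr.
  by rewrite nb; have := normc_ge0 x; nra.
have := near _ Dw hw; have := near _ Dw' hw'; have := normc_triangle beta w w'.
by rewrite (distcC beta); lra.
Qed.

Lemma chart_inv_continuous zeta z : normc zeta = 1 -> D z -> normc_continuous (chart_inv zeta) z.
Proof.
move=> z1 Dz e e0; have d0 := chart_inv_den z1 Dz; have n0 := zeta_neq0 z1.
have dp : 0 < normc (1 + z / zeta).
  by rewrite lt_neqAle normc_ge0 andbT eq_sym; apply: contra d0 => /eqP/eq0_normc ->.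
set m := normc (1 + z / zeta) in dp.
exists (Num.min (m / 2) (e * m ^+ 2 / 4)).
  by rewrite lt_min !divr_gt0 ?mulr_gt0 ?exprn_gt0.
move=> h; rewrite lt_min => /andP[h1 h2].
have nh : normc (h / zeta) = normc h by rewrite normcM normcV z1 invr1 mulr1.
have d1 : m / 2 <= normc (1 + (z + h) / zeta).
  have := le_normcB (1 + z / zeta) (1 + (z + h) / zeta).
  have -> : 1 + z / zeta - (1 + (z + h) / zeta) = - (h / zeta) by ring.
  by rewrite normcN nh -/m; lra.
have d1' : 1 + (z + h) / zeta != 0.
  by apply/eqP => E; move: d1; rewrite E normc0; lra.
have E : (chart_inv zeta (z + h) - chart_inv zeta z) * ((1 + z / zeta) * (1 + (z + h) / zeta)) =
    (0 +i* 1) * (2%:R%:C * - (h / zeta)).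
  rewrite /chart_inv !rmorph_nat; move: d0 d1'; have -> : (z + h) / zeta = z / zeta + h / zeta by ring.
  by move: (z / zeta) (h / zeta) => s s' d0 d1'; field; rewrite d0 d1'.
have := congr1 (@normc R) E; rewrite !normcM normc_imag normr1 mul1r normcN normc_real -normcM nh ger0_norm//.
rewrite -/m => E'.
have := normc_ge0 (chart_inv zeta (z + h) - chart_inv zeta z); set X := normc _ in E' * => X0.
have m2 : 0 < m * (m / 2) by rewrite mulr_gt0 ?divr_gt0.
rewrite -(ler_pM2r m2).
apply: (@le_trans _ _ (2 * normc h)); last by lra.
by rewrite -E'; apply: ler_wpM2l => //; rewrite normcM ler_pM2l.
Qed.

(** The shells are the level sets of this function in the upper half-plane. *)
Definition maxnorm W : R := Num.max `|complex.Re W| (complex.Im W).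

Lemma maxnorm_lip W W' : `|maxnorm W - maxnorm W'| <= normc (W - W').
Proof.
have half a c : maxnorm a <= maxnorm c + normc (a - c).
  rewrite /maxnorm ge_max; apply/andP; split.
    have : `|complex.Re a| <= `|complex.Re c| + `|complex.Re (a - c)|.
      by rewrite raddfB /= -{1}(subrK (complex.Re c) (complex.Re a)) addrC ler_normD.
    have := normc_Re (a - c); have : `|complex.Re c| <= Num.max `|complex.Re c| (complex.Im c) by rewrite le_max lexx.
    lra.
  have := normc_Im (a - c); have := ler_norm (complex.Im (a - c)); rewrite raddfB /=.
  have : complex.Im c <= Num.max `|complex.Re c| (complex.Im c) by rewrite le_max lexx orbT.
  lra.
have := half W W'; have := half W' W; rewrite (distcC W') ler_norml => *.
by apply/andP; split; lra.
Qed.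

Lemma maxnorm_shell (r : R) W : maxnorm W = r -> on_shell r W.
Proof.
rewrite /maxnorm => <-; split; rewrite ?le_max ?lexx ?orbT//.
by case: leP => h; [right|left].
Qed.

Lemma chart_norm_lower zeta W (y : R) : normc zeta = 1 -> 0 <= complex.Im W -> complex.Im W <= y ->
  1 - 4 * y <= normc (chart zeta W) ^+ 2.
Proof.
move=> z1 y0 yy; have := chart_sqr z1 y0; have := chart_den_ge1 y0.
set d := normc (0 +i* 1 + W) => d1 E.
have d2 : 1 <= d ^+ 2 by rewrite exprn_ege1.
have d20 : 0 < d ^+ 2 by lra.
by rewrite -(ler_pM2r d20) E; nra.
Qed.

(** The image of a short shell lies close to a point [b] near the unit circle.  The
    points [w] such that [|w| <= 1 - e1] whose component along [b] is at most [1 - 3 l]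
    form a convex set, which contains [F 0] and avoids this image.  If this set
    contained the image of a point inside the shell, the preimage of a segment would
    join this point to [0] without crossing the shell.  So all the points inside the
    shell are mapped to the complementary cap. *)
Lemma boundary_oscillation F G (c e : R) : smooth_qc F G c -> 0 < e ->
  exists2 d, 0 < d <= 1 / 2 & forall zeta, normc zeta = 1 -> forall p q, D p -> D q ->
    maxnorm (chart_inv zeta p) < d -> maxnorm (chart_inv zeta q) < d -> normc (F p - F q) <= e.
Proof.
move=> qc e0; have D0 := disk0.
have F0 : normc (F 0) < 1 by exact: (qc_ran qc).
(* The second bound keeps [F 0] out of the cap. *)
pose l := Num.min (e ^+ 2 / 24) ((1 - normc (F 0)) / 3).
have l0 : 0 < l by rewrite lt_min !divr_gt0 ?exprn_gt0 ?subr_gt0.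
have le1 : 24 * l <= e ^+ 2.
  have : l <= e ^+ 2 / 24 by rewrite ge_min lexx.
  lra.
have lF0 : normc (F 0) <= 1 - 3 * l.
  have : l <= (1 - normc (F 0)) / 3 by rewrite ge_min lexx orbT.
  lra.
have [M HM] : exists M : nat, 8 * (2120 / (1 - c) ^+ 2) < l ^+ 2 * M%:R.
  exists (Num.truncn (8 * (2120 / (1 - c) ^+ 2) / l ^+ 2)).+1.
  by rewrite -ltr_pdivrMl ?exprn_gt0// (mulrC (_ ^- 2)) truncnS_gt.
exists (2 ^+ M.+1)^-1.
  rewrite invr_gt0 exprn_gt0//= exprS invfM div1r ler_piMr// invf_le1 ?exprn_gt0//.
  by rewrite -natrX ler1n expn_gt0.
move=> zeta z1 p q Dp Dq Np Nq.
have Fp : normc (F p) < 1 by exact: (qc_ran qc).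
have Fq : normc (F q) < 1 by exact: (qc_ran qc).
(* Unlike [l], the margin [e1] may depend on [p] and [q]. *)
pose e1 := Num.min (Num.min (l / 2) (1 - normc (F 0))) (Num.min (1 - normc (F p)) (1 - normc (F q))).
have e10 : 0 < e1 by rewrite !lt_min !subr_gt0 F0 Fp Fq divr_gt0.
have [e1l e1F0 e1p e1q] : [/\ e1 <= l / 2, e1 <= 1 - normc (F 0), e1 <= 1 - normc (F p) & e1 <= 1 - normc (F q)].
  by rewrite /e1; split; rewrite !ge_min lexx ?orbT.
have lt3 : 3 * l <= 1 by have := normc_ge0 (F 0); lra.
have [r' /andP[r'0 r'1] Gr'] : exists2 r', 0 <= r' < 1 & forall w, normc w <= 1 - e1 -> normc (G w) <= r'.
  by apply: (qc_max (qc_inv_cont qc) (qc_inv_ran qc)); lra.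
(* The height at which the shell is cut: below it, [|F|] exceeds [1 - e1]. *)
have [j Mj Hj] : exists2 j : nat, (M <= j)%N & 4 * (2 ^+ j.+1)^-1 < 1 - r' ^+ 2 :> R.
  have r2 : 0 < (1 - r' ^+ 2) / 4 by rewrite divr_gt0// subr_gt0 expr_lt1.
  pose j0 := Num.truncn ((1 - r' ^+ 2) / 4)^-1.
  exists (maxn M j0); first exact: leq_maxl.
  have H : (2 ^+ (maxn M j0).+1)^-1 < (1 - r' ^+ 2) / 4.
    rewrite invf_plt ?posrE ?exprn_gt0//; apply: (lt_le_trans (truncnS_gt _)).
    rewrite -natrX ler_nat; apply: (@leq_trans (maxn M j0).+1).
      by rewrite ltnS leq_maxr.
    by apply: ltnW; exact: ltn_expl.
  lra.
have [r [W0 [/andP[r1 r2] [bW0 iW0] shell]]] := short_shell qc z1 Mj l0 HM.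
set eta := (2 ^+ j.+1)^-1 in Hj iW0 shell.
have eta0 : 0 < eta by rewrite invr_gt0 exprn_gt0.
have low W : 0 <= complex.Im W -> complex.Im W <= eta -> r' < normc (chart zeta W).
  move=> y0 y1; have := chart_norm_lower z1 y0 y1 => h.
  by rewrite -(@ltr_pXn2r _ 2)// ?nnegrE ?normc_ge0//; lra.
have DW0 : D (chart zeta W0).
  by apply: (le_lt_trans (chart_norm z1 bW0)); rewrite iW0; lra.
set b := F (chart zeta W0) in shell.
have b1 : 1 - e1 < normc b.
  rewrite ltNge; apply/negP => /Gr'; rewrite /b (qc_can qc)//; apply/negP; rewrite -ltNge.
  by apply: low; rewrite iW0 ?lexx ?ltW.
have b0 : 0 < normc b by lra.
have main x : D x -> maxnorm (chart_inv zeta x) < (2 ^+ M.+1)^-1 -> normc (F x) <= 1 - e1 ->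
    (1 - 3 * l) * normc b < dotp (F x) b.
  move=> Dx Nx Fx; rewrite ltNge; apply/negP => Sx.
  (* Along the preimage of the segment from [F 0] to [F x], [maxnorm] goes from [1] to less
   than [r]. *)
pose N (w : R[i]) : R := - maxnorm (chart_inv zeta (G w)).
  have Dt t : 0 <= t <= 1 -> D (segment_pt (F 0) (F x) t) by move=> t01; apply: segment_pt_disk => //; exact: (qc_ran qc).
  have [||||t t01 Et] := @IVT_at _ (fun t => N (segment_pt (F 0) (F x) t)) 0 1 (- r).
  - exact: ler01.
  - move=> t t01; apply: continuous_segment_pt => e2 e20.
    have DG := qc_inv_ran qc (Dt _ t01).
    have e22 : 0 < e2 / 2 by lra.
    have [d2 d20 H2] := chart_inv_continuous z1 DG e22.
    have d22 : 0 < d2 / 2 by lra.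
    have [d3 d30 H3] := qc_inv_cont qc (Dt _ t01) d22.
    exists d3 => // v vd; rewrite /N -opprD normrN.
    apply: (le_lt_trans (maxnorm_lip _ _)).
    have := H3 _ vd; rewrite (addrC (segment_pt _ _ _)) subrK => h3.
    have := H2 (G v - G (segment_pt (F 0) (F x) t)); rewrite (addrC (G (segment_pt _ _ _))) subrK => h2.
    by apply: (le_lt_trans (h2 _)); lra.
  - rewrite segment_pt0 /N (qc_can qc)// lerN2.
    have -> : chart_inv zeta 0 = 0 +i* 1 by rewrite /chart_inv mul0r subr0 addr0 divr1 mulr1.
    by rewrite /maxnorm /= normr0 le_max; apply/orP; right; lra.
  - by rewrite segment_pt1 /N (qc_can qc)// lerN2; lra.
  set w := segment_pt _ _ _ in Et.
  have Dw : D w by exact: Dt.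
  have wS : dotp w b <= (1 - 3 * l) * normc b.
    rewrite dotp_segment_pt; move/andP: t01 => [t0 t1].
    have := dotp_le (F 0) b => h0.
    have h1 : dotp (F 0) b <= (1 - 3 * l) * normc b.
      by apply: (le_trans h0); rewrite ler_pM2r.
    have := ler_wpM2l t0 Sx; have t1' : 0 <= 1 - t by lra.
    by have := ler_wpM2l t1' h1; lra.
  have wn : normc w <= 1 - e1.
    apply: (le_trans (normc_segment_pt _ _ t01)); move/andP: t01 => [t0 t1].
    have t1' : 0 <= 1 - t by lra.
    have F0' : normc (F 0) <= 1 - e1 by lra.
    by have := ler_wpM2l t1' F0'; have := ler_wpM2l t0 Fx; lra.
  have DG := qc_inv_ran qc Dw.
  have := chart_inv_Im z1 DG; set W := chart_inv zeta (G w) => W0'.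
  have sW : on_shell r W by apply: maxnorm_shell; apply: oppr_inj.
  have cW : chart zeta W = G w by rewrite /W chart_invK.
  have [h|h] := leP eta (complex.Im W); last first.
    have := low _ (ltW W0') (ltW h); rewrite cW => hh.
    by have := Gr' _ wn; lra.
  have := shell _ h sW; rewrite cW (qc_inv_can qc)// => wb.
  have := dotp_le (b - w) b; rewrite dotpBl dotpp distcC => h1.
  have := ler_wpM2r (ltW b0) wb.
  by nra.
by apply: (cap_diameter (qc_ran qc Dp) (qc_ran qc Dq) b0 e0 le1); apply: main => //; lra.
Qed.

(** Near the circle one uses the oscillation in the chart centred at the radial
    projection of one of the two points; elsewhere, compactness. *)
Lemma qc_unif_continuous F G (c e : R) : smooth_qc F G c -> 0 < e ->
  exists2 d, 0 < d & forall p q, D p -> D q -> normc (q - p) < d -> normc (F q - F p) <= e.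
Proof.
move=> qc e0; have [d /andP[d0 d1] osc] := boundary_oscillation qc e0.
have r1 : 1 - d / 4 < 1 by lra.
have [d' d'0 inner] := qc_inner_unif_continuous qc r1 e0.
exists (Num.min d' (d / 4)); first by rewrite lt_min d'0; lra.
move=> p q Dp Dq; rewrite lt_min => /andP[pq1 pq2].
have [pr|pr] := leP (normc p) (1 - d / 4); first exact: inner.
have p0 : 0 < normc p by lra.
have p1 : normc p < 1 by [].
pose zeta : R[i] := (normc p)^-1%:C * p.
have z1 : normc zeta = 1 by rewrite /zeta normcM normc_real gtr0_norm ?invr_gt0// mulVf// gt_eqF.
have pz : normc (p - zeta) = 1 - normc p.
  have -> : p - zeta = (1 - (normc p)^-1)%:C * p by rewrite /zeta rmorphB rmorph1; ring.
  rewrite normcM normc_real ler0_norm; last by rewrite subr_le0 invf_ge1// ltW.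
  by field; rewrite gt_eqF.
have small x : normc (x - zeta) < d -> maxnorm (chart_inv zeta x) < d.
  move=> xz; apply: (le_lt_trans _ xz).
  have xz1 : normc (x - zeta) <= 1 by lra.
  apply: le_trans (chart_inv_small z1 xz1).
  rewrite /maxnorm ge_max normc_Re /=; apply: le_trans (normc_Im _); exact: ler_norm.
apply: (osc _ z1 _ _ Dq Dp); apply: small; last by rewrite pz; lra.
by have := normc_triangle p q zeta; rewrite pz; lra.
Qed.

End UniformContinuity.

(** * Separability *)

Section Separability.
Context {R : realType}.
Local Notation C := (R[i]^o).
Local Notation D := (unit_disk R).
Local Notation mu := (@lebesgue_measure R).
Implicit Types (z w v p q : R[i]) (f g : Q R).

Lemma plane_map_normc_continuous (f : disk R -> disk R) z : continuous f -> D z -> normc_continuous (plane_map f) z.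
Proof.
move=> cf Dz e e0; have [d d0 Hd] := plane_map_continuous cf Dz e0.
have [r r0 Hr] := disk_nbhd Dz; exists (Num.min d r); first by rewrite lt_min d0.
move=> h; rewrite lt_min => /andP[hd hr]; apply/ltW/Hd; first exact: Hr.
by rewrite addrC addKr.
Qed.

Lemma plane_mapK (f g : disk R -> disk R) z : cancel f g -> D z ->
  plane_map g (plane_map f z) = z.
Proof. by move=> fg Dz; rewrite (plane_mapE f Dz) plane_map_val fg. Qed.

Lemma wirtingerE (F : C -> C) z (a b c d : R) :
  axis_pd false (fun z => complex.Re (F z)) z = a -> axis_pd false (fun z => complex.Im (F z)) z = b ->
  axis_pd true (fun z => complex.Re (F z)) z = c -> axis_pd true (fun z => complex.Im (F z)) z = d ->
  wirtinger F z = ((a + d) / 2 +i* ((b - c) / 2)) /\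
  wirtinger_bar F z = ((a - d) / 2 +i* ((b + c) / 2)).
Proof.
move=> Ea Eb Ec Ed.
have ex : cpartialx F z = a +i* b by rewrite -Ea -Eb.
have ey : cpartialy F z = c +i* d by rewrite -Ec -Ed.
have two : (2 : R[i]) != 0 by rewrite pnatr_eq0.
rewrite /wirtinger /wirtinger_bar ex ey.
by split; apply: (canLR (mulfK two)); apply/eqP; rewrite eq_complex /=;
  apply/andP; split; apply/eqP; field.
Qed.

Lemma normc_sub_le (x y : R[i]) : `|normc x - normc y| <= normc (x - y).
Proof.
by rewrite ler_norml; have := le_normcB x y; have := le_normcB y x; rewrite (distcC y x) => *;
  apply/andP; split; lra.
Qed.

Lemma wirtinger_dist (a b c d a' b' c' d' e : R) : 0 < e ->
  `|a - a'| <= e / 4 -> `|b - b'| <= e / 4 -> `|c - c'| <= e / 4 -> `|d - d'| <= e / 4 ->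
  normc (((a + d) / 2 +i* ((b + c) / 2)) - ((a' + d') / 2 +i* ((b' + c') / 2))) < e.
Proof.
move=> e0 ha hb hc hd; apply: (le_lt_trans (normc_ReIm _)) => /=.
have -> : (a + d) / 2 - (a' + d') / 2 = ((a - a') + (d - d')) / 2 by field.
have -> : (b + c) / 2 - (b' + c') / 2 = ((b - b') + (c - c')) / 2 by field.
rewrite !normrM (gtr0_norm (_ : 0 < 2^-1))//.
by have := ler_normD (a - a') (d - d'); have := ler_normD (b - b') (c - c'); lra.
Qed.

Lemma wirtinger_continuous (F : C -> C) z (e : R) :
  C1_on D (fun z => complex.Re (F z)) -> C1_on D (fun z => complex.Im (F z)) -> D z -> 0 < e ->
  exists2 d, 0 < d & forall w, normc (w - z) < d ->
    [/\ D w, `|normc (wirtinger F w) - normc (wirtinger F z)| < e &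
    `|normc (wirtinger_bar F w) - normc (wirtinger_bar F z)| < e].
Proof.
move=> F1 F2 Dz e0; have e4 : 0 < e / 4 by lra.
have [r1 [r10 D1 H1]] := C1_locally unit_disk_open F1 Dz e4.
have [r2 [r20 D2 H2]] := C1_locally unit_disk_open F2 Dz e4.
exists (Num.min r1 r2); first by rewrite lt_min r10.
move=> w; rewrite lt_min => /andP[w1 w2].
have a := H1 _ w1 false; have c := H1 _ w1 true.
have b := H2 _ w2 false; have d := H2 _ w2 true.
have [W1 W2] := wirtingerE (F := F) (z := w) erefl erefl erefl erefl.
have [Z1 Z2] := wirtingerE (F := F) (z := z) erefl erefl erefl erefl.
rewrite W1 W2 Z1 Z2; split; first exact: D1.
- apply: (le_lt_trans (normc_sub_le _ _)); apply: wirtinger_dist => //.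
  by rewrite -opprD normrN.
- apply: (le_lt_trans (normc_sub_le _ _)); apply: wirtinger_dist => //.
  by rewrite -opprD normrN.
Qed.

Lemma strict_dilatation (a b a' b' c e : R) : 0 <= c -> c < 1 -> 0 < e ->
  e = (b - c * a) / 2 -> `|a' - a| < e -> `|b' - b| < e -> c * a' < b'.
Proof.
move=> c0 c1 e0 E; rewrite !ltr_norml => /andP[p1 p2] /andP[p3 p4].
have : c * (a' - a) <= e.
  apply: (@le_trans _ _ (c * e)); first by rewrite ler_wpM2l// ltW.
  by rewrite ler_piMl// ltW.
lra.
Qed.

(** The derivatives are continuous, so the inequality fails on an open set, and a
    nonempty open set contains a square of positive measure. *)
Lemma ae_dilatation (F : C -> C) (c : R) : 0 <= c < 1 ->
  C1_on D (fun z => complex.Re (F z)) -> C1_on D (fun z => complex.Im (F z)) ->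
  ae_on D (fun z => normc (wirtinger_bar F z) <= c * normc (wirtinger F z)) ->
  forall z, D z -> normc (wirtinger_bar F z) <= c * normc (wirtinger F z).
Proof.
move=> /andP[c0 c1] F1 F2 [N [mN N0 HN]] z Dz; rewrite leNgt; apply/negP => lt.
pose e := (normc (wirtinger_bar F z) - c * normc (wirtinger F z)) / 2.
have e0 : 0 < e by rewrite /e; lra.
have [d d0 Hd] := wirtinger_continuous F1 F2 Dz e0.
pose s := d / 2; have s0 : 0 < s by rewrite /s; lra.
have sub : square (complex.Re z, complex.Im z) s `<=` N.
  move=> q; rewrite /square /= !in_itv /= => -[/andP[x1 x2] /andP[y1 y2]].
  have qz : normc ((q.1 +i* q.2) - z) < d.
    apply: (le_lt_trans (normc_ReIm _)); rewrite !raddfB /=.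
    have : `|q.1 - complex.Re z| < s by rewrite ltr_norml; apply/andP; split; lra.
    have : `|q.2 - complex.Im z| < s by rewrite ltr_norml; apply/andP; split; lra.
    by rewrite /s; lra.
  have [Dq h1 h2] := Hd _ qz.
  apply: HN => /= /(_ Dq); apply/negP; rewrite -ltNge.
  exact: (strict_dilatation c0 c1 e0 erefl h1 h2).
have : ((mu \x mu) (square (complex.Re z, complex.Im z) s) <= (mu \x mu) N)%E.
  by apply: le_measure => //; rewrite inE//; exact: square_measurable.
rewrite N0 square_measure ?(ltW s0)// lee_fin leNgt exprn_gt0//.
by rewrite mulr_gt0.
Qed.

Lemma HQ_smooth_qc f : HQ R f -> exists G c, smooth_qc (plane_map f) G c.
Proof.
move=> [[/C2_onP[h1 _] _] [/C2_onP[h2 _] _]].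
have [K K1 [[cf [g [cg fg gf]]] _ _ dil]] := Q_quasiconformal f.
have c01 : 0 <= (K - 1) / (K + 1) < 1.
  rewrite ltr_pdivrMr; last lra.
  by rewrite divr_ge0 /=; lra.
exists (plane_map g), ((K - 1) / (K + 1)); split.
- by move=> z; exact: plane_map_disk.
- by move=> z; exact: plane_map_disk.
- by move=> z; exact: plane_mapK.
- by move=> z; exact: plane_mapK.
- by move=> z; exact: plane_map_normc_continuous.
- by move=> z; exact: plane_map_normc_continuous.
- exact: h1.
- exact: h2.
- exact: c01.
- exact: (ae_dilatation c01 h1 h2 dil).
Qed.

Lemma HQ_unif_continuous f (e : R) : HQ R f -> 0 < e ->
  exists2 d, 0 < d & forall p q, D p -> D q -> normc (q - p) < d ->
    normc (plane_map f q - plane_map f p) <= e.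
Proof. by move=> /HQ_smooth_qc[G [c qc]]; exact: qc_unif_continuous qc. Qed.

Definition cell (K : nat) p : nat * nat :=
  (Num.truncn (K%:R * (complex.Re p + 1)), Num.truncn (K%:R * (complex.Im p + 1))).

Lemma cell_coord (K : nat) (x : R) : (0 < K)%N -> -1 < x -> x < 1 ->
  (Num.truncn (K%:R * (x + 1)) < 2 * K)%N.
Proof.
move=> K0 x0 x1; have KR : 0 < K%:R :> R by rewrite ltr0n.
rewrite truncn_lt_nat; last by apply: mulr_ge0; lra.
by rewrite natrM mulrC ltr_pM2r//; lra.
Qed.

Lemma cell_coord_near (K : nat) (x y : R) : (0 < K)%N -> -1 < x -> -1 < y ->
  Num.truncn (K%:R * (x + 1)) = Num.truncn (K%:R * (y + 1)) -> `|x - y| < K%:R^-1.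
Proof.
move=> K0 x0 y0 E; have KR : 0 < K%:R :> R by rewrite ltr0n.
have /truncn_itv/andP[a1 a2] : 0 <= K%:R * (x + 1) by apply: mulr_ge0; lra.
have /truncn_itv/andP[b1 b2] : 0 <= K%:R * (y + 1) by apply: mulr_ge0; lra.
rewrite -E in b1 b2; rewrite -natr1 in a2 b2.
rewrite -(ltr_pM2l KR) mulfV ?gt_eqF// -[X in X * _](gtr0_norm KR) -normrM ltr_norml.
by apply/andP; split; lra.
Qed.

Lemma disk_coord p : D p -> [/\ -1 < complex.Re p, complex.Re p < 1, -1 < complex.Im p & complex.Im p < 1].
Proof.
move=> Dp; have := le_lt_trans (normc_Re _) Dp; have := le_lt_trans (normc_Im _) Dp.
by rewrite !ltr_norml => /andP[? ?] /andP[? ?].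
Qed.

Lemma cell_near (K : nat) p q : (0 < K)%N -> D p -> D q -> cell K p = cell K q ->
  normc (q - p) < 2 / K%:R.
Proof.
move=> K0 /disk_coord[x1 _ y1 _] /disk_coord[x2 _ y2 _] [Ex Ey].
have hx := cell_coord_near K0 x1 x2 Ex; have hy := cell_coord_near K0 y1 y2 Ey.
rewrite distcC; apply: (le_lt_trans (normc_ReIm _)); rewrite !raddfB /=; lra.
Qed.

Definition cell_indices (K : nat) : seq (nat * nat) :=
  [seq (i, j) | i <- iota 0 (2 * K), j <- iota 0 (2 * K)].

Lemma cell_in (K : nat) p : (0 < K)%N -> D p -> cell K p \in cell_indices K.
Proof.
move=> K0 /disk_coord[x1 x2 y1 y2]; apply/allpairsP.
by exists (cell K p) => /=; rewrite !mem_iota !add0n !cell_coord.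
Qed.

(** A cell that misses the disk gets the sample point [0], so that sample points always
    belong to the disk. *)
Definition sample (K : nat) (ij : nat * nat) : R[i] :=
  xget (0 : C) [set p : C | D p /\ cell K p = ij].

Lemma sample_disk K ij : D (sample K ij).
Proof. by rewrite /sample; case: xgetP => [p _ []|_]; [|exact: disk0]. Qed.

Lemma sample_cell K p : D p -> cell K (sample K (cell K p)) = cell K p.
Proof. by move=> Dp; have [] := @xgetI C 0 [set q : C | D q /\ cell K q = cell K p] p (conj Dp erefl). Qed.

Definition rounding (n : nat) (w : R[i]) : int * int :=
  (Num.floor (n.+1%:R * complex.Re w), Num.floor (n.+1%:R * complex.Im w)).

Lemma floor_eq_near (N x y : R) : 0 < N -> Num.floor (N * x) = Num.floor (N * y) -> `|x - y| < N^-1.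
Proof.
move=> N0 E; rewrite -(ltr_pM2l N0) mulfV ?gt_eqF// -[X in X * _](gtr0_norm N0) -normrM ltr_norml.
have := floor_le_tmp (N * x); have := floorD1_gt (N * x).
have := floor_le_tmp (N * y); have := floorD1_gt (N * y).
by rewrite E intrD1 => *; apply/andP; split; lra.
Qed.

Lemma rounding_near n w w' : rounding n w = rounding n w' -> normc (w - w') < 2 / n.+1%:R.
Proof.
move=> [Ex Ey]; have n0 : 0 < n.+1%:R :> R by rewrite ltr0n.
have hx := floor_eq_near n0 Ex; have hy := floor_eq_near n0 Ey.
apply: (le_lt_trans (normc_ReIm _)); rewrite !raddfB /=.
by move: hx hy; move: (n.+1%:R^-1) => N hx hy; lra.
Qed.

Definition samples (n K : nat) f : seq (int * int) :=
  [seq rounding n (plane_map f (sample K ij)) | ij <- cell_indices K].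

Lemma HQ_mesh f n : HQ R f -> exists K : nat, (0 < K)%N /\ forall p q, D p -> D q -> cell K p = cell K q ->
  normc (plane_map f q - plane_map f p) <= n.+1%:R^-1.
Proof.
move=> Hf; have n0 : 0 < n.+1%:R^-1 :> R by rewrite invr_gt0 ltr0n.
have [d d0 Hd] := HQ_unif_continuous Hf n0.
exists (Num.truncn (2 / d)).+1; split => // p q Dp Dq E; apply: Hd => //.
apply: (lt_trans (cell_near _ Dp Dq E)) => //.
by rewrite ltr_pdivrMr ?ltr0n// -ltr_pdivrMl// mulrC truncnS_gt.
Qed.

Lemma samples_near n K f g : (0 < K)%N ->
  (forall p q, D p -> D q -> cell K p = cell K q ->
     normc (plane_map f q - plane_map f p) <= n.+1%:R^-1) ->
  (forall p q, D p -> D q -> cell K p = cell K q ->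
     normc (plane_map g q - plane_map g p) <= n.+1%:R^-1) ->
  samples n K f = samples n K g -> d_sup f g <= 4 / n.+1%:R.
Proof.
move=> K0 Hf Hg /eq_in_map E; apply: d_sup_le => p Dp.
have := rounding_near (E _ (cell_in K0 Dp)).
set s := sample K (cell K p) => h.
have Ds : D s by exact: sample_disk.
have sE : cell K s = cell K p by exact: sample_cell.
have := Hf _ _ Ds Dp sE; have := Hg _ _ Dp Ds (esym sE).
have := normc_triangle (plane_map f s) (plane_map f p) (plane_map g p).
have := normc_triangle (plane_map g s) (plane_map f s) (plane_map g p).
by move: (n.+1%:R^-1) h => N h; lra.
Qed.

(** A uniformly continuous map is known up to a given error from a mesh adapted to its
    modulus of continuity and from its rounded values at one point per cell.  These
    data range over a countable type; one map is picked for each value that they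
    take. *)
Lemma HQ_separable : separable (set_type (HQ R)).
Proof.
have norm0 : `|0 : R| < 1 by rewrite normr0.
pose T := set_type (HQ R).
pose x0 : T := exist _ (mobius_Q norm0) (mem_set (mobius_HQ norm0)).
have HT (f : T) : HQ R (set_val f) by exact: (set_mem (valP f)).
have [mesh Hmesh] := choice (fun fn : T * nat => HQ_mesh fn.2 (HT fn.1)).
pose code (n : nat) (f : T) := (mesh (f, n), samples n (mesh (f, n)) (set_val f)).
pose pick (c : nat * (nat * seq (int * int))) : T := xget x0 [set f | code c.1 f = c.2].
exists (range pick).
  apply: (sub_countable (card_image_le _ _)); exact: countableP.
move=> O [x Ox] oO.
have [U [[V oV <-] /= Vx] VO] : nbhs x O by exact: open_nbhs_nbhs.
have [e e0 eV] : exists2 e : R, 0 < e & ball (set_val x) e `<=` V.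
  by apply/nbhs_ballP; exact: open_nbhs_nbhs.
pose n := Num.truncn (4 / e).
pose y := pick (n, code n x).
have yx : code n y = code n x by exact: (@xgetI T x0 [set f | code n f = code n x] x erefl).
exists y; split; last by exists (n, code n x).
apply: VO => /=; apply: eV; apply/Q_ballE.
have [Ek Es] : mesh (y, n) = mesh (x, n) /\ samples n (mesh (y, n)) (set_val y) = samples n (mesh (x, n)) (set_val x).
  by case: yx.
have [K0 Hx] := Hmesh (x, n); have [_ Hy] := Hmesh (y, n).
rewrite /= Ek in Hx Hy K0 Es.
apply: (le_lt_trans (samples_near K0 Hx Hy (esym Es))).
by rewrite ltr_pdivrMr ?ltr0n// -ltr_pdivrMl// mulrC truncnS_gt.
Qed.

End Separability.

Theorem theorem3p2 (R : realType) :
  [/\ separable (set_type (HQ R)),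
      ~ compact [set: set_type (HQ R)] &
      closed (HQ R)].
Proof.
split; [exact: HQ_separable|exact: HQ_not_compact|exact: HQ_closed].
Qed.
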